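(* Let $H$ be a coquasi-Hopf algebra with bijective antipode, $A$ a right $H$-comodule algebra and $B=A^{coH}$ the algebra of coinvariants. Then the following are equivalent: (1) $A$ is faithfully flat as a left $B$-module, and $A$ is a Galois extension of $B$; (2) the functor of coinvariants $(-)^{coH}:\mathcal{M}_A^H\to\mathcal{M}_B$ and the induction functor $(-)\otimes_BA:\mathcal{M}_B\to\mathcal{M}_A^H$ are a pair of inverse equivalences between $\mathcal{M}_A^H$ and $\mathcal{M}_B$.
   Context: Everything is over a field $k$; $\otimes=\otimes_k$. Sweedler notation: $\Delta(h)=h_1\otimes h_2$ (summation suppressed); for a right comodule, $\rho(m)=m_0\otimes m_1$, iterated as $m_0\otimes m_1\otimes m_2$, etc. A coquasi-bialgebra is a coassociative counital coalgebra $(H,\Delta,\varepsilon)$ with coalgebra morphisms $H\otimes H\to H$, $h\otimes g\mapsto hg$, and $k\to H$, $1\mapsto 1_H$, and a convolution invertible $\omega\in(H\otimes H\otimes H)^*$ such that for all $h,g,x,y\in H$: $h_1(g_1x_1)\omega(h_2,g_2,x_2)=\omega(h_1,g_1,x_1)(h_2g_2)x_2$; $1_Hh=h1_H=h$; $\omega(h_1,g_1,x_1y_1)\omega(h_2g_2,x_2,y_2)=\omega(g_1,x_1,y_1)\omega(h_1,g_2x_2,y_2)\omega(h_2,g_3,x_3)$; $\omega(h,1_H,g)=\varepsilon(h)\varepsilon(g)$. A coquasi-Hopf algebra is a coquasi-bialgebra with a coalgebra antihomomorphism $S:H\to H$ (antipode) and $\alpha,\beta\in H^*$ such that $S(h_1)\alpha(h_2)h_3=\alpha(h)1_H$,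 $h_1\beta(h_2)S(h_3)=\beta(h)1_H$, $\omega(h_1\beta(h_2),S(h_3),\alpha(h_4)h_5)=\omega^{-1}(S(h_1),\alpha(h_2)h_3\beta(h_4),S(h_5))=\varepsilon(h)$. The triple $(S,\alpha,\beta)$ is fixed and normalized by $\alpha(1_H)=\beta(1_H)=1$. A right $H$-comodule algebra is a right $H$-comodule $A$ with a multiplication and an element $1_A$ such that $\rho(ab)=a_0b_0\otimes a_1b_1$, $\rho(1_A)=1_A\otimes 1_H$, $1_Aa=a=a1_A$, $(ab)c=a_0(b_0c_0)\omega(a_1,b_1,c_1)$. $B=A^{coH}=\{a\in A:\rho(a)=a\otimes 1_H\}$ is an associative unital algebra, and $A$ is a $B$-bimodule by multiplication. $\mathcal{M}_A^H$ (right relative Hopf modules): right $H$-comodules $M$ with a right action $M\otimes A\to M$ satisfying $\rho(ma)=m_0a_0\otimes m_1a_1$, $m1_A=m$, $(ma)b=m_0(a_0b_0)\omega(m_1,a_1,b_1)$; morphisms are the $H$-colinear maps respecting the action. $M^{coH}=\{m:\rho(m)=m\otimes1_H\}$ is a right $B$-module. For $N\in\mathcal{M}_B$ (right $B$-modules), $N\otimes_BA\in\mathcal{M}_A^H$ by $\rho(n\otimes_Ba)=n\otimes_Ba_0\otimes a_1$, $(n\otimes_Ba)b=n\otimes_Bab$. The functor $(-)\otimes_BA$ is left adjoint to $(-)^{coH}$, with counit $\varepsilon_M(m\otimes_Ba)=ma$ and unit $u_N(n)=n\otimes_B1_A$. $B\subseteq A$ is a Galois extension if the map $can:A\otimes_BA\to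 A\otimes H$, $can(a\otimes_Bb)=a_0b_0\otimes b_4\,\omega^{-1}(a_1,b_1\beta(b_2),S(b_3))$, is bijective. *)

(* Defs.v *)
From HB Require Import structures.
From mathcomp Require Import all_boot all_algebra.
From mathcomp Require Import boolp.

Set Implicit Arguments.
Unset Strict Implicit.
Unset Printing Implicit Defensive.

Import GRing.Theory.
Local Open Scope ring_scope.
Local Open Scope quotient_scope.

Section TensorRelation.
Variables (k : fieldType) (R : Type) (M : zmodType) (N : lmodType k).
Variables (ra : M -> R -> M) (la : R -> {linear N -> N}).

(* A list of pairs (m_i, n_i) stands for the formal sum of the m_i (x) n_i. *)
Inductive tens_rel : seq (M * N) -> seq (M * N) -> Prop :=
| tens_rel_refl s : tens_rel s s
| tens_rel_sym s t : tens_rel s t -> tens_rel t s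
| tens_rel_trans s t u : tens_rel s t -> tens_rel t u -> tens_rel s u
| tens_rel_cat s s' t t' :
    tens_rel s s' -> tens_rel t t' -> tens_rel (s ++ t) (s' ++ t')
| tens_rel_swap s t : tens_rel (s ++ t) (t ++ s)
| tens_rel_addl m m' n : tens_rel [:: (m + m', n)] [:: (m, n); (m', n)]
| tens_rel_addr m n n' : tens_rel [:: (m, n + n')] [:: (m, n); (m, n')]
| tens_rel_zero m : tens_rel [:: (m, 0)] [::]
| tens_rel_bal m r n : tens_rel [:: (ra m r, n)] [:: (m, la r n)].

Definition tens_relb : rel (seq (M * N)) := fun s t => `[< tens_rel s t >].

Lemma tens_relb_equiv : equiv_class_of tens_relb.
Proof.
split.
- by move=> s; apply/asboolP; apply: tens_rel_refl.
- by move=> s t; apply/asboolP/asboolP; apply: tens_rel_sym.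
- move=> s t u /asboolP st /asboolP tu; apply/asboolP.
  exact: tens_rel_trans st tu.
Qed.

Canonical tens_equiv := EquivRelPack tens_relb_equiv.

End TensorRelation.

(* The tensor product over R of a right R-module M (with action ra) and a left
   R-module N (with action la by k-linear maps), with the k-vector space
   structure coming from N. *)
Definition tens (k : fieldType) (R : Type) (M : zmodType) (N : lmodType k)
    (ra : M -> R -> M) (la : R -> {linear N -> N}) : Type :=
  {eq_quot tens_equiv ra la}.

Section Tensor.
Variables (k : fieldType) (R : Type) (M : zmodType) (N : lmodType k).
Variables (ra : M -> R -> M) (la : R -> {linear N -> N}).

Local Notation T := (tens ra la).
Local Notation rl := (tens_rel ra la).

HB.instance Definition _ := Choice.copy T {eq_quot tens_equiv ra la}.
HB.instance Definition _ := EqQuotient.copy T {eq_quot tens_equiv ra la}.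

Definition terms (t : T) : seq (M * N) := repr t.
Definition tsum_of (s : seq (M * N)) : T := \pi_T s.
Definition pure (m : M) (n : N) : T := tsum_of [:: (m, n)].

Lemma tsum_ofP s t : tsum_of s = tsum_of t <-> rl s t.
Proof.
split=> [/eqquotP/asboolP //|st].
by apply/eqquotP/asboolP.
Qed.

Lemma termsK : cancel terms tsum_of.
Proof. exact: reprK. Qed.

Lemma tsum_terms s : rl (terms (tsum_of s)) s.
Proof. by apply/tsum_ofP; rewrite termsK. Qed.

Let tadd (t u : T) : T := tsum_of (terms t ++ terms u).
Let scl (c : k) (s : seq (M * N)) := [seq (p.1, c *: p.2) | p <- s].
Let tscale (c : k) (t : T) : T := tsum_of (scl c (terms t)).

Lemma tens_rel_scale c s t :
  rl s t -> rl [seq (p.1, c *: p.2) | p <- s] [seq (p.1, c *: p.2) | p <- t].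
Proof.
elim=> {s t}.
- by move=> s; apply: tens_rel_refl.
- by move=> s t _; apply: tens_rel_sym.
- by move=> s t u _ st _; apply: tens_rel_trans.
- by move=> s s' t t' _ ss _ tt; rewrite !map_cat; apply: tens_rel_cat.
- by move=> s t; rewrite !map_cat; apply: tens_rel_swap.
- by move=> m m' n; apply: tens_rel_addl.
- by move=> m n n' /=; rewrite scalerDr; apply: tens_rel_addr.
- by move=> m /=; rewrite scaler0; apply: tens_rel_zero.
- by move=> m r n /=; rewrite -linearZ; apply: tens_rel_bal.
Qed.

Let taddE s t : tadd (tsum_of s) (tsum_of t) = tsum_of (s ++ t).
Proof. by apply/tsum_ofP; apply: tens_rel_cat; apply: tsum_terms. Qed.

Let tscaleE c s : tscale c (tsum_of s) = tsum_of (scl c s).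
Proof. by apply/tsum_ofP; apply: tens_rel_scale; apply: tsum_terms. Qed.

Let taddA : associative tadd.
Proof.
move=> x y z; rewrite -[x]termsK -[y]termsK -[z]termsK.
by rewrite !taddE catA.
Qed.

Let taddC : commutative tadd.
Proof. by move=> x y; apply/tsum_ofP; apply: tens_rel_swap. Qed.

Let tadd0 : left_id (tsum_of [::]) tadd.
Proof. by move=> x; rewrite -[x]termsK taddE. Qed.

Let taddN : left_inverse (tsum_of [::]) (tscale (-1)) tadd.
Proof.
move=> x; rewrite -[x]termsK tscaleE taddE; apply/tsum_ofP.
elim: (terms x) => [|[m n] s IHs] /=; first exact: tens_rel_refl.
have step u v : rl ((u ++ [:: (m, n)]) ++ v) ([:: (m, n)] ++ u ++ v).
  rewrite catA; apply: tens_rel_cat; last exact: tens_rel_refl.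
  exact: tens_rel_swap.
rewrite -cat1s; apply: (@tens_rel_trans _ _ _ _ _ _ _ (([:: (m, -1 *: n)] ++
  [:: (m, n)]) ++ (scl (-1) s ++ s))); last first.
  rewrite -[[::]]/([::] ++ [::]); apply: tens_rel_cat => //.
  apply: (@tens_rel_trans _ _ _ _ _ _ _ [:: (m, -1 *: n + n)]).
    by apply: tens_rel_sym; apply: tens_rel_addr.
  by rewrite scaleN1r addNr; apply: tens_rel_zero.
rewrite -catA; apply: tens_rel_cat; first exact: tens_rel_refl.
by rewrite -(cat1s _ s) catA; apply: step.
Qed.

HB.instance Definition _ := GRing.isZmodule.Build T taddA taddC tadd0 taddN.

Let tscaleA c d t : tscale c (tscale d t) = tscale (c * d) t.
Proof.
rewrite -[t]termsK !tscaleE /scl -map_comp; congr tsum_of.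
by apply: eq_map => p /=; rewrite scalerA.
Qed.

Let tscale1 : left_id 1 tscale.
Proof.
move=> t; rewrite -[t]termsK !tscaleE /scl; congr tsum_of.
by rewrite -[RHS]map_id; apply: eq_map => -[m n] /=; rewrite scale1r.
Qed.

Let tscaleDr : right_distributive tscale +%R.
Proof.
move=> c x y; rewrite -[x]termsK -[y]termsK.
by rewrite -[_ + _]/(tadd _ _) taddE !tscaleE -[RHS]/(tadd _ _) taddE /scl map_cat.
Qed.

Let tscaleDl t : {morph tscale^~ t : c d / c + d}.
Proof.
move=> c d; rewrite -[t]termsK !tscaleE -[RHS]/(tadd _ _) taddE; apply/tsum_ofP.
have mid (p q : M * N) u v : rl ([:: p; q] ++ (u ++ v)) ((p :: u) ++ (q :: v)).
  rewrite -(cat1s p u) -(cat1s q v) -(cat1s p [:: q]) -!catA.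
  apply: tens_rel_cat; first exact: tens_rel_refl.
  rewrite !catA; apply: tens_rel_cat; last exact: tens_rel_refl.
  exact: tens_rel_swap.
elim: (terms t) => [|[m n] s IHs]; first exact: tens_rel_refl.
apply: (tens_rel_trans _ (mid _ _ _ _)).
rewrite -[scl _ _]/([:: (m, (c + d) *: n)] ++ scl (c + d) s).
by apply: tens_rel_cat => //; rewrite scalerDl; apply: tens_rel_addr.
Qed.

HB.instance Definition _ :=
  GRing.Zmodule_isLmodule.Build k T tscaleA tscale1 tscaleDr tscaleDl.

Lemma tsum_ofE s : tsum_of s = \sum_(p <- s) pure p.1 p.2.
Proof.
elim: s => [|[m n] s IHs]; first by rewrite big_nil.
by rewrite big_cons -IHs -[RHS]/(tadd _ _) taddE.
Qed.

Lemma pureDl m m' n : pure (m + m') n = pure m n + pure m' n.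
Proof.
by rewrite -[RHS]/(tadd _ _) taddE; apply/tsum_ofP; apply: tens_rel_addl.
Qed.

Lemma pureDr m n n' : pure m (n + n') = pure m n + pure m n'.
Proof.
by rewrite -[RHS]/(tadd _ _) taddE; apply/tsum_ofP; apply: tens_rel_addr.
Qed.

Lemma pureZr c m n : pure m (c *: n) = c *: pure m n.
Proof. by rewrite -[RHS]/(tscale _ _) tscaleE. Qed.

Lemma pure_bal m r n : pure (ra m r) n = pure m (la r n).
Proof. by apply/tsum_ofP; apply: tens_rel_bal. Qed.

(* If f is balanced, this is the map induced by f on the tensor product; it
   does not then depend on the chosen representatives (tlift_pure). *)
Definition tlift (V : zmodType) (f : M -> N -> V) (t : T) : V :=
  \sum_(p <- terms t) f p.1 p.2.

Definition balanced (V : lmodType k) (f : M -> N -> V) : Prop :=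
  [/\ forall m m' n, f (m + m') n = f m n + f m' n,
      forall m, linear (f m)
    & forall m r n, f (ra m r) n = f m (la r n)].

Section Lift.
Variables (V : lmodType k) (f : M -> N -> V).
Hypothesis fP : balanced f.

Lemma tens_rel_lift s t :
  rl s t -> \sum_(p <- s) f p.1 p.2 = \sum_(p <- t) f p.1 p.2.
Proof.
case: fP => fDl fL fB.
have fDr m n n' : f m (n + n') = f m n + f m n' by rewrite -[n]scale1r fL !scale1r.
have f0 m : f m 0 = 0.
  by apply: (@addIr _ (f m 0)); rewrite -fDr !add0r.
elim=> {s t} //.
- by move=> s t u _ -> _ ->.
- by move=> s s' t t' _ ss _ tt; rewrite !big_cat ss tt.
- by move=> s t; rewrite !big_cat /= addrC.
- by move=> m m' n; rewrite !big_cons !big_nil !addr0 fDl.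
- by move=> m n n'; rewrite !big_cons !big_nil !addr0 fDr.
- by move=> m; rewrite big_cons big_nil f0 addr0.
- by move=> m r n; rewrite !big_cons !big_nil fB.
Qed.

Lemma tlift_sum s : tlift f (tsum_of s) = \sum_(p <- s) f p.1 p.2.
Proof. by apply: tens_rel_lift; apply: tsum_terms. Qed.

Lemma tlift_pure m n : tlift f (pure m n) = f m n.
Proof. by rewrite tlift_sum big_seq1. Qed.

Lemma tlift_is_linear : linear (tlift f).
Proof.
case: fP => _ fL _ c t u.
have f0 m : f m 0 = 0 by have := fL m (-1) 0 0; rewrite scaler0 addr0 scaleN1r addNr.
rewrite -[t]termsK -[u]termsK.
rewrite -[c *: _]/(tscale _ _) tscaleE -[_ + tsum_of _]/(tadd _ _) taddE.
rewrite !tlift_sum big_cat big_map scaler_sumr; congr (_ + _).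
by apply: eq_bigr => p _ /=; have := fL p.1 c p.2 0; rewrite f0 !addr0.
Qed.

Definition tlin : {linear T -> V} :=
  HB.pack (tlift f) (GRing.isLinear.Build k T V *:%R (tlift f) tlift_is_linear).

End Lift.

Lemma tliftE (V : lmodType k) (g : {linear T -> V}) t :
  tlift (fun m n => g (pure m n)) t = g t.
Proof. by rewrite -[in RHS](termsK t) tsum_ofE linear_sum. Qed.

End Tensor.

(* If t = \sum_i x_i (x) y_i, this is \sum_i E x_i y_i; nested, it renders
   Sweedler notation. *)
Notation "\tsum_ ( x , y <- t ) E" := (tlift (fun x y => E) t)
  (at level 41, E at level 41, x name, y name, t at level 50,
   format "'[' \tsum_ ( x ,  y  <-  t ) '/  '  E ']'") : ring_scope.

Definition kact (k : fieldType) (M : lmodType k) (m : M) (c : k) : M := c *: m.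
Definition kscale (k : fieldType) (N : lmodType k) (c : k) : {linear N -> N} :=
  *:%R c.

(* The tensor product over k: a type in type_scope, a pure tensor in ring_scope. *)
Notation "M ⊗ N" := (tens (@kact _ M) (@kscale _ N))
  (at level 40, left associativity) : type_scope.
Notation "m ⊗ n" := (pure (@kact _ _) (@kscale _ _) m n)
  (at level 40, left associativity) : ring_scope.

Section TensorField.
Variables (k : fieldType) (M N : lmodType k).

Lemma pureZl (c : k) (m : M) (n : N) : (c *: m) ⊗ n = c *: (m ⊗ n).
Proof. by rewrite -pureZr -[RHS]pure_bal. Qed.

Lemma kbalanced (V : lmodType k) (f : M -> N -> V) :
  (forall n, linear (f^~ n)) -> (forall m, linear (f m)) ->
  balanced (@kact _ M) (@kscale _ N) f.
Proof.
move=> fl fr; split=> [m m' n|m c n n'|m c n].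
- by have := fl n 1 m m'; rewrite /= !scale1r.
- exact: fr.
- have fl0 : f 0 n = 0.
    by have := fl n (-1) 0 0; rewrite /= scaler0 addr0 scaleN1r addNr.
  have fr0 : f m 0 = 0.
    by have := fr m (-1) 0 0; rewrite /= scaler0 addr0 scaleN1r addNr.
  have := fl n c m 0; have := fr m c n 0.
  by rewrite /= fl0 fr0 !addr0 => -> ->.
Qed.

End TensorField.

Lemma balanced_tlift (k : fieldType) (R R' : Type) (M M' : zmodType)
    (N N' : lmodType k) (ra : M -> R -> M) (la : R -> {linear N -> N})
    (ra' : M' -> R' -> M') (la' : R' -> {linear N' -> N'}) (V : lmodType k)
    (f : M -> N -> M' -> N' -> V) (t : tens ra' la') :
  (forall p q, balanced ra la (fun m n => f m n p q)) ->
  balanced ra la (fun m n => \tsum_(p, q <- t) f m n p q).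
Proof.
move=> fP; split=> [m m' n|m c n n'|m c n]; rewrite /tlift.
- by rewrite -big_split; apply: eq_bigr => -[p q] _; case: (fP p q).
- rewrite scaler_sumr -big_split.
  by apply: eq_bigr => -[p q] _; case: (fP p q) => _ fL _; apply: fL.
- by apply: eq_bigr => -[p q] _; case: (fP p q).
Qed.

Record coalgebra (k : fieldType) := Coalgebra {
  coalg_sort :> lmodType k;
  comul : {linear coalg_sort -> (coalg_sort ⊗ coalg_sort)%type};
  counit : {scalar coalg_sort};
  comulA : forall h,
    \tsum_(x, y <- comul h) \tsum_(y1, y2 <- comul y) x ⊗ (y1 ⊗ y2) =
    \tsum_(x, y <- comul h) \tsum_(x1, x2 <- comul x) x1 ⊗ (x2 ⊗ y);
  counitl : forall h, \tsum_(x, y <- comul h) counit x *: y = h;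
  counitr : forall h, \tsum_(x, y <- comul h) counit y *: x = h
}.

Section Sweedler.
Variables (k : fieldType) (C : coalgebra k) (V : zmodType).

(* Iterated comultiplication h_1 (x) h_2 (x) ..., nested to the right. *)
Definition sw2 (h : C) (f : C -> C -> V) : V :=
  \tsum_(x, y <- comul C h) f x y.
Definition sw3 (h : C) (f : C -> C -> C -> V) : V :=
  sw2 h (fun h1 h' => sw2 h' (f h1)).
Definition sw4 (h : C) (f : C -> C -> C -> C -> V) : V :=
  sw2 h (fun h1 h' => sw3 h' (f h1)).
Definition sw5 (h : C) (f : C -> C -> C -> C -> C -> V) : V :=
  sw2 h (fun h1 h' => sw4 h' (f h1)).

End Sweedler.

Notation "\sw_ ( x , y <- h ) E" := (sw2 h (fun x y => E))
  (at level 41, E at level 41, x name, y name, h at level 50,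
   format "'[' \sw_ ( x ,  y  <-  h ) '/  '  E ']'") : ring_scope.
Notation "\sw_ ( x , y , z <- h ) E" := (sw3 h (fun x y z => E))
  (at level 41, E at level 41, x name, y name, z name, h at level 50,
   format "'[' \sw_ ( x ,  y ,  z  <-  h ) '/  '  E ']'") : ring_scope.
Notation "\sw_ ( x , y , z , t <- h ) E" := (sw4 h (fun x y z t => E))
  (at level 41, E at level 41, x name, y name, z name, t name, h at level 50,
   format "'[' \sw_ ( x ,  y ,  z ,  t  <-  h ) '/  '  E ']'") : ring_scope.
Notation "\sw_ ( x , y , z , t , u <- h ) E" := (sw5 h (fun x y z t u => E))
  (at level 41, E at level 41, x name, y name, z name, t name, u name,
   h at level 50,
   format "'[' \sw_ ( x ,  y ,  z ,  t ,  u  <-  h ) '/  '  E ']'") : ring_scope.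

(* omegaVT is the convolution inverse of omegaT (omega_convr, omega_convl). *)
Record cqb_data (k : fieldType) := CqbData {
  cqb_coalg :> coalgebra k;
  hmulT : {linear (cqb_coalg ⊗ cqb_coalg)%type -> cqb_coalg};
  hone : cqb_coalg;
  omegaT : {scalar (cqb_coalg ⊗ cqb_coalg ⊗ cqb_coalg)%type};
  omegaVT : {scalar (cqb_coalg ⊗ cqb_coalg ⊗ cqb_coalg)%type}
}.
Arguments hone {k}.

Section CqbNotations.
Variables (k : fieldType) (H : cqb_data k).
Definition eps (h : H) : k := counit H h.
Definition hmul (h g : H) : H := hmulT H (h ⊗ g).
Definition omega (h g x : H) : k := omegaT H (h ⊗ g ⊗ x).
Definition omegaV (h g x : H) : k := omegaVT H (h ⊗ g ⊗ x).
End CqbNotations.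

Notation "h ⋅ g" := (hmul h g) (at level 39, left associativity) : ring_scope.

Record cqb_axioms (k : fieldType) (H : cqb_data k) : Prop := {
  comul_mul : forall h g : H, comul H (h ⋅ g) =
    \sw_(h1, h2 <- h) \sw_(g1, g2 <- g) (h1 ⋅ g1) ⊗ (h2 ⋅ g2);
  eps_mul : forall h g : H, eps (h ⋅ g) = eps h * eps g;
  comul_one : comul H (hone H) = hone H ⊗ hone H;
  eps_one : eps (hone H) = 1;
  omega_convr : forall h g x : H,
    \sw_(h1, h2 <- h) \sw_(g1, g2 <- g) \sw_(x1, x2 <- x)
      (omega h1 g1 x1 * omegaV h2 g2 x2) = eps h * eps g * eps x;
  omega_convl : forall h g x : H,
    \sw_(h1, h2 <- h) \sw_(g1, g2 <- g) \sw_(x1, x2 <- x)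
      (omegaV h1 g1 x1 * omega h2 g2 x2) = eps h * eps g * eps x;
  hmulA : forall h g x : H,
    \sw_(h1, h2 <- h) \sw_(g1, g2 <- g) \sw_(x1, x2 <- x)
      (omega h2 g2 x2 *: (h1 ⋅ (g1 ⋅ x1))) =
    \sw_(h1, h2 <- h) \sw_(g1, g2 <- g) \sw_(x1, x2 <- x)
      (omega h1 g1 x1 *: ((h2 ⋅ g2) ⋅ x2));
  hmul1l : forall h : H, hone H ⋅ h = h;
  hmul1r : forall h : H, h ⋅ hone H = h;
  omega_cocycle : forall h g x y : H,
    \sw_(h1, h2 <- h) \sw_(g1, g2 <- g) \sw_(x1, x2 <- x) \sw_(y1, y2 <- y)
      (omega h1 g1 (x1 ⋅ y1) * omega (h2 ⋅ g2) x2 y2) =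
    \sw_(h1, h2 <- h) \sw_(g1, g2, g3 <- g) \sw_(x1, x2, x3 <- x)
      \sw_(y1, y2 <- y)
      (omega g1 x1 y1 * omega h1 (g2 ⋅ x2) y2 * omega h2 g3 x3);
  omega_one : forall h g : H, omega h (hone H) g = eps h * eps g
}.

Record coquasi_bialgebra (k : fieldType) := CoquasiBialgebra {
  cqb_sort :> cqb_data k;
  cqbP : cqb_axioms cqb_sort
}.

Record coquasi_hopf_axioms (k : fieldType) (H : cqb_data k)
    (S : {linear H -> H}) (alpha beta : {scalar H}) : Prop := {
  antipode_comul : forall h, comul H (S h) = \sw_(h1, h2 <- h) (S h2 ⊗ S h1);
  antipode_eps : forall h, eps (S h) = eps h;
  antipode_alpha : forall h,
    \sw_(h1, h2, h3 <- h) (alpha h2 *: (S h1 ⋅ h3)) = alpha h *: hone H;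
  antipode_beta : forall h,
    \sw_(h1, h2, h3 <- h) (beta h2 *: (h1 ⋅ S h3)) = beta h *: hone H;
  antipode_omega : forall h,
    \sw_(h1, h2, h3, h4, h5 <- h)
      omega (beta h2 *: h1) (S h3) (alpha h4 *: h5) = eps h;
  antipode_omegaV : forall h,
    \sw_(h1, h2, h3, h4, h5 <- h)
      omegaV (S h1) ((alpha h2 * beta h4) *: h3) (S h5) = eps h;
  alpha_one : alpha (hone H) = 1;
  beta_one : beta (hone H) = 1
}.

Record coquasi_hopf (k : fieldType) := CoquasiHopf {
  cqh_sort :> coquasi_bialgebra k;
  antipode : {linear cqh_sort -> cqh_sort};
  alpha : {scalar cqh_sort};
  beta : {scalar cqh_sort};
  cqhP : coquasi_hopf_axioms antipode alpha beta
}.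

Record comodule (k : fieldType) (C : coalgebra k) := Comodule {
  comod_sort :> lmodType k;
  rho : {linear comod_sort -> (comod_sort ⊗ C)%type};
  rhoA : forall m,
    \tsum_(m0, m' <- rho m) \tsum_(m1, m2 <- comul C m') m0 ⊗ (m1 ⊗ m2) =
    \tsum_(m', m2 <- rho m) \tsum_(m0, m1 <- rho m') m0 ⊗ (m1 ⊗ m2);
  rho_counit : forall m, \tsum_(m0, m1 <- rho m) counit C m1 *: m0 = m
}.

Section ComoduleSweedler.
Variables (k : fieldType) (C : coalgebra k) (M : comodule C) (V : zmodType).

Definition csw2 (m : M) (f : M -> C -> V) : V := \tsum_(m0, m1 <- rho M m) f m0 m1.
Definition csw5 (m : M) (f : M -> C -> C -> C -> C -> V) : V :=
  csw2 m (fun m0 m' => sw4 m' (f m0)).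

End ComoduleSweedler.

Notation "\csw_ ( x , y <- m ) E" := (csw2 m (fun x y => E))
  (at level 41, E at level 41, x name, y name, m at level 50,
   format "'[' \csw_ ( x ,  y  <-  m ) '/  '  E ']'") : ring_scope.
Notation "\csw_ ( x , y , z , t , u <- m ) E" := (csw5 m (fun x y z t u => E))
  (at level 41, E at level 41, x name, y name, z name, t name, u name,
   m at level 50,
   format "'[' \csw_ ( x ,  y ,  z ,  t ,  u  <-  m ) '/  '  E ']'") : ring_scope.

Record comodalg_data (k : fieldType) (H : cqb_data k) := ComodalgData {
  ca_comod :> comodule H;
  amulT : {linear (ca_comod ⊗ ca_comod)%type -> ca_comod};
  aone : ca_comod
}.
Arguments aone {k H}.

Definition amul (k : fieldType) (H : cqb_data k) (A : comodalg_data H)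
  (a b : A) : A := amulT A (a ⊗ b).
Notation "a ⊙ b" := (amul a b) (at level 39, left associativity) : ring_scope.

Record comodalg_axioms (k : fieldType) (H : cqb_data k) (A : comodalg_data H) :
    Prop := {
  rho_amul : forall a b : A, rho A (a ⊙ b) =
    \csw_(a0, a1 <- a) \csw_(b0, b1 <- b) (a0 ⊙ b0) ⊗ (a1 ⋅ b1);
  rho_aone : rho A (aone A) = aone A ⊗ hone H;
  amul1l : forall a : A, aone A ⊙ a = a;
  amul1r : forall a : A, a ⊙ aone A = a;
  amulA : forall a b c : A, (a ⊙ b) ⊙ c =
    \csw_(a0, a1 <- a) \csw_(b0, b1 <- b) \csw_(c0, c1 <- c)
      (omega a1 b1 c1 *: (a0 ⊙ (b0 ⊙ c0)))
}.

Record comodule_algebra (k : fieldType) (H : coquasi_bialgebra k) :=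
  ComoduleAlgebra {
  ca_sort :> comodalg_data H;
  caP : comodalg_axioms ca_sort
}.

Record relhopf_data (k : fieldType) (H : cqb_data k) (A : comodalg_data H) :=
  RelhopfData {
  rh_comod :> comodule H;
  ractT : {linear (rh_comod ⊗ A)%type -> rh_comod}
}.

Definition ract (k : fieldType) (H : cqb_data k) (A : comodalg_data H)
  (M : relhopf_data A) (m : M) (a : A) : M := ractT M (m ⊗ a).
Notation "m ◁ a" := (ract m a) (at level 39, left associativity) : ring_scope.

Record relhopf_axioms (k : fieldType) (H : cqb_data k) (A : comodalg_data H)
    (M : relhopf_data A) : Prop := {
  rho_ract : forall (m : M) (a : A), rho M (m ◁ a) =
    \csw_(m0, m1 <- m) \csw_(a0, a1 <- a) (m0 ◁ a0) ⊗ (m1 ⋅ a1);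
  ract1 : forall m : M, m ◁ aone A = m;
  ractA : forall (m : M) (a b : A), (m ◁ a) ◁ b =
    \csw_(m0, m1 <- m) \csw_(a0, a1 <- a) \csw_(b0, b1 <- b)
      (omega m1 a1 b1 *: (m0 ◁ (a0 ⊙ b0)))
}.

Record rel_hopf_module (k : fieldType) (H : coquasi_bialgebra k)
    (A : comodule_algebra H) := RelHopfModule {
  rh_sort :> relhopf_data A;
  rhP : relhopf_axioms rh_sort
}.

Record relhopf_hom (k : fieldType) (H : cqb_data k) (A : comodalg_data H)
    (M N : relhopf_data A) := RelhopfHom {
  rh_map :> {linear M -> N};
  rh_colinear : forall m : M, rho N (rh_map m) = \csw_(m0, m1 <- m) rh_map m0 ⊗ m1;
  rh_act : forall (m : M) (a : A), rh_map (m ◁ a) = rh_map m ◁ a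
}.

Section TensorLemmas.
Variables (k : fieldType) (R : Type) (M : zmodType) (N : lmodType k).
Variables (ra : M -> R -> M) (la : R -> {linear N -> N}).
Local Notation T := (tens ra la).

Lemma tliftD (V : zmodType) (W : zmodType) (g : {additive V -> W})
    (f : M -> N -> V) (t : T) :
  g (tlift f t) = \tsum_(x, y <- t) g (f x y).
Proof. exact: raddf_sum. Qed.

Lemma eq_tlift (V : zmodType) (f g : M -> N -> V) (t : T) :
  (forall x y, f x y = g x y) -> tlift f t = tlift g t.
Proof. by move=> fg; apply: eq_bigr => p _; apply: fg. Qed.

Lemma tlift_comp (V : lmodType k) (f : M -> N -> V) (U : lmodType k)
    (g : U -> T) :
  balanced ra la f -> linear g -> linear (fun x => tlift f (g x)).
Proof. by move=> fP gP c x y; rewrite gP tlift_is_linear. Qed.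

Lemma tlift_sum_linear (V U : lmodType k) (f : U -> M -> N -> V) (t : T) :
  (forall p q, linear (fun x => f x p q)) -> linear (fun x => tlift (f x) t).
Proof.
move=> fP c x y; rewrite /tlift scaler_sumr -big_split.
by apply: eq_bigr => p _; apply: fP.
Qed.

Lemma tens_ext (V : lmodType k) (F G : T -> V) : linear F -> linear G ->
  (forall m n, F (pure ra la m n) = G (pure ra la m n)) -> F =1 G.
Proof.
move=> FP GP FG t.
pose F' : {linear T -> V} := HB.pack F (GRing.isLinear.Build k T V *:%R F FP).
pose G' : {linear T -> V} := HB.pack G (GRing.isLinear.Build k T V *:%R G GP).
rewrite -[F t]/(F' t) -[G t]/(G' t) -(tliftE F') -(tliftE G').
exact: eq_tlift.
Qed.

End TensorLemmas.

Lemma tlift_tlift (k : fieldType) (R : Type) (M : zmodType) (N : lmodType k)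
    (ra : M -> R -> M) (la : R -> {linear N -> N}) (V : lmodType k)
    (f : M -> N -> V) (R' : Type) (M' : zmodType) (N' : lmodType k)
    (ra' : M' -> R' -> M') (la' : R' -> {linear N' -> N'})
    (g : M' -> N' -> tens ra la) (t : tens ra' la') :
  balanced ra la f ->
  tlift f (tlift g t) = \tsum_(x, y <- t) tlift f (g x y).
Proof. by move=> fP; exact: (tliftD (tlin fP)). Qed.

Lemma tlift_exchange (k k' : fieldType) (R R' : Type) (M M' : zmodType)
    (N : lmodType k) (N' : lmodType k') (ra : M -> R -> M)
    (la : R -> {linear N -> N}) (ra' : M' -> R' -> M')
    (la' : R' -> {linear N' -> N'}) (V : zmodType)
    (f : M -> N -> M' -> N' -> V) (t : tens ra la) (u : tens ra' la') :
  \tsum_(x, y <- t) \tsum_(z, w <- u) f x y z w =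
  \tsum_(z, w <- u) \tsum_(x, y <- t) f x y z w.
Proof. exact: exchange_big. Qed.

Lemma pureLl (k : fieldType) (M N : lmodType k) (n : N) :
  linear (fun m : M => m ⊗ n).
Proof. by move=> c m m'; rewrite pureDl pureZl. Qed.

Lemma pureLr (k : fieldType) (R : Type) (M : zmodType) (N : lmodType k)
    (ra : M -> R -> M) (la : R -> {linear N -> N}) (m : M) :
  linear (pure ra la m).
Proof. by move=> c n n'; rewrite pureDr pureZr. Qed.

Lemma linear_comp (k : fieldType) (U V W : lmodType k) (f : V -> W) (g : U -> V) :
  linear f -> linear g -> linear (fun x => f (g x)).
Proof. by move=> fP gP c x y; rewrite gP fP. Qed.

Section CqbTheory.
Variables (k : fieldType) (H : coquasi_bialgebra k).
Local Notation one := (hone H).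

Lemma hmulLl (g : H) : linear (fun h : H => h ⋅ g).
Proof. by move=> c h h'; rewrite /hmul pureLl linearP. Qed.
Lemma hmulLr (h : H) : linear (fun g : H => h ⋅ g).
Proof. by move=> c g g'; rewrite /hmul pureLr linearP. Qed.
Lemma omegaL1 (g x : H) : scalar (fun h : H => omega h g x).
Proof. by move=> c h h'; rewrite /omega pureLl pureLl linearP. Qed.
Lemma omegaL2 (h x : H) : scalar (fun g : H => omega h g x).
Proof. by move=> c g g'; rewrite /omega pureLr pureLl linearP. Qed.
Lemma omegaL3 (h g : H) : scalar (fun x : H => omega h g x).
Proof. by move=> c x x'; rewrite /omega pureLr linearP. Qed.
Lemma omegaVL1 (g x : H) : scalar (fun h : H => omegaV h g x).
Proof. by move=> c h h'; rewrite /omegaV pureLl pureLl linearP. Qed.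
Lemma omegaVL2 (h x : H) : scalar (fun g : H => omegaV h g x).
Proof. by move=> c g g'; rewrite /omegaV pureLr pureLl linearP. Qed.
Lemma omegaVL3 (h g : H) : scalar (fun x : H => omegaV h g x).
Proof. by move=> c x x'; rewrite /omegaV pureLr linearP. Qed.
Lemma epsL : scalar (@eps k H).
Proof. by move=> c x y; rewrite /eps linearP. Qed.

Lemma scalarMl (U : lmodType k) (f : U -> k) d :
  scalar f -> scalar (fun x => f x * d).
Proof. by move=> fP c x y; rewrite fP mulrDl mulrA. Qed.
Lemma scalarMr (U : lmodType k) (f : U -> k) d :
  scalar f -> scalar (fun x => d * f x).
Proof. by move=> fP c x y; rewrite fP mulrDr !mulrA [d * c]mulrC. Qed.
Lemma scalarZl (U V : lmodType k) (f : U -> k) (v : V) :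
  scalar f -> linear (fun x => f x *: v).
Proof. by move=> fP c x y; rewrite fP scalerDl scalerA. Qed.
Lemma linearZr (U V : lmodType k) (f : U -> V) d :
  linear f -> linear (fun x => d *: f x).
Proof. by move=> fP c x y; rewrite fP scalerDr !scalerA [d * c]mulrC. Qed.

Lemma sw2_lin (V : lmodType k) (f : H -> H -> V) :
  (forall y, linear (f^~ y)) -> (forall x, linear (f x)) ->
  linear (fun h => sw2 h f).
Proof.
by move=> fl fr; apply: tlift_comp; [exact: kbalanced | exact: linearP].
Qed.

Lemma sw2_one (V : lmodType k) (f : H -> H -> V) :
  (forall y, linear (f^~ y)) -> (forall x, linear (f x)) ->
  sw2 one f = f one one.
Proof.
by move=> fl fr; rewrite /sw2 (comul_one (cqbP H)) tlift_pure //; apply: kbalanced.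
Qed.

Lemma sw_coassoc (V : lmodType k) (f : H -> H -> H -> V) (h : H) :
  (forall y z, linear (fun x => f x y z)) ->
  (forall x z, linear (fun y => f x y z)) -> (forall x y, linear (f x y)) ->
  \sw_(h1, h2, h3 <- h) f h1 h2 h3 =
  \sw_(h', h3 <- h) \sw_(h1, h2 <- h') f h1 h2 h3.
Proof.
move=> f1 f2 f3.
have f23 x : balanced (@kact _ H) (@kscale _ H) (f x) by apply: kbalanced.
have fP : balanced (@kact _ H) (@kscale _ (H ⊗ H)%type) (fun x t => tlift (f x) t).
  apply: kbalanced => [t|x]; last exact: tlift_is_linear.
  exact: tlift_sum_linear.
have := congr1 (tlift (fun x t => tlift (f x) t)) (comulA h).
rewrite !(tlift_tlift _ _ fP) => E.
transitivity (\tsum_(x, y <- comul H h) tlift (fun x t => tlift (f x) t)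
   (\tsum_(y1, y2 <- comul H y) x ⊗ (y1 ⊗ y2))).
  apply: eq_tlift => x y; rewrite (tlift_tlift _ _ fP); apply: eq_tlift => y1 y2.
  by rewrite !tlift_pure.
rewrite E; apply: eq_tlift => x y; rewrite (tlift_tlift _ _ fP).
by apply: eq_tlift => x1 x2; rewrite !tlift_pure.
Qed.

Lemma sw_epsl (V : lmodType k) (f : H -> V) h :
  linear f -> \sw_(h1, h2 <- h) (eps h1 *: f h2) = f h.
Proof.
move=> fP.
pose F : {linear H -> V} := HB.pack f (GRing.isLinear.Build k H V *:%R f fP).
rewrite -[in RHS](counitl h) -[RHS]/(F _) tliftD.
by apply: eq_tlift => x y; exact: esym (linearZ_LR F _ _).
Qed.

Lemma sw_epsr (V : lmodType k) (f : H -> V) h :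
  linear f -> \sw_(h1, h2 <- h) (eps h2 *: f h1) = f h.
Proof.
move=> fP.
pose F : {linear H -> V} := HB.pack f (GRing.isLinear.Build k H V *:%R f fP).
rewrite -[in RHS](counitr h) -[RHS]/(F _) tliftD.
by apply: eq_tlift => x y; exact: esym (linearZ_LR F _ _).
Qed.

End CqbTheory.

Section LinearComp.
Variables (k : fieldType) (H : coquasi_bialgebra k) (U : lmodType k).
Variables (f : U -> H).
Hypothesis fP : linear f.

Lemma linC_hmul1 g : linear (fun u => f u ⋅ g).
Proof. by move=> c u v; rewrite fP hmulLl. Qed.
Lemma linC_hmul2 h : linear (fun u => h ⋅ f u).
Proof. by move=> c u v; rewrite fP hmulLr. Qed.
Lemma linC_omega1 g x : scalar (fun u => omega (f u) g x).
Proof. by move=> c u v; rewrite fP omegaL1. Qed.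
Lemma linC_omega2 h x : scalar (fun u => omega h (f u) x).
Proof. by move=> c u v; rewrite fP omegaL2. Qed.
Lemma linC_omega3 h g : scalar (fun u => omega h g (f u)).
Proof. by move=> c u v; rewrite fP omegaL3. Qed.
Lemma linC_omegaV1 g x : scalar (fun u => omegaV (f u) g x).
Proof. by move=> c u v; rewrite fP omegaVL1. Qed.
Lemma linC_omegaV2 h x : scalar (fun u => omegaV h (f u) x).
Proof. by move=> c u v; rewrite fP omegaVL2. Qed.
Lemma linC_omegaV3 h g : scalar (fun u => omegaV h g (f u)).
Proof. by move=> c u v; rewrite fP omegaVL3. Qed.
Lemma linC_eps : scalar (fun u => eps (f u)).
Proof. by move=> c u v; rewrite fP epsL. Qed.
Lemma linC_sw2 (V : lmodType k) (F : H -> H -> V) :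
  (forall y, linear (F^~ y)) -> (forall x, linear (F x)) ->
  linear (fun u => sw2 (f u) F).
Proof. by move=> F1 F2 c u v; rewrite fP sw2_lin. Qed.
Lemma linC_sum (V : lmodType k) (C : coalgebra k) (h : C) (F : U -> C -> C -> V) :
  (forall p q, linear (fun u => F u p q)) -> linear (fun u => sw2 h (F u)).
Proof. by move=> FP; apply: tlift_sum_linear. Qed.
Lemma linC_sum_k (C : coalgebra k) (h : C) (F : U -> C -> C -> k) :
  (forall p q, scalar (fun u => F u p q)) -> scalar (fun u => sw2 h (F u)).
Proof. exact: (@linC_sum k^o). Qed.
Lemma linC_sw2_k (F : H -> H -> k) :
  (forall y, scalar (F^~ y)) -> (forall x, scalar (F x)) ->
  scalar (fun u => sw2 (f u) F).
Proof. exact: (@linC_sw2 k^o). Qed.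
End LinearComp.

Section LinearCompPure.
Variables (k : fieldType) (U : lmodType k).

Lemma linC_pure1 (M N : lmodType k) (f : U -> M) (n : N) :
  linear f -> linear (fun u => f u ⊗ n).
Proof. by move=> fP c u v; rewrite fP pureLl. Qed.
Lemma linC_pure2 (R : Type) (M : zmodType) (N : lmodType k)
    (ra : M -> R -> M) (la : R -> {linear N -> N}) (m : M) (f : U -> N) :
  linear f -> linear (fun u => pure ra la m (f u)).
Proof. by move=> fP c u v; rewrite fP pureLr. Qed.
Lemma linC_map (M N : lmodType k) (g : {linear M -> N}) (f : U -> M) :
  linear f -> linear (fun u => g (f u)).
Proof. by move=> fP c u v; rewrite fP linearP. Qed.
Lemma linC_form (M : lmodType k) (g : {scalar M}) (f : U -> M) :
  linear f -> scalar (fun u => g (f u)).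
Proof. by move=> fP c u v; rewrite fP linearP. Qed.
Lemma linC_id : linear (fun u : U => u).
Proof. by []. Qed.
End LinearCompPure.

Ltac lin_step := first
  [ apply: linC_id
  | apply: tlift_sum_linear => ? ?
  | apply: linC_sum => ? ?
  | apply: linC_sum_k => ? ?
  | apply: linC_hmul1 | apply: linC_hmul2 | apply: linC_omega1
  | apply: linC_omega2 | apply: linC_omega3 | apply: linC_omegaV1
  | apply: linC_omegaV2 | apply: linC_omegaV3 | apply: linC_eps
  | apply: linC_sw2 => [|?|?] | apply: linC_sw2_k => [|?|?]
  | apply: linC_pure1 | apply: linC_pure2 | apply: linC_map | apply: linC_form
  | apply: scalarMl | apply: scalarMr | apply: scalarZl | apply: linearZr ].
Ltac lin := rewrite /sw5 /sw4 /sw3 /=; intros; solve [repeat lin_step].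

Section CqbTheory2.
Variables (k : fieldType) (H : coquasi_bialgebra k).
Local Notation one := (hone H).

Lemma eq_sw2 (V : zmodType) (h : H) (f g : H -> H -> V) :
  (forall x y, f x y = g x y) -> sw2 h f = sw2 h g.
Proof. exact: eq_tlift. Qed.

Lemma sw_epsl_k (f : H -> k) h : scalar f -> \sw_(h1, h2 <- h) (eps h1 * f h2) = f h.
Proof. exact: (@sw_epsl k H k^o). Qed.

Lemma sw_epsr_k (f : H -> k) h : scalar f -> \sw_(h1, h2 <- h) (eps h2 * f h1) = f h.
Proof. exact: (@sw_epsr k H k^o). Qed.

Lemma mulr_sw2 (h : H) (c : k) (f : H -> H -> k) :
  c * sw2 h f = \sw_(h1, h2 <- h) (c * f h1 h2).
Proof. by rewrite /sw2 /tlift mulr_sumr. Qed.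

Lemma mulr_sw2l (h : H) (c : k) (f : H -> H -> k) :
  sw2 h f * c = \sw_(h1, h2 <- h) (f h1 h2 * c).
Proof. by rewrite /sw2 /tlift mulr_suml. Qed.

Lemma sw2_exchange (V : zmodType) (h g : H) (f : H -> H -> H -> H -> V) :
  \sw_(h1, h2 <- h) \sw_(g1, g2 <- g) f h1 h2 g1 g2 =
  \sw_(g1, g2 <- g) \sw_(h1, h2 <- h) f h1 h2 g1 g2.
Proof. exact: tlift_exchange. Qed.

Let omega_one_idem x y : omega one x y =
  \sw_(x1, x2 <- x) \sw_(y1, y2 <- y) (omega one x1 y1 * omega one x2 y2).
Proof.
have := omega_cocycle (cqbP H) one one x y.
rewrite (@sw2_one _ _ k^o); [|lin..].
rewrite (@sw2_one _ _ k^o); [|lin..].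
rewrite (@sw2_one _ _ k^o); [|lin..].
rewrite /sw3 (@sw2_one _ _ k^o); [|lin..].
rewrite (@sw2_one _ _ k^o); [|lin..].
move=> E.
transitivity (\sw_(x1, x2 <- x) \sw_(y1, y2 <- y)
  omega one one (x1 ⋅ y1) * omega (one ⋅ one) x2 y2).
  rewrite -[LHS](@sw_epsl_k (fun x => omega one x y)); last by lin.
  apply: eq_sw2 => x1 x2.
  rewrite -[in LHS](@sw_epsl_k (fun y => omega one x2 y)); last by lin.
  rewrite mulr_sw2; apply: eq_sw2 => y1 y2.
  rewrite (omega_one (cqbP H)) (hmul1l (cqbP H)) (eps_one (cqbP H)).
  by rewrite (eps_mul (cqbP H)) mul1r mulrA.
rewrite E.
transitivity (\sw_(x1, x' <- x) \sw_(y1, y2 <- y)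
  omega one x1 y1 * (\sw_(x2, x3 <- x') eps x3 * omega one x2 y2)).
  apply: eq_sw2 => x1 x'; rewrite sw2_exchange; apply: eq_sw2 => y1 y2.
  rewrite mulr_sw2; apply: eq_sw2 => x2 x3.
  rewrite (omega_one (cqbP H)) (hmul1l (cqbP H)) (eps_one (cqbP H)).
  by rewrite mul1r [eps x3 * _]mulrC mulrA.
apply: eq_sw2 => x1 x'; apply: eq_sw2 => y1 y2.
by rewrite (@sw_epsr_k (fun x => omega one x y2)); last by lin.
Qed.

Lemma omega_one_l x y : omega one x y = eps x * eps y.
Proof.
have inv u v : \sw_(u1, u2 <- u) \sw_(v1, v2 <- v)
    (omega one u1 v1 * omegaV one u2 v2) = eps u * eps v.
  have := omega_convr (cqbP H) one u v.
  by rewrite (@sw2_one _ _ k^o); [rewrite (eps_one (cqbP H)) mul1r|lin..].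
rewrite -inv.
transitivity (\sw_(x', x3 <- x) \sw_(y', y3 <- y)
  (\sw_(x1, x2 <- x') \sw_(y1, y2 <- y') (omega one x1 y1 * omega one x2 y2)) *
     omegaV one x3 y3); last first.
  apply: eq_sw2 => x' x3; apply: eq_sw2 => y' y3.
  by rewrite -omega_one_idem.
transitivity (\sw_(x1, x2, x3 <- x) \sw_(y1, y2, y3 <- y)
  (omega one x1 y1 * omega one x2 y2 * omegaV one x3 y3)); last first.
  rewrite (@sw_coassoc _ _ k^o); [|lin..].
  apply: eq_sw2 => x' x3.
  under [RHS]eq_sw2 => y' y3 do rewrite mulr_sw2l.
  rewrite [RHS]sw2_exchange; apply: eq_sw2 => x1 x2.
  under [RHS]eq_sw2 => y' y3 do rewrite mulr_sw2l.
  by rewrite (@sw_coassoc _ _ k^o); [|lin..].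
transitivity (\sw_(x1, x2 <- x) \sw_(y1, y2 <- y)
  (omega one x1 y1 * (eps x2 * eps y2))); last first.
  apply: eq_sw2 => x1 x'; rewrite /sw3 [RHS]sw2_exchange; apply: eq_sw2 => y1 y'.
  rewrite -inv mulr_sw2; apply: eq_sw2 => x2 x3.
  by rewrite mulr_sw2; apply: eq_sw2 => y2 y3; rewrite mulrA.
rewrite -[LHS](@sw_epsr_k (fun x => omega one x y)); last by lin.
apply: eq_sw2 => x1 x2.
rewrite -[in LHS](@sw_epsr_k (fun y => omega one x1 y)); last by lin.
rewrite mulr_sw2; apply: eq_sw2 => y1 y2.
by rewrite mulrA mulrC.
Qed.

End CqbTheory2.

Section ComoduleTheory.
Variables (k : fieldType) (H : coquasi_bialgebra k).

Lemma linC_csum (U : lmodType k) (V : lmodType k) (M : comodule H) (m : M)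
    (F : U -> M -> H -> V) :
  (forall p q, linear (fun u => F u p q)) -> linear (fun u => csw2 m (F u)).
Proof. by move=> FP; apply: tlift_sum_linear. Qed.

Lemma eq_csw2 (M : comodule H) (V : zmodType) (m : M) (f g : M -> H -> V) :
  (forall x y, f x y = g x y) -> csw2 m f = csw2 m g.
Proof. exact: eq_tlift. Qed.

Section Comodule.
Variables (M : comodule H) (V : lmodType k).

Lemma csw2_pure (m m' : M) (h : H) (f : M -> H -> V) :
  (forall y, linear (f^~ y)) -> (forall x, linear (f x)) ->
  rho M m = m' ⊗ h -> csw2 m f = f m' h.
Proof.
by move=> f1 f2 mP; rewrite /csw2 mP tlift_pure //; apply: kbalanced.
Qed.

Lemma csw2_lin (f : M -> H -> V) :
  (forall y, linear (f^~ y)) -> (forall x, linear (f x)) ->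
  linear (fun m => csw2 m f).
Proof.
by move=> f1 f2; apply: tlift_comp; [exact: kbalanced | exact: linearP].
Qed.

Lemma csw_eps (f : M -> V) m :
  linear f -> \csw_(m0, m1 <- m) (eps m1 *: f m0) = f m.
Proof.
move=> fP.
pose F : {linear M -> V} := HB.pack f (GRing.isLinear.Build k M V *:%R f fP).
rewrite -[in RHS](rho_counit m) -[RHS]/(F _) tliftD.
by apply: eq_tlift => x y; exact: esym (linearZ_LR F _ _).
Qed.

End Comodule.
End ComoduleTheory.

Section LinearCompA.
Variables (k : fieldType) (H : coquasi_bialgebra k) (U : lmodType k).

Lemma linC_csw2 (M : comodule H) (V : lmodType k) (f : U -> M) (F : M -> H -> V) :
  linear f -> (forall y, linear (F^~ y)) -> (forall x, linear (F x)) ->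
  linear (fun u => csw2 (f u) F).
Proof. by move=> fP F1 F2 c u v; rewrite fP csw2_lin. Qed.

Lemma linC_amul1 (A : comodalg_data H) (f : U -> A) (a : A) :
  linear f -> linear (fun u => f u ⊙ a).
Proof. by move=> fP c u v; rewrite fP /amul pureLl linearP. Qed.
Lemma linC_amul2 (A : comodalg_data H) (f : U -> A) (a : A) :
  linear f -> linear (fun u => a ⊙ f u).
Proof. by move=> fP c u v; rewrite fP /amul pureLr linearP. Qed.
Lemma linC_ract1 (A : comodalg_data H) (M : relhopf_data A) (f : U -> M) (a : A) :
  linear f -> linear (fun u => f u ◁ a).
Proof. by move=> fP c u v; rewrite fP /ract pureLl linearP. Qed.
Lemma linC_ract2 (A : comodalg_data H) (M : relhopf_data A) (m : M) (f : U -> A) :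
  linear f -> linear (fun u => m ◁ f u).
Proof. by move=> fP c u v; rewrite fP /ract pureLr linearP. Qed.
End LinearCompA.

Ltac clin_step := first [lazymatch goal with
  | |- GRing.linear_for _ (fun u => u) => apply: linC_id
  | |- GRing.linear_for _ (fun u => @pure _ _ _ _ _ _ (@?f u) (@?g u)) =>
    first [apply: linC_pure1 | apply: linC_pure2]
  | |- GRing.linear_for _ (fun u => @csw2 _ _ _ _ (@?f u) (@?g u)) =>
    first [apply: linC_csum => ? ? | apply: linC_csw2 => [|?|?]]
  | |- GRing.linear_for _ (fun u => @sw2 _ _ _ (@?f u) (@?g u)) =>
    first [apply: linC_sum => ? ? | apply: linC_sum_k => ? ?
          | apply: linC_sw2 => [|?|?] | apply: linC_sw2_k => [|?|?]]
  | |- GRing.linear_for _ (fun u => @hmul _ _ (@?f u) (@?g u)) =>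
    first [apply: linC_hmul1 | apply: linC_hmul2]
  | |- GRing.linear_for _ (fun u => @amul _ _ _ (@?f u) (@?g u)) =>
    first [apply: linC_amul1 | apply: linC_amul2]
  | |- GRing.linear_for _ (fun u => @ract _ _ _ _ (@?f u) (@?g u)) =>
    first [apply: linC_ract1 | apply: linC_ract2]
  | |- GRing.linear_for _ (fun u => @omega _ _ (@?f u) (@?g u) (@?h u)) =>
    first [apply: linC_omega1 | apply: linC_omega2 | apply: linC_omega3]
  | |- GRing.linear_for _ (fun u => @omegaV _ _ (@?f u) (@?g u) (@?h u)) =>
    first [apply: linC_omegaV1 | apply: linC_omegaV2 | apply: linC_omegaV3]
  | |- GRing.linear_for _ (fun u => @GRing.scale _ _ (@?f u) (@?g u)) =>
    first [apply: scalarZl | apply: linearZr]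
  | |- GRing.linear_for _ (fun u => @GRing.mul _ (@?f u) (@?g u)) =>
    first [apply: scalarMl | apply: scalarMr]
  end
  | lin_step | apply: linC_csum => ? ? | apply: linC_csw2 => [|?|?]
  | apply: linC_amul1 | apply: linC_amul2 | apply: linC_ract1 | apply: linC_ract2].
Ltac clin := rewrite /csw5 /sw5 /sw4 /sw3 /=; intros; solve [repeat clin_step].

Definition coinv_pred (k : fieldType) (H : cqb_data k) (M : comodule H) :
  {pred M} := fun m => rho M m == m ⊗ hone H.
Arguments coinv_pred {k H} M _ /.

Lemma coinv_predP (k : fieldType) (H : cqb_data k) (M : comodule H) :
  GRing.zmod_closed (coinv_pred M).
Proof.
split; rewrite ?unfold_in.
  by apply/eqP; have := @pureZl k M H 0 0 (hone H); rewrite !scale0r linear0 => ->.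
move=> x y; rewrite !unfold_in => /eqP xP /eqP yP; apply/eqP.
by rewrite linearB xP yP -[- y]scaleN1r pureDl pureZl scaleN1r.
Qed.

HB.instance Definition _ (k : fieldType) (H : cqb_data k) (M : comodule H) :=
  GRing.isZmodClosed.Build M (coinv_pred M) (coinv_predP M).

Record coinv (k : fieldType) (H : cqb_data k) (M : comodule H) := Coinv {
  coinv_val : M;
  coinv_valP : coinv_val \in coinv_pred M
}.

Section CoinvInstances.
Variables (k : fieldType) (H : cqb_data k) (M : comodule H).
HB.instance Definition _ := [isSub for @coinv_val k H M].
HB.instance Definition _ := [Choice of coinv M by <:].
HB.instance Definition _ := [SubChoice_isSubZmodule of coinv M by <:].

Lemma coinvP (m : coinv M) : rho M (val m) = val m ⊗ hone H.
Proof. by apply/eqP; apply: (coinv_valP m). Qed.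

Lemma coinv_inj (m n : coinv M) : val m = val n -> m = n.
Proof. exact: val_inj. Qed.

End CoinvInstances.

Section RelHopfTheory.
Variables (k : fieldType) (H : coquasi_bialgebra k) (A : comodule_algebra H).
Variables (M : rel_hopf_module A).
Local Notation one := (hone H).

Lemma rho_ract_coinvl (m : M) (a : A) : rho M m = m ⊗ one ->
  rho M (m ◁ a) = \csw_(a0, a1 <- a) (m ◁ a0) ⊗ a1.
Proof.
move=> mP; rewrite (rho_ract (rhP M)) (csw2_pure _ _ mP); [|clin..].
by apply: eq_csw2 => a0 a1; rewrite (hmul1l (cqbP H)).
Qed.

Lemma rho_ract_coinvr (m : M) (a : A) : rho A a = a ⊗ one ->
  rho M (m ◁ a) = \csw_(m0, m1 <- m) (m0 ◁ a) ⊗ m1.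
Proof.
move=> aP; rewrite (rho_ract (rhP M)); apply: eq_csw2 => m0 m1.
by rewrite (csw2_pure _ _ aP) ?(hmul1r (cqbP H)) //; clin.
Qed.

Lemma ractA_coinv1 (m : M) (a b : A) : rho M m = m ⊗ one ->
  (m ◁ a) ◁ b = m ◁ (a ⊙ b).
Proof.
move=> mP; rewrite (ractA (rhP M)) (csw2_pure _ _ mP); [|clin..].
rewrite -[RHS](@csw_eps _ _ _ _ (fun a => m ◁ (a ⊙ b))); last by clin.
apply: eq_csw2 => a0 a1.
rewrite -[m ◁ (a0 ⊙ b)](@csw_eps _ _ _ _ (fun b => m ◁ (a0 ⊙ b))); last by clin.
rewrite /csw2 /tlift scaler_sumr; apply: eq_bigr => -[b0 b1] _ /=.
by rewrite scalerA omega_one_l.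
Qed.

Lemma ractA_coinv2 (m : M) (a b : A) : rho A a = a ⊗ one ->
  (m ◁ a) ◁ b = m ◁ (a ⊙ b).
Proof.
move=> aP; rewrite (ractA (rhP M)).
rewrite -[RHS](@csw_eps _ _ _ _ (fun m => m ◁ (a ⊙ b))); last by clin.
apply: eq_csw2 => m0 m1.
rewrite (csw2_pure _ _ aP); [|clin..].
rewrite -[m0 ◁ (a ⊙ b)](@csw_eps _ _ _ _ (fun b => m0 ◁ (a ⊙ b))); last by clin.
rewrite /csw2 /tlift scaler_sumr; apply: eq_bigr => -[b0 b1] _ /=.
by rewrite scalerA (omega_one (cqbP H)).
Qed.

Lemma coinv_ract_subproof (m : coinv M) (b : coinv A) :
  (val m ◁ val b) \in coinv_pred M.
Proof.
rewrite unfold_in; apply/eqP; rewrite rho_ract_coinvl ?coinvP //.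
by rewrite (csw2_pure _ _ (coinvP b)) //; clin.
Qed.

Definition coinv_ract (m : coinv M) (b : coinv A) : coinv M :=
  Coinv (coinv_ract_subproof m b).

End RelHopfTheory.

Section CoinvAlgebra.
Variables (k : fieldType) (H : coquasi_bialgebra k) (A : comodule_algebra H).
Local Notation one := (hone H).

Definition regular_data : relhopf_data A := RelhopfData (amulT A).

Lemma regular_axioms : relhopf_axioms regular_data.
Proof.
by split; [exact: rho_amul (caP A) | exact: amul1r (caP A) | exact: amulA (caP A)].
Qed.

Definition regular : rel_hopf_module A := RelHopfModule regular_axioms.

Lemma amulA_coinv1 (a b c : A) : rho A a = a ⊗ one -> (a ⊙ b) ⊙ c = a ⊙ (b ⊙ c).
Proof. exact: (@ractA_coinv1 _ _ _ regular). Qed.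

Lemma amulA_coinv2 (a b c : A) : rho A b = b ⊗ one -> (a ⊙ b) ⊙ c = a ⊙ (b ⊙ c).
Proof. exact: (@ractA_coinv2 _ _ _ regular). Qed.

(* A is not associative, but its coinvariants B form a ring. *)
Definition coinv_alg : Type := coinv A.
HB.instance Definition _ := GRing.Zmodule.on coinv_alg.
HB.instance Definition _ := SubType.on coinv_alg.

Lemma aone_coinv_subproof : aone A \in coinv_pred A.
Proof. by rewrite unfold_in; apply/eqP; apply: rho_aone (caP A). Qed.

Definition coinv_one : coinv_alg := Coinv aone_coinv_subproof.
Definition coinv_mul (b c : coinv_alg) : coinv_alg := @coinv_ract _ _ _ regular b c.

Lemma coinv_mulE (b c : coinv_alg) : val (coinv_mul b c) = (val b : A) ⊙ (val c : A).
Proof. by []. Qed.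

Let coinv_mulA : associative coinv_mul.
Proof.
by move=> a b c; apply: val_inj; apply/esym/amulA_coinv1/(coinvP (a : coinv A)).
Qed.
Let coinv_mul1l : left_id coinv_one coinv_mul.
Proof. by move=> a; apply: val_inj; apply: amul1l (caP A) _. Qed.
Let coinv_mul1r : right_id coinv_one coinv_mul.
Proof. by move=> a; apply: val_inj; apply: amul1r (caP A) _. Qed.
Let coinv_mulDl : left_distributive coinv_mul +%R.
Proof. by move=> a b c; apply: val_inj; rewrite /= /ract pureDl linearD. Qed.
Let coinv_mulDr : right_distributive coinv_mul +%R.
Proof. by move=> a b c; apply: val_inj; rewrite /= /ract pureDr linearD. Qed.

HB.instance Definition _ := GRing.Zmodule_isPzRing.Build coinv_alg
  coinv_mulA coinv_mul1l coinv_mul1r coinv_mulDl coinv_mulDr.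

End CoinvAlgebra.

(* Right B-modules are left modules over the converse ring; their k-vector space
   structure is the one induced by k -> B. *)
Notation rmod A := (lmodType (coinv_alg A)^c).

Section CoinvModule.
Variables (k : fieldType) (H : coquasi_bialgebra k) (A : comodule_algebra H).
Variables (M : rel_hopf_module A).
Local Notation B := (coinv_alg A).

Definition coinv_mod : Type := coinv M.
HB.instance Definition _ := GRing.Zmodule.on coinv_mod.
HB.instance Definition _ := SubType.on coinv_mod.

Let act (b : B^c) (m : coinv_mod) : coinv_mod := coinv_ract m b.

Let actA b c m : act b (act c m) = act (b * c) m.
Proof. by apply: val_inj; rewrite /= ractA_coinv2 //; apply: (coinvP (c : coinv A)). Qed.
Let act1 : left_id 1 act.
Proof. by move=> m; apply: val_inj; apply: ract1 (rhP M) _. Qed.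
Let actDr : right_distributive act +%R.
Proof. by move=> b m n; apply: val_inj; rewrite /= /ract pureDl linearD. Qed.
Let actDl m : {morph act^~ m : b c / b + c}.
Proof. by move=> b c; apply: val_inj; rewrite /= /ract pureDr linearD. Qed.

HB.instance Definition _ :=
  GRing.Zmodule_isLmodule.Build B^c coinv_mod actA act1 actDr actDl.

Lemma coinv_scaleE (b : B) (m : coinv_mod) :
  val ((b : B^c) *: m) = (val m : M) ◁ (val b : A).
Proof. by []. Qed.

End CoinvModule.

Section Induction.
Variables (k : fieldType) (H : coquasi_bialgebra k) (A : comodule_algebra H).
Local Notation B := (coinv_alg A).

Definition lmulB (b : B) (a : A) : A := (val b : A) ⊙ a.

Lemma lmulB_linear b : linear (lmulB b).
Proof. by rewrite /lmulB; clin. Qed.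

HB.instance Definition _ b :=
  GRing.isLinear.Build k A A *:%R (lmulB b) (lmulB_linear b).

Lemma lmulB1 a : lmulB 1 a = a.
Proof. exact: amul1l (caP A) a. Qed.

Lemma lmulBM b c a : lmulB (b * c) a = lmulB b (lmulB c a).
Proof. exact: amulA_coinv1 (coinvP (b : coinv A)). Qed.

Definition ractB (N : rmod A) (n : N) (b : B) : N := (b : B^c) *: n.

Section Object.
Variable N : rmod A.

(* N ⊗_B A; its scalar action c (n ⊗ a) = n ⊗ c a is also n (c 1_B) ⊗ a. *)
Definition indT := tens (@ractB N) lmulB.
HB.instance Definition _ := GRing.Lmodule.on indT.

Definition pureB (n : N) (a : A) : indT := pure (@ractB N) lmulB n a.

Lemma pureB_bal n b a : pureB (ractB n b) a = pureB n (lmulB b a).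
Proof. exact: pure_bal. Qed.

Definition ind_rho_fun (n : N) (a : A) : (indT ⊗ H)%type :=
  \csw_(a0, a1 <- a) pureB n a0 ⊗ a1.

Lemma ind_rho_balanced : balanced (@ractB N) lmulB ind_rho_fun.
Proof.
rewrite /ind_rho_fun; split.
- move=> n n' a; rewrite /csw2 /tlift -big_split; apply: eq_bigr => -[x y] _ /=.
  by rewrite -pureDl; congr (_ ⊗ _); apply: pureDl.
- by move=> n; rewrite /pureB; clin.
- move=> n b a; have bP := coinvP (b : coinv A).
  rewrite [RHS]/csw2 (@rho_ract_coinvl _ _ _ (regular A)) //.
  have P : balanced (@kact _ A) (@kscale _ H) (fun a0 a1 => pureB n a0 ⊗ a1).
    by apply: kbalanced; rewrite /pureB; clin.
  rewrite (tlift_tlift _ _ P); apply: eq_tlift => x y.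
  by rewrite (tlift_pure P); congr (_ ⊗ _); apply: pureB_bal.
Qed.

Definition ind_rho : {linear indT -> (indT ⊗ H)%type} := tlin ind_rho_balanced.

Lemma ind_rhoE n a : ind_rho (pureB n a) = \csw_(a0, a1 <- a) pureB n a0 ⊗ a1.
Proof. exact: (tlift_pure ind_rho_balanced n a). Qed.

Lemma ind_ext (V : lmodType k) (F G : indT -> V) : linear F -> linear G ->
  (forall n a, F (pureB n a) = G (pureB n a)) -> F =1 G.
Proof. exact: tens_ext. Qed.

Lemma pureB_linear n : linear (pureB n).
Proof. exact: pureLr. Qed.

Lemma linC_pureB (U : lmodType k) (f : U -> A) n :
  linear f -> linear (fun u => pureB n (f u)).
Proof. exact: linC_pure2. Qed.

Lemma ind_rhoA t :
  \tsum_(m0, m' <- ind_rho t) \tsum_(m1, m2 <- comul H m') m0 ⊗ (m1 ⊗ m2) =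
  \tsum_(m', m2 <- ind_rho t) \tsum_(m0, m1 <- ind_rho m') m0 ⊗ (m1 ⊗ m2).
Proof.
have P1 : balanced (@kact _ indT) (@kscale _ H)
    (fun m0 m' => \sw_(m1, m2 <- m') m0 ⊗ (m1 ⊗ m2)).
  by apply: kbalanced; clin.
have P3 (m2 : H) : balanced (@kact _ indT) (@kscale _ H)
    (fun m0 m1 => m0 ⊗ (m1 ⊗ m2)).
  by apply: kbalanced; clin.
have P2 : balanced (@kact _ indT) (@kscale _ H)
    (fun m' m2 => \tsum_(m0, m1 <- ind_rho m') m0 ⊗ (m1 ⊗ m2)).
  apply: kbalanced => [m2|m']; last by clin.
  by apply: tlift_comp; [exact: P3 | exact: linearP].
have P4 n : balanced (@kact _ A) (@kscale _ (H ⊗ H)%type)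
    (fun a0 z => pureB n a0 ⊗ z).
  by apply: kbalanced; rewrite /pureB; clin.
move: t; apply: ind_ext.
- by apply: tlift_comp; [exact: P1 | exact: linearP].
- by apply: tlift_comp; [exact: P2 | exact: linearP].
move=> n a; rewrite ind_rhoE /csw2 (tlift_tlift _ _ P1) (tlift_tlift _ _ P2).
have := congr1 (tlift (fun a0 z => pureB n a0 ⊗ z)) (rhoA a).
rewrite !(tlift_tlift _ _ (P4 n)) => E.
transitivity (\tsum_(x, y <- rho A a) tlift (fun a0 z => pureB n a0 ⊗ z)
   (\tsum_(y1, y2 <- comul H y) x ⊗ (y1 ⊗ y2))).
  apply: eq_tlift => x y; rewrite (tlift_tlift _ _ (P4 n)) (tlift_pure P1).
  by apply: eq_tlift => y1 y2; rewrite (tlift_pure (P4 n)).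
rewrite E; apply: eq_tlift => x y.
rewrite (tlift_tlift _ _ (P4 n)) (tlift_pure P2) ind_rhoE /csw2.
rewrite (tlift_tlift _ _ (P3 y)); apply: eq_tlift => x1 x2.
by rewrite (tlift_pure (P4 n)) (tlift_pure (P3 y)).
Qed.

Lemma ind_rho_counit t : \tsum_(m0, m1 <- ind_rho t) counit H m1 *: m0 = t.
Proof.
have P : balanced (@kact _ indT) (@kscale _ H)
    (fun m0 (m1 : H) => counit H m1 *: m0).
  by apply: kbalanced; clin.
move: t; apply: ind_ext => [||n a] //.
  by apply: tlift_comp; [exact: P | exact: linearP].
rewrite ind_rhoE /csw2 (tlift_tlift _ _ P).
rewrite -[RHS](csw_eps a (pureB_linear n)).
by apply: eq_tlift => x y; rewrite (tlift_pure P).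
Qed.

Definition ind_comod : comodule H := Comodule ind_rhoA ind_rho_counit.

Definition ind_act_fun (b : A) (n : N) (a : A) : indT := pureB n (a ⊙ b).

Lemma ind_act_balanced b : balanced (@ractB N) lmulB (ind_act_fun b).
Proof.
rewrite /ind_act_fun; split.
- by move=> n n' a; apply: pureDl.
- by move=> n; rewrite /pureB; clin.
- move=> n c a; rewrite pureB_bal; congr (pureB n _).
  by apply/esym/amulA_coinv1/(coinvP (c : coinv A)).
Qed.

Lemma ind_act_biadd : balanced (@kact _ ind_comod) (@kscale _ A)
  (fun (t : indT) b => tlift (ind_act_fun b) t).
Proof.
apply: kbalanced => [b|t]; first exact: tlift_is_linear (ind_act_balanced b).
by apply: tlift_sum_linear => n a; rewrite /ind_act_fun /pureB; clin.
Qed.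

Definition ind_data : relhopf_data A :=
  RelhopfData (rh_comod := ind_comod) (tlin ind_act_biadd).

Lemma ind_ractE n a b : (pureB n a : ind_data) ◁ b = pureB n (a ⊙ b).
Proof.
by rewrite /ract /= tlift_pure; [apply: tlift_pure (ind_act_balanced b) _ _
  | exact: ind_act_biadd].
Qed.

Lemma ind_rhoE' n a :
  rho ind_data (pureB n a) = \csw_(a0, a1 <- a) pureB n a0 ⊗ a1.
Proof. exact: ind_rhoE. Qed.

Lemma csw_ind (V : lmodType k) (f : ind_data -> H -> V) n a :
  (forall y, linear (f^~ y)) -> (forall x, linear (f x)) ->
  \csw_(t0, t1 <- (pureB n a : ind_data)) f t0 t1 =
  \csw_(a0, a1 <- a) f (pureB n a0) a1.
Proof.
move=> f1 f2; have P := kbalanced f1 f2.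
rewrite /csw2 ind_rhoE' /csw2 (tlift_tlift _ _ P).
by apply: eq_tlift => x y; apply: (tlift_pure P).
Qed.

Lemma linear_ract (b : A) : linear (fun t : ind_data => t ◁ b).
Proof. by apply: linC_ract1. Qed.

Lemma linear_csw_ind (V : lmodType k) (f : ind_data -> H -> V) :
  (forall y, linear (f^~ y)) -> (forall x, linear (f x)) ->
  linear (fun t : indT => \csw_(t0, t1 <- (t : ind_data)) f t0 t1).
Proof. exact: csw2_lin. Qed.

Lemma ind_axioms : relhopf_axioms ind_data.
Proof.
split.
- move=> t b; move: t; apply: ind_ext => [||n a].
  + exact: linC_map (linear_ract b).
  + by apply: linear_csw_ind; clin.
  rewrite ind_ractE ind_rhoE' csw_ind; [|clin..].
  have P : balanced (@kact _ A) (@kscale _ H)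
      (fun a0 a1 => pureB n a0 ⊗ a1).
    by apply: kbalanced; rewrite /pureB; clin.
  rewrite [LHS]/csw2 (rho_amul (caP A)) (tlift_tlift _ _ P).
  apply: eq_tlift => a0 a1; rewrite (tlift_tlift _ _ P).
  by apply: eq_tlift => b0 b1; rewrite (tlift_pure P) ind_ractE.
- apply: ind_ext => [||n a]; [exact: linear_ract|exact: linC_id|].
  by rewrite ind_ractE (amul1r (caP A)).
- move=> t b c; move: t; apply: ind_ext => [||n a].
  + by apply: (@linC_ract1 _ _ _ _ ind_data) => //; apply: linear_ract.
  + by apply: linear_csw_ind; clin.
  rewrite !ind_ractE (amulA (caP A)) csw_ind; [|clin..].
  pose F : {linear A -> indT} := HB.pack (pureB n)
    (GRing.isLinear.Build k A indT *:%R (pureB n) (pureB_linear n)).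
  rewrite -[LHS]/(F _) tliftD; apply: eq_tlift => a0 a1.
  rewrite tliftD; apply: eq_tlift => b0 b1.
  rewrite tliftD; apply: eq_tlift => c0 c1.
  by rewrite ind_ractE; apply: (linearZ_LR F).
Qed.

Definition ind : rel_hopf_module A := RelHopfModule ind_axioms.

End Object.
End Induction.

Record category := Category {
  obj :> Type;
  hom : obj -> obj -> Type;
  idm : forall x, hom x x;
  compm : forall x y z, hom y z -> hom x y -> hom x z;
  compm1l : forall x y (f : hom x y), compm (idm y) f = f;
  compm1r : forall x y (f : hom x y), compm f (idm x) = f;
  compmA : forall x y z t (h : hom z t) (g : hom y z) (f : hom x y),
    compm h (compm g f) = compm (compm h g) f
}.
Arguments idm {c} x.
Arguments compm {c x y z} g f.

Record functor (C D : category) := Functor {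
  fobj :> C -> D;
  fmap : forall x y, hom x y -> hom (fobj x) (fobj y);
  fmap1 : forall x, fmap (idm x) = idm (fobj x);
  fmapM : forall x y z (g : hom y z) (f : hom x y),
    fmap (compm g f) = compm (fmap g) (fmap f)
}.
Arguments fmap {C D} _ {x y} _.

Definition functor_id (C : category) : functor C C :=
  @Functor C C id (fun x y f => f) (fun _ => erefl) (fun _ _ _ _ _ => erefl).

Section FunctorComp.
Variables (C D E : category) (G : functor D E) (F : functor C D).

Lemma fcomp_fmap1 x : fmap G (fmap F (idm x)) = idm (G (F x)).
Proof. by rewrite !fmap1. Qed.

Lemma fcomp_fmapM x y z (g : hom y z) (f : hom x y) :
  fmap G (fmap F (compm g f)) = compm (fmap G (fmap F g)) (fmap G (fmap F f)).
Proof. by rewrite !fmapM. Qed.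

Definition functor_comp : functor C E :=
  @Functor C E (fun x => G (F x)) (fun x y f => fmap G (fmap F f))
    fcomp_fmap1 fcomp_fmapM.

End FunctorComp.

Definition is_iso (C : category) (x y : C) (f : hom x y) : Prop :=
  exists g : hom y x, compm g f = idm x /\ compm f g = idm y.

Definition naturally_isomorphic (C D : category) (F G : functor C D) : Prop :=
  exists theta : forall x, hom (F x) (G x),
    (forall x, is_iso (theta x)) /\
    (forall x y (f : hom x y),
       compm (theta y) (fmap F f) = compm (fmap G f) (theta x)).

(* The two composites are naturally isomorphic to the identity functors, by
   arbitrary natural isomorphisms. *)
Definition inverse_equivalences (C D : category) (F : functor C D)
    (G : functor D C) : Prop :=
  naturally_isomorphic (functor_comp G F) (functor_id C) /\
  naturally_isomorphic (functor_comp F G) (functor_id D).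

Lemma linear_ext (R : pzRingType) (U V : lmodType R) (f g : {linear U -> V}) :
  f =1 g -> f = g.
Proof.
case: f g => f cf [g cg] /= /funext fg.
move: cf cg; rewrite fg => -[[p] [q]] [[p'] [q']].
by rewrite (Prop_irrelevance p p') (Prop_irrelevance q q').
Qed.

Section Categories.
Variables (k : fieldType) (H : coquasi_bialgebra k) (A : comodule_algebra H).
Local Notation B := (coinv_alg A).

Lemma relhopf_hom_ext (M N : relhopf_data A) (f g : relhopf_hom M N) :
  f =1 g -> f = g.
Proof.
case: f g => f fr fa [g gr ga] /= /linear_ext fg; subst g.
by congr RelhopfHom; apply: Prop_irrelevance.
Qed.

Definition mod_hom (M N : rmod A) : Type := {linear M -> N}.

Definition mod_id (M : rmod A) : mod_hom M M := idfun.
Definition mod_comp (M N P : rmod A) (g : mod_hom N P) (f : mod_hom M N) :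
  mod_hom M P := (g : {linear N -> P}) \o (f : {linear M -> N}).

Definition cat_mod : category.
Proof.
by refine (@Category (rmod A) mod_hom mod_id mod_comp _ _ _) => *;
  apply: linear_ext.
Defined.

Section Hom.
Variables M N P : rel_hopf_module A.

Lemma rh_id_colinear (m : M) :
  rho M (idfun m) = \csw_(m0, m1 <- m) idfun m0 ⊗ m1.
Proof. exact: esym (tliftE (@idfun _) _). Qed.

Definition rh_id : relhopf_hom M M :=
  @RelhopfHom _ _ _ M M idfun rh_id_colinear (fun _ _ => erefl).

Variables (g : relhopf_hom N P) (f : relhopf_hom M N).

Lemma rh_comp_colinear (m : M) :
  rho P ((g \o f) m) = \csw_(m0, m1 <- m) (g \o f) m0 ⊗ m1.
Proof.
have Q : balanced (@kact _ N) (@kscale _ H) (fun n0 n1 => g n0 ⊗ n1).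
  by apply: kbalanced; clin.
rewrite [LHS](rh_colinear g) /csw2 (rh_colinear f) /csw2 (tlift_tlift _ _ Q).
by apply: eq_tlift => x y; apply: (tlift_pure Q).
Qed.

Lemma rh_comp_act (m : M) (a : A) : (g \o f) (m ◁ a) = (g \o f) m ◁ a.
Proof. by rewrite /= !rh_act. Qed.

Definition rh_comp : relhopf_hom M P :=
  @RelhopfHom _ _ _ M P (g \o f) rh_comp_colinear rh_comp_act.

End Hom.

Definition cat_relhopf : category.
Proof.
by refine (@Category (rel_hopf_module A) (fun M N => relhopf_hom M N)
  rh_id rh_comp _ _ _) => *; apply: relhopf_hom_ext.
Defined.

Section CoinvMap.
Variables (M N : rel_hopf_module A) (f : relhopf_hom M N).

Lemma coinv_map_subproof (m : coinv_mod M) : f (val m) \in coinv_pred N.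
Proof.
rewrite unfold_in; apply/eqP; rewrite rh_colinear.
by rewrite (csw2_pure _ _ (coinvP (m : coinv M))) //; clin.
Qed.

Definition coinv_map_fun (m : coinv_mod M) : coinv_mod N :=
  Coinv (coinv_map_subproof m).

Lemma coinv_map_linear : linear coinv_map_fun.
Proof.
move=> b m n; apply: val_inj; rewrite /= linearD; congr (_ + _).
exact: rh_act.
Qed.

Definition coinv_map : mod_hom (coinv_mod M) (coinv_mod N) :=
  HB.pack coinv_map_fun
    (GRing.isLinear.Build B^c (coinv_mod M) (coinv_mod N) *:%R coinv_map_fun
       coinv_map_linear).

End CoinvMap.

Definition coinv_functor : functor cat_relhopf cat_mod.
Proof.
refine (@Functor cat_relhopf cat_mod (fun M => coinv_mod M) coinv_map _ _).
- by move=> M; apply: linear_ext => m; apply: val_inj.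
- by move=> M N P g f; apply: linear_ext => m; apply: val_inj.
Defined.

Section IndMap.
Variables (N P : rmod A) (f : {linear N -> P}).

Definition ind_map_fun (n : N) (a : A) : indT P := pureB (f n) a.

Lemma ind_map_balanced : balanced (@ractB _ _ A N) (@lmulB _ _ A) ind_map_fun.
Proof.
rewrite /ind_map_fun; split.
- by move=> n n' a; rewrite linearD; apply: pureDl.
- by move=> n; apply: pureB_linear.
- by move=> n b a; rewrite /ractB linearZ; apply: pureB_bal.
Qed.

Definition ind_lin : {linear indT N -> indT P} := tlin ind_map_balanced.

Lemma ind_linE n a : ind_lin (pureB n a) = pureB (f n) a.
Proof. exact: (tlift_pure ind_map_balanced n a). Qed.

Lemma ind_lin_colinear (t : ind_data N) :
  rho (ind_data P) (ind_lin t) = \csw_(t0, t1 <- t) (ind_lin t0 : ind_data P) ⊗ t1.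
Proof.
have P1 (y : H) : linear (fun t0 : ind_data N => (ind_lin t0 : ind_data P) ⊗ y).
  exact: (linC_pure1 _ (linearP ind_lin)).
have P2 (x : ind_data N) : linear (fun y : H => (ind_lin x : ind_data P) ⊗ y).
  by clin.
move: t; apply: ind_ext => [||n a].
- exact: (linC_map (rho (ind_data P)) (linearP ind_lin)).
- exact: linear_csw_ind.
rewrite ind_linE ind_rhoE' csw_ind //.
by apply: eq_csw2 => a0 a1; rewrite ind_linE.
Qed.

Lemma ind_lin_act (t : ind_data N) (a : A) :
  ind_lin (t ◁ a) = (ind_lin t : ind_data P) ◁ a.
Proof.
move: t; apply: ind_ext => [||n b].
- by move=> c x y; rewrite linear_ract linearP.
- by move=> c x y; rewrite linearP linear_ract.
by rewrite ind_ractE !ind_linE ind_ractE.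
Qed.

Definition ind_map : relhopf_hom (ind N) (ind P) :=
  @RelhopfHom _ _ _ (ind N) (ind P) ind_lin ind_lin_colinear ind_lin_act.

End IndMap.

Definition ind_functor : functor cat_mod cat_relhopf.
Proof.
refine (@Functor cat_mod cat_relhopf (fun N => ind N) ind_map _ _).
- move=> N; apply: relhopf_hom_ext.
  by apply: ind_ext => [||n a]; [exact: linearP|exact: linC_id|apply: ind_linE].
- move=> N P Q g f; apply: relhopf_hom_ext.
  apply: ind_ext => [||n a]; [exact: linearP|exact: linearP|].
  apply: (etrans (ind_linE _ n a)); apply: esym.
  exact: etrans (congr1 (ind_lin g) (ind_linE f n a)) (ind_linE g (f n) a).
Defined.

Definition exact_at (U V W : Type) (z : W) (f : U -> V) (g : V -> W) : Prop :=
  forall v, g v = z <-> exists u, f u = v.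

(* A is faithfully flat as a left B-module: a sequence N1 -> N2 -> N3 of right
   B-modules is exact if and only if it is so after applying - ⊗_B A. *)
Definition faithfully_flat : Prop :=
  forall (N1 N2 N3 : rmod A) (f : {linear N1 -> N2}) (g : {linear N2 -> N3}),
    exact_at 0 f g <-> exact_at 0 (ind_lin f) (ind_lin g).

End Categories.

Section Galois.
Variables (k : fieldType) (H : coquasi_hopf k) (A : comodule_algebra H).
Local Notation B := (coinv_alg A).

Definition rmulB (a : A) (b : B) : A := a ⊙ (val b : A).

Definition AtensA := tens rmulB (@lmulB _ _ A).
HB.instance Definition _ := GRing.Lmodule.on AtensA.

Definition can_fun (a b : A) : (A ⊗ H)%type :=
  \csw_(a0, a1 <- a) \csw_(b0, b1, b2, b3, b4 <- b)
    (a0 ⊙ b0) ⊗ (omegaV a1 (beta H b2 *: b1) (antipode H b3) *: b4).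

Lemma can_balanced : balanced rmulB (@lmulB _ _ A) can_fun.
Proof.
have F1 (b0 : A) (h : H) : balanced (@kact _ A) (@kscale _ H) (fun a0 a1 =>
    \sw_(b1, b2, b3, b4 <- h) (a0 ⊙ b0) ⊗
      (omegaV a1 (beta H b2 *: b1) (antipode H b3) *: b4)).
  by apply: kbalanced; clin.
have F2 (a0 : A) (a1 : H) : balanced (@kact _ A) (@kscale _ H) (fun b0 h =>
    \sw_(b1, b2, b3, b4 <- h) (a0 ⊙ b0) ⊗
      (omegaV a1 (beta H b2 *: b1) (antipode H b3) *: b4)).
  by apply: kbalanced; clin.
have F3 b : balanced (@kact _ A) (@kscale _ H) (fun a0 a1 =>
    \csw_(b0, b1, b2, b3, b4 <- b) (a0 ⊙ b0) ⊗
      (omegaV a1 (beta H b2 *: b1) (antipode H b3) *: b4)).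
  exact: balanced_tlift.
rewrite /can_fun; split.
- move=> a a' b; rewrite [LHS]/csw2 linearD.
  by have := tlift_is_linear (F3 b) 1 (rho A a) (rho A a'); rewrite !scale1r.
- move=> a; apply: tlift_sum_linear => a0 a1.
  by apply: tlift_comp; [exact: F2 | exact: linearP].
- move=> a b c; have bP := coinvP (b : coinv A).
  rewrite [LHS]/csw2 (@rho_ract_coinvr _ _ _ (regular A)) // (tlift_tlift _ _ (F3 c)).
  apply: eq_tlift => a0 a1; rewrite (tlift_pure (F3 c)).
  rewrite [RHS]/csw5 [RHS]/csw2 (@rho_ract_coinvl _ _ _ (regular A)) //.
  rewrite (tlift_tlift _ _ (F2 a0 a1)); apply: eq_tlift => c0 h.
  rewrite (tlift_pure (F2 a0 a1)).
  apply: eq_tlift => b1 h'; apply: eq_tlift => b2 h''; apply: eq_tlift => b3 b4.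
  by congr (_ ⊗ _); apply: amulA_coinv2 bP.
Qed.

Definition can : {linear AtensA -> (A ⊗ H)%type} := tlin can_balanced.

Definition galois : Prop := bijective can.

End Galois.

(* Main.v *)
From HB Require Import structures.
From mathcomp Require Import all_boot all_algebra.
From mathcomp Require Import boolp ring.
From mathcomp Require classical_sets.
Require Import Defs.

(* For M in M_A^H the map canM : M ⊗_B A -> M ⊗ H, m ⊗ a |-> m_0 a_0 ⊗ a_2 pR(m_1, a_1),
   is natural in M and extends can, which is the case M = A.

   (1) => (2). For M = V ⊗ A the map canM is V ⊗ can up to an invertible twist by omega^-1;
   since every M is a quotient of M ⊗ A, it is bijective for all M. Let H carry the trivial
   coaction and let delta : M -> H ⊗ M, m |-> m_1 ⊗ m_0 - 1 ⊗ m, whose kernel is M^coH.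
   Through canM, the map delta ⊗_B A becomes a map M ⊗ H -> H ⊗ M ⊗ H whose kernel is the image
   of the split monomorphism coaug : M -> M ⊗ H, m |-> m_0 ⊗ beta(m_1) m_2. Flatness then
   identifies M^coH ⊗_B A with M, and faithful flatness identifies N with (N ⊗_B A)^coH.

   (2) => (1). Kernels in M_A^H are kernels of vector spaces, so an equivalence preserves and
   reflects exactness. For the Galois property, consider the bijective counit of H ⊗ A: as a
   B-module, A is a retract of (H ⊗ A)^coH, with section a |-> beta(S^-1(a_1)) S^-1(a_2) ⊗ a_0.
   The counit composed with this section factors through can, so can is injective; and
   composing can with the retraction yields a map through the counit whose image contains all
   the 1 ⊗ h, which suffices for surjectivity. *)

Set Implicit Arguments.
Unset Strict Implicit.
Unset Printing Implicit Defensive.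

Import GRing.Theory.
Local Open Scope ring_scope.

(** * Sweedler calculus *)

(** Since H and A are associative only up to [omega], an antipode pair inside a longer product
    cannot be cancelled before brackets are moved. The associators arising in this way are collected
    in the forms [pR], [qR], [pL], [qL]. The [shift] identities say what a cancellation costs, and
    the two normalization axioms of the antipode make [qR] and [pR] mutually inverse in a twisted
    sense; with these, the computations known for Hopf algebras carry over. The map delta is linear
    over B but in general not over A, so its kernel is not formed in the category of relative Hopf
    modules; [canM] makes the induced map computable, and the trivial coaction on H removes every
    associator involving that leg. For the converse H carries its regular coaction, because the
    coinvariants of H ⊗ A must be rich enough to contain A; the inverse antipode is what embeds A
    there. Descent data and coinvariants are general tensors, not pure ones. Equations such as
    rho(e) = e ⊗ 1 are therefore exploited by applying linear maps on triple tensor products to both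
    sides and chaining the results. *)

Section SweedlerCalculus.
Variables (k : fieldType) (H : coquasi_bialgebra k).

Section Linear.
Variable V : lmodType k.

Lemma sw2A (f : H -> H -> H -> V) (h : H) :
  (forall y z, linear (fun x => f x y z)) ->
  (forall x z, linear (fun y => f x y z)) -> (forall x y, linear (f x y)) ->
  \sw_(x, y <- h) \sw_(a, b <- x) f a b y =
  \sw_(a, w <- h) \sw_(b, y <- w) f a b y.
Proof. by move=> f1 f2 f3; rewrite -(sw_coassoc h f1 f2 f3). Qed.

Lemma csw2A (M : comodule H) (f : M -> H -> H -> V) (m : M) :
  (forall y z, linear (fun x => f x y z)) ->
  (forall x z, linear (fun y => f x y z)) -> (forall x y, linear (f x y)) ->
  \csw_(x, y <- m) \csw_(a, b <- x) f a b y =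
  \csw_(a, w <- m) \sw_(b, y <- w) f a b y.
Proof.
move=> f1 f2 f3.
have f23 x : balanced (@kact _ H) (@kscale _ H) (f x) by apply: kbalanced.
have fP : balanced (@kact _ M) (@kscale _ (H ⊗ H)%type) (fun x t => tlift (f x) t).
  apply: kbalanced => [t|x]; last exact: tlift_is_linear.
  exact: tlift_sum_linear.
have := congr1 (tlift (fun x t => tlift (f x) t)) (rhoA m).
rewrite !(tlift_tlift _ _ fP) => E; symmetry.
transitivity (\tsum_(x, y <- rho M m) tlift (fun x t => tlift (f x) t)
   (\tsum_(y1, y2 <- comul H y) x ⊗ (y1 ⊗ y2))).
  apply: eq_tlift => x y; rewrite (tlift_tlift _ _ fP); apply: eq_tlift => y1 y2.
  by rewrite !tlift_pure.
rewrite E; apply: eq_tlift => x y; rewrite (tlift_tlift _ _ fP).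
by apply: eq_tlift => x1 x2; rewrite !tlift_pure.
Qed.

Lemma sw2_hmul (f : H -> H -> V) (h g : H) :
  (forall y, linear (f^~ y)) -> (forall x, linear (f x)) ->
  sw2 (h ⋅ g) f = \sw_(h1, h2 <- h) \sw_(g1, g2 <- g) f (h1 ⋅ g1) (h2 ⋅ g2).
Proof.
move=> f1 f2; have P := kbalanced f1 f2.
rewrite {1}/sw2 (comul_mul (cqbP H)) (tlift_tlift _ _ P); apply: eq_tlift => h1 h2.
by rewrite (tlift_tlift _ _ P); apply: eq_tlift => g1 g2; rewrite (tlift_pure P).
Qed.

Lemma csw2_amul (A : comodule_algebra H) (f : A -> H -> V) (a b : A) :
  (forall y, linear (f^~ y)) -> (forall x, linear (f x)) ->
  csw2 (a ⊙ b) f = \csw_(a0, a1 <- a) \csw_(b0, b1 <- b) f (a0 ⊙ b0) (a1 ⋅ b1).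
Proof.
move=> f1 f2; have P := kbalanced f1 f2.
rewrite {1}/csw2 (rho_amul (caP A)) (tlift_tlift _ _ P); apply: eq_tlift => h1 h2.
by rewrite (tlift_tlift _ _ P); apply: eq_tlift => g1 g2; rewrite (tlift_pure P).
Qed.

Lemma csw2_ract (A : comodule_algebra H) (M : rel_hopf_module A) (f : M -> H -> V)
    (m : M) (b : A) :
  (forall y, linear (f^~ y)) -> (forall x, linear (f x)) ->
  csw2 (m ◁ b) f = \csw_(m0, m1 <- m) \csw_(b0, b1 <- b) f (m0 ◁ b0) (m1 ⋅ b1).
Proof.
move=> f1 f2; have P := kbalanced f1 f2.
rewrite {1}/csw2 (rho_ract (rhP M)) (tlift_tlift _ _ P); apply: eq_tlift => h1 h2.
by rewrite (tlift_tlift _ _ P); apply: eq_tlift => g1 g2; rewrite (tlift_pure P).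
Qed.

Lemma csw2_aone (A : comodule_algebra H) (f : A -> H -> V) :
  (forall y, linear (f^~ y)) -> (forall x, linear (f x)) ->
  csw2 (aone A) f = f (aone A) (hone H).
Proof. by move=> f1 f2; rewrite (csw2_pure f1 f2 (rho_aone (caP A))). Qed.

Lemma scaler_sw2 (h : H) c (f : H -> H -> V) :
  c *: sw2 h f = \sw_(x, y <- h) (c *: f x y).
Proof. exact: scaler_sumr. Qed.

Lemma scaler_csw2 (M : comodule H) (m : M) c (f : M -> H -> V) :
  c *: csw2 m f = \csw_(x, y <- m) (c *: f x y).
Proof. exact: scaler_sumr. Qed.

Lemma sw2_scaler (h : H) (f : H -> H -> k) (v : V) :
  sw2 h f *: v = \sw_(x, y <- h) (f x y *: v).
Proof. exact: scaler_suml. Qed.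

Lemma linear_sw2 (U : lmodType k) (g : U -> V) (h : H) (f : H -> H -> U) :
  linear g -> g (sw2 h f) = \sw_(x, y <- h) g (f x y).
Proof.
move=> gP.
pose G : {linear U -> V} := HB.pack g (GRing.isLinear.Build k U V *:%R g gP).
exact: (linear_sum G).
Qed.

Lemma linear_csw2 (U : lmodType k) (g : U -> V) (M : comodule H) (m : M)
    (f : M -> H -> U) :
  linear g -> g (csw2 m f) = \csw_(x, y <- m) g (f x y).
Proof.
move=> gP.
pose G : {linear U -> V} := HB.pack g (GRing.isLinear.Build k U V *:%R g gP).
exact: (linear_sum G).
Qed.

End Linear.

Lemma sw2A_k (f : H -> H -> H -> k) (h : H) :
  (forall y z, scalar (fun x => f x y z)) ->
  (forall x z, scalar (fun y => f x y z)) -> (forall x y, scalar (f x y)) ->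
  \sw_(x, y <- h) \sw_(a, b <- x) f a b y =
  \sw_(a, w <- h) \sw_(b, y <- w) f a b y.
Proof. exact: (@sw2A k^o). Qed.

Lemma sw2_hmul_k (f : H -> H -> k) (h g : H) :
  (forall y, scalar (f^~ y)) -> (forall x, scalar (f x)) ->
  sw2 (h ⋅ g) f = \sw_(h1, h2 <- h) \sw_(g1, g2 <- g) f (h1 ⋅ g1) (h2 ⋅ g2).
Proof. exact: (@sw2_hmul k^o). Qed.

Lemma sw2_one_k (f : H -> H -> k) :
  (forall y, scalar (f^~ y)) -> (forall x, scalar (f x)) ->
  sw2 (hone H) f = f (hone H) (hone H).
Proof. exact: (@sw2_one _ _ k^o). Qed.

Lemma sw2_csw2_exchange (V : zmodType) (M : comodule H) (h : H) (m : M)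
    (f : H -> H -> M -> H -> V) :
  \sw_(h1, h2 <- h) \csw_(g1, g2 <- m) f h1 h2 g1 g2 =
  \csw_(g1, g2 <- m) \sw_(h1, h2 <- h) f h1 h2 g1 g2.
Proof. exact: tlift_exchange. Qed.

Lemma csw2_exchange (V : zmodType) (M N : comodule H) (h : N) (m : M)
    (f : N -> H -> M -> H -> V) :
  \csw_(h1, h2 <- h) \csw_(g1, g2 <- m) f h1 h2 g1 g2 =
  \csw_(g1, g2 <- m) \csw_(h1, h2 <- h) f h1 h2 g1 g2.
Proof. exact: tlift_exchange. Qed.

Lemma tlift_comul (V : zmodType) (f : H -> H -> V) (h : H) :
  tlift f (comul H h) = sw2 h f.
Proof. by []. Qed.

Lemma tlift_rho (M : comodule H) (V : zmodType) (f : M -> H -> V) (m : M) :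
  tlift f (rho M m) = csw2 m f.
Proof. by []. Qed.

Lemma omegaZ1 c (h g x : H) : omega (c *: h) g x = c * omega h g x.
Proof. by rewrite /omega !pureZl linearZ. Qed.
Lemma omegaZ2 c (h g x : H) : omega h (c *: g) x = c * omega h g x.
Proof. by rewrite /omega pureZr pureZl linearZ. Qed.
Lemma omegaZ3 c (h g x : H) : omega h g (c *: x) = c * omega h g x.
Proof. by rewrite /omega !pureZr linearZ. Qed.
Lemma omegaVZ1 c (h g x : H) : omegaV (c *: h) g x = c * omegaV h g x.
Proof. by rewrite /omegaV !pureZl linearZ. Qed.
Lemma omegaVZ2 c (h g x : H) : omegaV h (c *: g) x = c * omegaV h g x.
Proof. by rewrite /omegaV pureZr pureZl linearZ. Qed.
Lemma omegaVZ3 c (h g x : H) : omegaV h g (c *: x) = c * omegaV h g x.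
Proof. by rewrite /omegaV !pureZr linearZ. Qed.
Lemma hmulZl c (h g : H) : (c *: h) ⋅ g = c *: (h ⋅ g).
Proof. by rewrite /hmul pureZl linearZ. Qed.
Lemma hmulZr c (h g : H) : h ⋅ (c *: g) = c *: (h ⋅ g).
Proof. by rewrite /hmul pureZr linearZ. Qed.

End SweedlerCalculus.

Section SweedlerAntipode.
Variables (k : fieldType) (H : coquasi_hopf k).
Local Notation S := (antipode H).

Lemma sw2_antipode (V : lmodType k) (f : H -> H -> V) (h : H) :
  (forall y, linear (f^~ y)) -> (forall x, linear (f x)) ->
  sw2 (S h) f = \sw_(h1, h2 <- h) f (S h2) (S h1).
Proof.
move=> f1 f2; have P := kbalanced f1 f2.
rewrite {1}/sw2 (antipode_comul (cqhP H)) (tlift_tlift _ _ P).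
by apply: eq_tlift => h1 h2; rewrite (tlift_pure P).
Qed.

Lemma sw2_antipode_k (f : H -> H -> k) (h : H) :
  (forall y, scalar (f^~ y)) -> (forall x, scalar (f x)) ->
  sw2 (S h) f = \sw_(h1, h2 <- h) f (S h2) (S h1).
Proof. exact: (@sw2_antipode k^o). Qed.

Lemma antipode_one : S (hone H) = hone H.
Proof.
have := antipode_alpha (cqhP H) (hone H).
rewrite /sw3 sw2_one; [|clin..]; rewrite sw2_one; [|clin..].
by rewrite (alpha_one (cqhP H)) !scale1r (hmul1r (cqbP H)).
Qed.

End SweedlerAntipode.

(* Extension point of mlin, redefined where new linear maps appear. *)
Ltac mlin_head := fail.
Ltac mlin_step := lazymatch goal with
  | |- GRing.linear_for _ (fun u => u) => exact: linC_id
  | |- GRing.linear_for _ (@omega _ _ _ _) => exact: omegaL3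
  | |- GRing.linear_for _ (@omegaV _ _ _ _) => exact: omegaVL3
  | |- GRing.linear_for _ (@hmul _ _ _) => exact: hmulLr
  | |- GRing.linear_for _ (@amul _ _ _ _) => apply: linC_amul2; exact: linC_id
  | |- GRing.linear_for _ (@ract _ _ _ _ _) => apply: linC_ract2; exact: linC_id
  | |- GRing.linear_for _ (pure _ _ _) => exact: pureLr
  | |- GRing.linear_for _ (@eps _ _) => exact: epsL
  | |- GRing.linear_for _ (fun u => @pure _ _ _ _ _ _ (@?f u) (@?g u)) =>
    first [apply: linC_pure1 | apply: linC_pure2]
  | |- GRing.linear_for _ (fun u => @csw2 _ _ _ _ (@?f u) (@?g u)) =>
    first [apply: linC_csum => ? ? | apply: linC_csw2 => [|?|?]]
  | |- GRing.linear_for _ (fun u => @sw2 _ _ _ (@?f u) (@?g u)) =>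
    first [apply: linC_sum => ? ? | apply: linC_sum_k => ? ?
          | apply: linC_sw2 => [|?|?] | apply: linC_sw2_k => [|?|?]]
  | |- GRing.linear_for _ (fun u => @hmul _ _ (@?f u) (@?g u)) =>
    first [apply: linC_hmul1 | apply: linC_hmul2]
  | |- GRing.linear_for _ (fun u => @amul _ _ _ (@?f u) (@?g u)) =>
    first [apply: linC_amul1 | apply: linC_amul2]
  | |- GRing.linear_for _ (fun u => @ract _ _ _ _ (@?f u) (@?g u)) =>
    first [apply: linC_ract1 | apply: linC_ract2]
  | |- GRing.linear_for _ (fun u => @omega _ _ (@?f u) (@?g u) (@?h u)) =>
    first [apply: linC_omega1 | apply: linC_omega2 | apply: linC_omega3]
  | |- GRing.linear_for _ (fun u => @omegaV _ _ (@?f u) (@?g u) (@?h u)) =>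
    first [apply: linC_omegaV1 | apply: linC_omegaV2 | apply: linC_omegaV3]
  | |- GRing.linear_for _ (fun u => @eps _ _ (@?f u)) => apply: linC_eps
  | |- GRing.linear_for _ (fun u => @GRing.scale _ _ (@?f u) (@?g u)) =>
    first [apply: scalarZl | apply: linearZr]
  | |- GRing.linear_for _ (fun u => @GRing.mul _ (@?f u) (@?g u)) =>
    first [apply: scalarMl | apply: scalarMr]
  | |- GRing.linear_for _ (fun u => @tlift _ _ _ _ _ _ _ (@?f u) _) =>
    apply: tlift_sum_linear => ? ?
  | |- GRing.linear_for _ (fun u => GRing.Linear.sort _ (@?f u)) =>
    first [apply: linC_map | apply: linC_form | mlin_head | exact: linearP]
  | |- _ => first [mlin_head | exact: linearP | apply: linC_map | apply: linC_form]
  end.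
Ltac mlin := rewrite /csw5 /sw5 /sw4 /sw3; intros; cbv beta; solve [repeat mlin_step].

Ltac swexch := first [apply: sw2_exchange | apply: sw2_csw2_exchange
  | apply: esym; apply: sw2_csw2_exchange | apply: csw2_exchange].

(* On a goal [T = ?e]: brings the sum over the parts of [x] to the front. *)
Ltac swfront x := cbv beta; lazymatch goal with
  | |- sw2 x _ = _ => reflexivity
  | |- csw2 x _ = _ => reflexivity
  | |- sw2 _ _ = _ => etransitivity;
      [apply: eq_sw2 => ? ?; swfront x | cbv beta; swexch]
  | |- csw2 _ _ = _ => etransitivity;
      [apply: eq_csw2 => ? ?; swfront x | cbv beta; swexch]
  end.

(** If a leg of the head sum is split again in the body, the inner sum is pulled to the front. If it
    was the left leg, coassociativity moves the splitting to the right leg, and the new inner sum is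
    treated in the same way. *)
Ltac swtop := cbv beta; lazymatch goal with
  | |- sw2 _ _ = _ =>
    etransitivity;
    [ let x := fresh "x" in let y := fresh "y" in
      apply: eq_sw2 => x y;
      lazymatch goal with
      | |- ?T = _ => lazymatch T with
        | context [sw2 x _] => swfront x
        | context [sw2 y _] => swfront y
        | _ => reflexivity
        end
      end
    | cbv beta; lazymatch goal with
      | |- sw2 _ (fun x y => sw2 x _) = _ =>
        etransitivity; [first [apply: sw2A; mlin | apply: sw2A_k; mlin]
          | cbv beta; etransitivity; [apply: eq_sw2 => ? ?; swtop | reflexivity]]
      | |- _ => reflexivity
      end ]
  | |- csw2 _ _ = _ =>
    etransitivity;
    [ let x := fresh "x" in let y := fresh "y" in
      apply: eq_csw2 => x y;
      lazymatch goal with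
      | |- ?T = _ => lazymatch T with
        | context [csw2 x _] => swfront x
        | context [sw2 y _] => swfront y
        | _ => reflexivity
        end
      end
    | cbv beta; lazymatch goal with
      | |- csw2 _ (fun x y => csw2 x _) = _ =>
        etransitivity; [apply: csw2A; mlin
          | cbv beta; etransitivity; [apply: eq_csw2 => ? ?; swtop | reflexivity]]
      | |- _ => reflexivity
      end ]
  end.

(* On a goal [T = ?e], where the leg [x] occurs in [T] only as [eps x]. *)
Ltac sweps x := cbv beta; lazymatch goal with
  | |- sw2 _ _ = _ => etransitivity; [apply: eq_sw2 => ? ?; sweps x
      | cbv beta; apply: esym; first [apply: mulr_sw2 | apply: scaler_sw2]]
  | |- csw2 _ _ = _ => etransitivity; [apply: eq_csw2 => ? ?; sweps x
      | cbv beta; apply: esym; apply: scaler_csw2]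
  | |- ?B = _ => lazymatch B with
    | eps x * _ => reflexivity
    | eps x *: _ => reflexivity
    | context C [@eps ?k0 _ x] =>
      let o := constr:(@GRing.one k0) in
      let B' := context C [o] in
      first [transitivity (eps x * B'); [ring | reflexivity]
       | transitivity (eps x *: B');
         [rewrite ?scalerA; congr (_ *: _); ring | reflexivity]]
    end
  end.

Ltac swcounit_top := lazymatch goal with
  | |- sw2 _ (fun x y => eps x * _) = _ => apply: sw_epsl_k; mlin
  | |- sw2 _ (fun x y => eps y * _) = _ => apply: sw_epsr_k; mlin
  | |- sw2 _ (fun x y => eps x *: _) = _ => apply: sw_epsl; mlin
  | |- sw2 _ (fun x y => eps y *: _) = _ => apply: sw_epsr; mlin
  | |- csw2 _ (fun x y => eps y *: _) = _ => apply: csw_eps; mlin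
  end.

Ltac swcounit_legs x y := lazymatch goal with
  | |- ?T = _ => lazymatch T with
    | context [eps x] => sweps x
    | context [eps y] => sweps y
    end
  end.

(** A leg occurring only under [eps] is factored out of the body, and the head sum disappears by a
    counit axiom. When this fails, [swn] falls back on [swtop]. *)
Ltac swcounit := lazymatch goal with
  | |- sw2 _ _ = _ => etransitivity;
    [let x := fresh "x" in let y := fresh "y" in
     apply: eq_sw2 => x y; swcounit_legs x y | cbv beta; swcounit_top]
  | |- csw2 _ _ = _ => etransitivity;
    [let x := fresh "x" in let y := fresh "y" in
     apply: eq_csw2 => x y; swcounit_legs x y | cbv beta; swcounit_top]
  end.

Ltac swsimp := rewrite ?(eps_mul (cqbP _)) ?(antipode_eps (cqhP _))
  ?(eps_one (cqbP _)) ?(hmul1l (cqbP _)) ?(hmul1r (cqbP _)) ?(amul1l (caP _)) ?(amul1r (caP _))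
  ?(ract1 (rhP _)) ?antipode_one.

(* Extension point of swn: rewrites the coaction on a pure tensor. *)
Ltac swpure := fail.

(* On a goal [T = ?e]: flattens nested Sweedler sums into right combs. *)
Ltac swn := cbv beta; lazymatch goal with
  | |- sw2 (_ ⋅ _) _ = _ =>
    etransitivity; [first [apply: sw2_hmul; mlin | apply: sw2_hmul_k; mlin] | swn]
  | |- sw2 (hone _) _ = _ =>
    etransitivity; [first [apply: sw2_one; mlin | apply: sw2_one_k; mlin] | swn]
  | |- sw2 (GRing.Linear.sort (antipode _) _) _ = _ =>
    etransitivity; [first [apply: sw2_antipode; mlin | apply: sw2_antipode_k; mlin] | swn]
  | |- sw2 _ _ = _ => etransitivity; [apply: eq_sw2 => ? ?; swn | cbv beta; first [swcounit | swtop]]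
  | |- csw2 (_ ⊙ _) _ = _ => etransitivity; [apply: csw2_amul; mlin | swn]
  | |- csw2 (_ ◁ _) _ = _ => etransitivity; [apply: csw2_ract; mlin | swn]
  | |- csw2 (aone _) _ = _ => etransitivity; [apply: csw2_aone; mlin | swn]
  | |- tlift _ _ = _ =>
    etransitivity; [first [apply: tlift_comul | apply: tlift_rho] | swn]
  | |- csw2 (pure _ _ _ _) _ = _ => etransitivity; [swpure | swn]
  | |- csw2 (pureB _ _) _ = _ => etransitivity; [swpure | swn]
  | |- csw2 _ _ = _ => etransitivity; [apply: eq_csw2 => ? ?; swn | cbv beta; first [swcounit | swtop]]
  | |- sw2 _ _ * _ = _ => etransitivity; [apply: mulr_sw2l | swn]
  | |- _ * sw2 _ _ = _ => etransitivity; [apply: mulr_sw2 | swn]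
  | |- _ *: sw2 _ _ = _ => etransitivity; [apply: scaler_sw2 | swn]
  | |- _ *: csw2 _ _ = _ => etransitivity; [apply: scaler_csw2 | swn]
  | |- sw2 _ _ *: _ = _ => etransitivity; [apply: sw2_scaler | swn]
  | |- (?a * ?b) * ?c = _ =>
    first [lazymatch b with context [sw2 _ _] => idtac end;
           etransitivity; [apply: (congr1 (fun z => z * c)); swn | swn]
         | lazymatch a with context [sw2 _ _] => idtac end;
           etransitivity; [apply: (congr1 (fun z => z * c)); swn | swn]
         | swsimp; reflexivity]
  | |- ?a *: (?b *: ?c) = _ =>
    first [lazymatch c with context [sw2 _ _] => idtac
           | context [csw2 _ _] => idtac end;
           etransitivity; [apply: (congr1 (fun z => a *: z)); swn | swn]
         | lazymatch b with context [sw2 _ _] => idtac end;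
           etransitivity; [apply: (congr1 (fun z => a *: z)); swn | swn]
         | swsimp; reflexivity]
  | |- (?a * ?b) *: ?c = _ =>
    first [lazymatch b with context [sw2 _ _] => idtac end;
           etransitivity; [apply: (congr1 (fun z => z *: c)); swn | swn]
         | lazymatch a with context [sw2 _ _] => idtac end;
           etransitivity; [apply: (congr1 (fun z => z *: c)); swn | swn]
         | swsimp; reflexivity]
  | |- _ => swsimp; reflexivity
  end.

Ltac swleaf := rewrite ?(omegaZ1, omegaZ2, omegaZ3, omegaVZ1, omegaVZ2, omegaVZ3,
    hmulZl, hmulZr, pureZl, pureZr) ?scalerA ?mul1r ?mulr1 ?scale1r;
  first [reflexivity | ring | congr (_ *: _); first [reflexivity | ring]].

(** Both sides are now combs over the same elements, possibly in different orders. Each sum on the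
    left is matched with the sum on the right over the same element, until only scalars remain to be
    compared. *)
Ltac swcmp := cbv beta; lazymatch goal with
  | |- sw2 ?h _ = _ => etransitivity;
      [| apply: esym; swfront h]; cbv beta; apply: eq_sw2 => ? ?; swcmp
  | |- csw2 ?h _ = _ => etransitivity;
      [| apply: esym; swfront h]; cbv beta; apply: eq_csw2 => ? ?; swcmp
  | |- _ => swleaf
  end.

(* Equality of Sweedler expressions up to coassociativity, exchange of sums and
   commutation of scalars. *)
Ltac sweq := rewrite /csw5 /sw5 /sw4 /sw3;
  etransitivity; [swn|]; apply: esym; etransitivity; [swn|]; apply: esym; swcmp.

(** * The cocycle identities *)

Section Convolution.
Variables (k : fieldType) (H : coquasi_bialgebra k).

(** Multilinear forms in place of the dual of the fourfold tensor power of H: under convolution they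
    form a monoid, in which the cocycle condition is one equation between invertible elements and
    can be solved formally for its factors. *)
Record form4 := Form4 {
  form4_fun :> H -> H -> H -> H -> k;
  form4_1 : forall g x y, scalar (fun h => form4_fun h g x y);
  form4_2 : forall h x y, scalar (fun g => form4_fun h g x y);
  form4_3 : forall h g y, scalar (fun x => form4_fun h g x y);
  form4_4 : forall h g x, scalar (fun y => form4_fun h g x y)
}.

Lemma form4_ext (f f' : form4) : (forall h g x y, f h g x y = f' h g x y) -> f = f'.
Proof.
case: f f' => f a b c d [f' a' b' c' d'] /= E.
have {}E : f = f' by do 4 (apply: funext => ?); apply: E.
by case: f' / E a' b' c' d' => *; congr Form4; apply: Prop_irrelevance.
Qed.

Ltac mlin_head ::= first [exact: form4_1 | exact: form4_2 | exact: form4_3 | exact: form4_4].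

Definition conv4_fun (f f' : form4) (h g x y : H) : k :=
  \sw_(h1, h2 <- h) \sw_(g1, g2 <- g) \sw_(x1, x2 <- x) \sw_(y1, y2 <- y)
    (f h1 g1 x1 y1 * f' h2 g2 x2 y2).

Definition conv4 (f f' : form4) : form4.
Proof. by exists (conv4_fun f f'); rewrite /conv4_fun; mlin. Defined.

Lemma conv4A : associative conv4.
Proof.
move=> f1 f2 f3; apply: form4_ext => h g x y; rewrite /= /conv4_fun /= /conv4_fun.
sweq.
Qed.

Definition eps4 : form4.
Proof. by exists (fun h g x y : H => eps h * eps g * eps x * eps y); mlin. Defined.

Lemma conv4_1f : left_id eps4 conv4.
Proof.
move=> f; apply: form4_ext => h g x y; rewrite /= /conv4_fun /=.
rewrite -[RHS](@sw_epsl_k _ _ (fun h => f h g x y)); last by mlin.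
apply: eq_sw2 => h1 h2; rewrite -[f h2 g x y](@sw_epsl_k _ _ (fun g => f h2 g x y)); last by mlin.
rewrite mulr_sw2; apply: eq_sw2 => g1 g2.
rewrite -[f h2 g2 x y](@sw_epsl_k _ _ (fun x => f h2 g2 x y)); last by mlin.
rewrite !mulr_sw2; apply: eq_sw2 => x1 x2.
rewrite -[f h2 g2 x2 y](@sw_epsl_k _ _ (fun y => f h2 g2 x2 y)); last by mlin.
by rewrite !mulr_sw2; apply: eq_sw2 => y1 y2; rewrite !mulrA.
Qed.

Lemma conv4_f1 : right_id eps4 conv4.
Proof.
move=> f; apply: form4_ext => h g x y; rewrite /= /conv4_fun /=.
rewrite -[RHS](@sw_epsr_k _ _ (fun h => f h g x y)); last by mlin.
apply: eq_sw2 => h1 h2; rewrite -[f h1 g x y](@sw_epsr_k _ _ (fun g => f h1 g x y)); last by mlin.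
rewrite mulr_sw2; apply: eq_sw2 => g1 g2.
rewrite -[f h1 g1 x y](@sw_epsr_k _ _ (fun x => f h1 g1 x y)); last by mlin.
rewrite !mulr_sw2; apply: eq_sw2 => x1 x2.
rewrite -[f h1 g1 x1 y](@sw_epsr_k _ _ (fun y => f h1 g1 x1 y)); last by mlin.
by rewrite !mulr_sw2; apply: eq_sw2 => y1 y2; ring.
Qed.

Section Factors.
(* w is omega or its convolution inverse *)
Variable w : H -> H -> H -> k.
Hypotheses (w1 : forall g x, scalar (fun h => w h g x))
  (w2 : forall h x, scalar (fun g => w h g x)) (w3 : forall h g, scalar (fun x => w h g x)).

Let wc1 (U : lmodType k) (f : U -> H) g x : linear f -> scalar (fun u => w (f u) g x).
Proof. exact: (@linear_comp _ U H k^o _ _ (w1 g x)). Qed.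
Let wc2 (U : lmodType k) (f : U -> H) h x : linear f -> scalar (fun u => w h (f u) x).
Proof. exact: (@linear_comp _ U H k^o _ _ (w2 h x)). Qed.
Let wc3 (U : lmodType k) (f : U -> H) h g : linear f -> scalar (fun u => w h g (f u)).
Proof. exact: (@linear_comp _ U H k^o _ _ (w3 h g)). Qed.

Ltac mlin_head ::= first [exact: w3 | apply: wc1 | apply: wc2 | apply: wc3].

(** The five pullbacks of [w] that occur in the cocycle condition. In [form_123] and [form_234] the
    missing argument is sent to the counit; in the other three the adjacent digits are
    multiplied. *)
Definition form_123 : form4.
Proof. by exists (fun h g x y => w h g x * eps y); mlin. Defined.
Definition form_234 : form4.
Proof. by exists (fun h g x y => eps h * w g x y); mlin. Defined.
Definition form_12_3_4 : form4.
Proof. by exists (fun h g x y => w (h ⋅ g) x y); mlin. Defined.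
Definition form_1_23_4 : form4.
Proof. by exists (fun h g x y => w h (g ⋅ x) y); mlin. Defined.
Definition form_1_2_34 : form4.
Proof. by exists (fun h g x y => w h g (x ⋅ y)); mlin. Defined.
End Factors.

Section Inverse.
Variables w v : H -> H -> H -> k.
Hypotheses (w1 : forall g x, scalar (fun h => w h g x))
  (w2 : forall h x, scalar (fun g => w h g x)) (w3 : forall h g, scalar (fun x => w h g x)).
Hypotheses (v1 : forall g x, scalar (fun h => v h g x))
  (v2 : forall h x, scalar (fun g => v h g x)) (v3 : forall h g, scalar (fun x => v h g x)).
Hypothesis wv : forall h g x : H, \sw_(h1, h2 <- h) \sw_(g1, g2 <- g) \sw_(x1, x2 <- x)
  (w h1 g1 x1 * v h2 g2 x2) = eps h * eps g * eps x.

Let wc1 (U : lmodType k) (f : U -> H) g x : linear f -> scalar (fun u => w (f u) g x).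
Proof. exact: (@linear_comp _ U H k^o _ _ (w1 g x)). Qed.
Let wc2 (U : lmodType k) (f : U -> H) h x : linear f -> scalar (fun u => w h (f u) x).
Proof. exact: (@linear_comp _ U H k^o _ _ (w2 h x)). Qed.
Let wc3 (U : lmodType k) (f : U -> H) h g : linear f -> scalar (fun u => w h g (f u)).
Proof. exact: (@linear_comp _ U H k^o _ _ (w3 h g)). Qed.
Let vc1 (U : lmodType k) (f : U -> H) g x : linear f -> scalar (fun u => v (f u) g x).
Proof. exact: (@linear_comp _ U H k^o _ _ (v1 g x)). Qed.
Let vc2 (U : lmodType k) (f : U -> H) h x : linear f -> scalar (fun u => v h (f u) x).
Proof. exact: (@linear_comp _ U H k^o _ _ (v2 h x)). Qed.
Let vc3 (U : lmodType k) (f : U -> H) h g : linear f -> scalar (fun u => v h g (f u)).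
Proof. exact: (@linear_comp _ U H k^o _ _ (v3 h g)). Qed.

Ltac mlin_head ::= first [exact: w3 | exact: v3 | apply: wc1 | apply: wc2 | apply: wc3
  | apply: vc1 | apply: vc2 | apply: vc3].

Let eps_sw (h : H) : \sw_(h1, h2 <- h) (eps h1 * eps h2) = eps h.
Proof. by rewrite sw_epsl_k; last by mlin. Qed.

Let inv_123 : conv4 (form_123 w1 w2 w3) (form_123 v1 v2 v3) = eps4.
Proof.
apply: form4_ext => h g x y; rewrite /= /conv4_fun /= -wv -eps_sw; sweq.
Qed.

Let inv_234 : conv4 (form_234 w1 w2 w3) (form_234 v1 v2 v3) = eps4.
Proof.
apply: form4_ext => h g x y; rewrite /= /conv4_fun /=.
rewrite -2!mulrA [eps g * _]mulrA -wv -eps_sw; sweq.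
Qed.

Let inv_12_3_4 : conv4 (form_12_3_4 w1 w2 w3) (form_12_3_4 v1 v2 v3) = eps4.
Proof.
by apply: form4_ext => h g x y; rewrite /= /conv4_fun /= -(eps_mul (cqbP H)) -wv; sweq.
Qed.

Let inv_1_23_4 : conv4 (form_1_23_4 w1 w2 w3) (form_1_23_4 v1 v2 v3) = eps4.
Proof.
apply: form4_ext => h g x y; rewrite /= /conv4_fun /=.
by rewrite -(mulrA (eps h)) -[eps g * _](eps_mul (cqbP H)) -wv; sweq.
Qed.

Let inv_1_2_34 : conv4 (form_1_2_34 w1 w2 w3) (form_1_2_34 v1 v2 v3) = eps4.
Proof.
apply: form4_ext => h g x y; rewrite /= /conv4_fun /=.
by rewrite -(mulrA (_ * _)) -[eps x * _](eps_mul (cqbP H)) -wv; sweq.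
Qed.

(** Each pullback is taken along a coalgebra map from four to three tensor factors, hence is
    multiplicative for convolution and preserves inverses. *)
Lemma conv4_inv : [/\ conv4 (form_123 w1 w2 w3) (form_123 v1 v2 v3) = eps4,
  conv4 (form_234 w1 w2 w3) (form_234 v1 v2 v3) = eps4,
  conv4 (form_12_3_4 w1 w2 w3) (form_12_3_4 v1 v2 v3) = eps4,
  conv4 (form_1_23_4 w1 w2 w3) (form_1_23_4 v1 v2 v3) = eps4
  & conv4 (form_1_2_34 w1 w2 w3) (form_1_2_34 v1 v2 v3) = eps4].
Proof. by []. Qed.

End Inverse.

Ltac mlin_head ::= first [exact: form4_1 | exact: form4_2 | exact: form4_3 | exact: form4_4].

Let wL1 := @omegaL1 k H. Let wL2 := @omegaL2 k H. Let wL3 := @omegaL3 k H.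
Let vL1 := @omegaVL1 k H. Let vL2 := @omegaVL2 k H. Let vL3 := @omegaVL3 k H.
Let W1 := form_123 wL1 wL2 wL3. Let V1 := form_123 vL1 vL2 vL3.
Let W2 := form_12_3_4 wL1 wL2 wL3. Let V2 := form_12_3_4 vL1 vL2 vL3.
Let W3 := form_1_23_4 wL1 wL2 wL3. Let V3 := form_1_23_4 vL1 vL2 vL3.
Let W4 := form_1_2_34 wL1 wL2 wL3. Let V4 := form_1_2_34 vL1 vL2 vL3.
Let W5 := form_234 wL1 wL2 wL3. Let V5 := form_234 vL1 vL2 vL3.

(** The counit in the fourth argument absorbs the sum over the parts of [y]. This and the next three
    lemmas bring convolutions back to the shape used in the axioms. *)
Let conv_l (w : H -> H -> H -> k) (w1 : forall g x, scalar (fun h => w h g x))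
   (w2 : forall h x, scalar (fun g => w h g x)) (w3 : forall h g, scalar (fun x => w h g x))
   (f : form4) h g x y : conv4 (form_123 w1 w2 w3) f h g x y =
  \sw_(h1, h2 <- h) \sw_(g1, g2 <- g) \sw_(x1, x2 <- x) (w h1 g1 x1 * f h2 g2 x2 y).
Proof.
apply: eq_sw2 => h1 h2; apply: eq_sw2 => g1 g2; apply: eq_sw2 => x1 x2 /=.
rewrite -[f h2 g2 x2 y](@sw_epsl_k _ _ (fun y => f h2 g2 x2 y)); last by mlin.
by rewrite mulr_sw2; apply: eq_sw2 => y1 y2; rewrite mulrA.
Qed.

Let conv_r (w : H -> H -> H -> k) (w1 : forall g x, scalar (fun h => w h g x))
   (w2 : forall h x, scalar (fun g => w h g x)) (w3 : forall h g, scalar (fun x => w h g x))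
   (f : form4) h g x y : conv4 f (form_123 w1 w2 w3) h g x y =
  \sw_(h1, h2 <- h) \sw_(g1, g2 <- g) \sw_(x1, x2 <- x) (f h1 g1 x1 y * w h2 g2 x2).
Proof.
apply: eq_sw2 => h1 h2; apply: eq_sw2 => g1 g2; apply: eq_sw2 => x1 x2 /=.
rewrite -[f h1 g1 x1 y](@sw_epsr_k _ _ (fun y => f h1 g1 x1 y)); last by mlin.
by rewrite mulr_sw2l; apply: eq_sw2 => y1 y2; ring.
Qed.

Let conv_5r (w : H -> H -> H -> k) (w1 : forall g x, scalar (fun h => w h g x))
   (w2 : forall h x, scalar (fun g => w h g x)) (w3 : forall h g, scalar (fun x => w h g x))
   (f : form4) h g x y : conv4 f (form_234 w1 w2 w3) h g x y =
  \sw_(g1, g2 <- g) \sw_(x1, x2 <- x) \sw_(y1, y2 <- y) (f h g1 x1 y1 * w g2 x2 y2).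
Proof.
rewrite /= /conv4_fun sw2_exchange.
apply: eq_sw2 => g1 g2; rewrite sw2_exchange; apply: eq_sw2 => x1 x2.
rewrite sw2_exchange; apply: eq_sw2 => y1 y2 /=.
rewrite -[f h g1 x1 y1](@sw_epsr_k _ _ (fun h => f h g1 x1 y1)); last by mlin.
by rewrite mulr_sw2l; apply: eq_sw2 => h1 h2; ring.
Qed.

Let conv_5l (w : H -> H -> H -> k) (w1 : forall g x, scalar (fun h => w h g x))
   (w2 : forall h x, scalar (fun g => w h g x)) (w3 : forall h g, scalar (fun x => w h g x))
   (f : form4) h g x y : conv4 (form_234 w1 w2 w3) f h g x y =
  \sw_(g1, g2 <- g) \sw_(x1, x2 <- x) \sw_(y1, y2 <- y) (w g1 x1 y1 * f h g2 x2 y2).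
Proof.
rewrite /= /conv4_fun sw2_exchange.
apply: eq_sw2 => g1 g2; rewrite sw2_exchange; apply: eq_sw2 => x1 x2.
rewrite sw2_exchange; apply: eq_sw2 => y1 y2 /=.
rewrite -[f h g2 x2 y2](@sw_epsl_k _ _ (fun h => f h g2 x2 y2)); last by mlin.
by rewrite mulr_sw2; apply: eq_sw2 => h1 h2; ring.
Qed.

Let cocycle : conv4 W4 W2 = conv4 W5 (conv4 W3 W1).
Proof.
apply: form4_ext => h g x y; rewrite [RHS]conv_5l.
rewrite [LHS](omega_cocycle (cqbP H)).
transitivity (\sw_(g1, g2 <- g) \sw_(x1, x2 <- x) \sw_(y1, y2 <- y)
  (omega g1 x1 y1 * (\sw_(h1, h2 <- h) \sw_(g1, g2 <- g2) \sw_(x1, x2 <- x2)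
   (omega h1 (g1 ⋅ x1) y2 * omega h2 g2 x2)))); first by sweq.
apply: eq_sw2 => g1 g2; apply: eq_sw2 => x1 x2; apply: eq_sw2 => y1 y2; congr (_ * _).
by rewrite conv_r.
Qed.

(** This is W1 V2 = V3 V5 W4: multiply W4 W2 = W5 W3 W1 by V3 V5 on the left and by V2 on the
    right. *)
Lemma omega_cocycle1 (h g x y : H) :
  \sw_(h1, h2 <- h) \sw_(g1, g2 <- g) \sw_(x1, x2 <- x)
    (omega h1 g1 x1 * omegaV (h2 ⋅ g2) x2 y) =
  \sw_(h1, h2 <- h) \sw_(g1, g2, g3 <- g) \sw_(x1, x2, x3 <- x) \sw_(y1, y2, y3 <- y)
    (omegaV h1 (g1 ⋅ x1) y1 * omegaV g2 x2 y2 * omega h2 g3 (x3 ⋅ y3)).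
Proof.
have [_ _ i2 _ _] := conv4_inv wL1 wL2 wL3 vL1 vL2 vL3 (omega_convr (cqbP H)).
have [_ i5 _ i3 _] := conv4_inv vL1 vL2 vL3 wL1 wL2 wL3 (omega_convl (cqbP H)).
have E : conv4 W1 V2 = conv4 (conv4 V3 V5) W4.
  have -> : W1 = conv4 (conv4 V3 V5) (conv4 W5 (conv4 W3 W1)).
    by rewrite -conv4A (conv4A V5) i5 conv4_1f conv4A i3 conv4_1f.
  by rewrite -cocycle -!conv4A i2 conv4_f1.
have := congr1 (fun f : form4 => f h g x y) E; rewrite [LHS]conv_l => ->.
transitivity (\sw_(h1, h2 <- h) \sw_(g1, g2 <- g) \sw_(x1, x2 <- x) \sw_(y1, y2 <- y)
  ((\sw_(g1, g2 <- g1) \sw_(x1, x2 <- x1) \sw_(y1, y2 <- y1) (omegaV h1 (g1 ⋅ x1) y1 *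
   omegaV g2 x2 y2)) * omega h2 g2 (x2 ⋅ y2))); last by sweq.
apply: eq_sw2 => h1 h2; apply: eq_sw2 => g1 g2; apply: eq_sw2 => x1 x2; apply: eq_sw2 => y1 y2.
by congr (_ * _); rewrite conv_5r.
Qed.

(** This is W2 V1 = V4 W5 W3: multiply the cocycle equation by V4 on the left and by V1 on the
    right. *)
Lemma omega_cocycle2 (h g x y : H) :
  \sw_(h1, h2 <- h) \sw_(g1, g2 <- g) \sw_(x1, x2 <- x)
    (omega (h1 ⋅ g1) x1 y * omegaV h2 g2 x2) =
  \sw_(h1, h2 <- h) \sw_(g1, g2, g3 <- g) \sw_(x1, x2, x3 <- x) \sw_(y1, y2, y3 <- y)
    (omegaV h1 g1 (x1 ⋅ y1) * omega g2 x2 y2 * omega h2 (g3 ⋅ x3) y3).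
Proof.
have [i1 _ _ _ _] := conv4_inv wL1 wL2 wL3 vL1 vL2 vL3 (omega_convr (cqbP H)).
have [_ _ _ _ i4] := conv4_inv vL1 vL2 vL3 wL1 wL2 wL3 (omega_convl (cqbP H)).
have E : conv4 W2 V1 = conv4 (conv4 V4 W5) W3.
  have -> : W2 = conv4 V4 (conv4 W4 W2) by rewrite conv4A i4 conv4_1f.
  by rewrite cocycle -!conv4A i1 conv4_f1.
have := congr1 (fun f : form4 => f h g x y) E; rewrite [LHS]conv_r => ->.
transitivity (\sw_(h1, h2 <- h) \sw_(g1, g2 <- g) \sw_(x1, x2 <- x) \sw_(y1, y2 <- y)
  ((\sw_(g1, g2 <- g1) \sw_(x1, x2 <- x1) \sw_(y1, y2 <- y1) (omegaV h1 g1 (x1 ⋅ y1) *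
   omega g2 x2 y2)) * omega h2 (g2 ⋅ x2) y2)); last by sweq.
apply: eq_sw2 => h1 h2; apply: eq_sw2 => g1 g2; apply: eq_sw2 => x1 x2; apply: eq_sw2 => y1 y2.
by congr (_ * _); rewrite conv_5r.
Qed.

(** This is V4 W5 = W2 V1 V3: multiply the cocycle equation by V4 on the left and by V1 V3 on the
    right. *)
Lemma omega_cocycle3 (h g x y : H) :
  \sw_(g1, g2 <- g) \sw_(x1, x2 <- x) \sw_(y1, y2 <- y)
    (omegaV h g1 (x1 ⋅ y1) * omega g2 x2 y2) =
  \sw_(h1, h2, h3 <- h) \sw_(g1, g2, g3 <- g) \sw_(x1, x2, x3 <- x) \sw_(y1, y2 <- y)
    (omega (h1 ⋅ g1) x1 y1 * omegaV h2 g2 x2 * omegaV h3 (g3 ⋅ x3) y2).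
Proof.
have [i1 _ _ i3 _] := conv4_inv wL1 wL2 wL3 vL1 vL2 vL3 (omega_convr (cqbP H)).
have [_ _ _ _ i4] := conv4_inv vL1 vL2 vL3 wL1 wL2 wL3 (omega_convl (cqbP H)).
have E : conv4 V4 W5 = conv4 (conv4 W2 V1) V3.
  have <- : conv4 (conv4 W5 (conv4 W3 W1)) (conv4 V1 V3) = W5.
    by rewrite !conv4A -(conv4A _ W1) i1 conv4_f1 -(conv4A W5) i3 conv4_f1.
  by rewrite -cocycle !conv4A i4 conv4_1f.
have := congr1 (fun f : form4 => f h g x y) E; rewrite [LHS]conv_5r => ->.
transitivity (\sw_(h1, h2 <- h) \sw_(g1, g2 <- g) \sw_(x1, x2 <- x) \sw_(y1, y2 <- y)
  ((\sw_(h1, h3 <- h1) \sw_(g1, g3 <- g1) \sw_(x1, x3 <- x1) (omega (h1 ⋅ g1) x1 y1 *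
   omegaV h3 g3 x3)) * omegaV h2 (g2 ⋅ x2) y2)); last by sweq.
apply: eq_sw2 => h1 h2; apply: eq_sw2 => g1 g2; apply: eq_sw2 => x1 x2; apply: eq_sw2 => y1 y2.
by congr (_ * _); rewrite conv_r.
Qed.

End Convolution.

Definition mklin (k : fieldType) (U V : lmodType k) (F : U -> V) (FP : linear F) :
  {linear U -> V} := HB.pack F (GRing.isLinear.Build k U V *:%R F FP).

Definition mkform (k : fieldType) (U : lmodType k) (F : U -> k) (FP : scalar F) :
  {scalar U} := HB.pack F (GRing.isLinear.Build k U k *%R F FP).

(** * Associators with an argument equal to 1, and linear forms of quasi-associativity *)

Section Normalization.
Variables (k : fieldType) (H : coquasi_bialgebra k).
Local Notation one := (hone H).

Lemma omegaV_one (h x : H) : omegaV h one x = eps h * eps x.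
Proof.
have := omega_convr (cqbP H) h one x; rewrite (eps_one (cqbP H)) mulr1 => <-.
transitivity (\sw_(h1, h2 <- h) \sw_(x1, x2 <- x)
  (omega h1 one x1 * omegaV h2 one x2)); last by sweq.
rewrite -[LHS](@sw_epsl_k _ _ (fun h => omegaV h one x)); last by mlin.
apply: eq_sw2 => h1 h2.
rewrite -[in LHS](@sw_epsl_k _ _ (fun x => omegaV h2 one x)); last by mlin.
rewrite mulr_sw2; apply: eq_sw2 => x1 x2.
by rewrite (omega_one (cqbP H)) mulrA.
Qed.

(** Specialize [omega_cocycle1] at x = y = 1. The left side becomes omega(h,g,1); on the right the
    middle factor is trivial by the normalization in the second slot, and the other two cancel as
    mutually inverse forms. *)
Lemma omega_one_r (h g : H) : omega h g one = eps h * eps g.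
Proof.
transitivity (\sw_(h1, h2 <- h) \sw_(g1, g2 <- g) \sw_(x1, x2 <- one)
    (omega h1 g1 x1 * omegaV (h2 ⋅ g2) x2 one)).
  transitivity (\sw_(h1, h2 <- h) \sw_(g1, g2 <- g)
    (omega h1 g1 one * (eps (h2 ⋅ g2) * eps one))); first by sweq.
  apply: eq_sw2 => h1 h2; apply: eq_sw2 => g1 g2.
  by rewrite -omegaV_one sw2_one_k //; mlin.
rewrite omega_cocycle1.
transitivity (\sw_(h1, h2 <- h) \sw_(g1, g2, g3 <- g)
  (omegaV h1 g1 one * omegaV g2 one one * omega h2 g3 one)); first by sweq.
transitivity (\sw_(h1, h2 <- h) \sw_(g1, g2, g3 <- g)
  (omegaV h1 g1 one * (eps g2 * eps one) * omega h2 g3 one)).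
  apply: eq_sw2 => h1 h2; apply: eq_sw2 => g1 g'; apply: eq_sw2 => g2 g3.
  by rewrite omegaV_one.
transitivity (\sw_(h1, h2 <- h) \sw_(g1, g2 <- g) \sw_(x1, x2 <- one)
    (omegaV h1 g1 x1 * omega h2 g2 x2)); first by sweq.
by rewrite (omega_convl (cqbP H)) (eps_one (cqbP H)) mulr1.
Qed.

Lemma omegaV_one_r (h g : H) : omegaV h g one = eps h * eps g.
Proof.
have := omega_convr (cqbP H) h g one; rewrite (eps_one (cqbP H)) mulr1 => <-.
transitivity (\sw_(h1, h2 <- h) \sw_(g1, g2 <- g)
  ((eps h1 * eps g1) * omegaV h2 g2 one)); first by sweq.
transitivity (\sw_(h1, h2 <- h) \sw_(g1, g2 <- g)
  (omega h1 g1 one * omegaV h2 g2 one)); last by sweq.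
by apply: eq_sw2 => h1 h2; apply: eq_sw2 => g1 g2; rewrite omega_one_r.
Qed.

Lemma omegaV_one_l (h g : H) : omegaV one h g = eps h * eps g.
Proof.
have := omega_convr (cqbP H) one h g; rewrite (eps_one (cqbP H)) mul1r => <-.
transitivity (\sw_(h1, h2 <- h) \sw_(g1, g2 <- g)
  ((eps h1 * eps g1) * omegaV one h2 g2)); first by sweq.
transitivity (\sw_(h1, h2 <- h) \sw_(g1, g2 <- g)
  (omega one h1 g1 * omegaV one h2 g2)); last by sweq.
by apply: eq_sw2 => h1 h2; apply: eq_sw2 => g1 g2; rewrite omega_one_l.
Qed.

Lemma linear_sw222 (U V : lmodType k) (F : {linear U -> V}) (h g x : H)
    (c : H -> H -> H -> H -> H -> H -> k) (f : H -> H -> H -> H -> H -> H -> U) :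
  F (\sw_(h1, h2 <- h) \sw_(g1, g2 <- g) \sw_(x1, x2 <- x)
    (c h1 h2 g1 g2 x1 x2 *: f h1 h2 g1 g2 x1 x2)) =
  \sw_(h1, h2 <- h) \sw_(g1, g2 <- g) \sw_(x1, x2 <- x)
    (c h1 h2 g1 g2 x1 x2 *: F (f h1 h2 g1 g2 x1 x2)).
Proof.
rewrite (linear_sw2 _ _ (linearP F)); apply: eq_sw2 => h1 h2.
rewrite (linear_sw2 _ _ (linearP F)); apply: eq_sw2 => g1 g2.
by rewrite (linear_sw2 _ _ (linearP F)); apply: eq_sw2 => x1 x2; rewrite linearZ.
Qed.

Lemma hmulA_lin (V : lmodType k) (F : {linear H -> V}) (h g x : H) :
  \sw_(h1, h2 <- h) \sw_(g1, g2 <- g) \sw_(x1, x2 <- x)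
    (omega h2 g2 x2 *: F (h1 ⋅ (g1 ⋅ x1))) =
  \sw_(h1, h2 <- h) \sw_(g1, g2 <- g) \sw_(x1, x2 <- x)
    (omega h1 g1 x1 *: F ((h2 ⋅ g2) ⋅ x2)).
Proof. by have := congr1 F (hmulA (cqbP H) h g x); rewrite !linear_sw222. Qed.

(** Quasi-associativity conjugated by [omegaV]: insert [omegaV] * [omega] in front, move the
    brackets, and cancel [omega] * [omegaV] behind. *)
Let hmulA_V (h g x : H) : \sw_(h1, h2 <- h) \sw_(g1, g2 <- g) \sw_(x1, x2 <- x)
    (omegaV h2 g2 x2 *: ((h1 ⋅ g1) ⋅ x1)) =
  \sw_(h1, h2 <- h) \sw_(g1, g2 <- g) \sw_(x1, x2 <- x)
    (omegaV h1 g1 x1 *: (h2 ⋅ (g2 ⋅ x2))).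
Proof.
transitivity (\sw_(h1, h2, h3 <- h) \sw_(g1, g2, g3 <- g) \sw_(x1, x2, x3 <- x)
  ((eps h1 * eps g1 * eps x1) *: (omegaV h3 g3 x3 *: ((h2 ⋅ g2) ⋅ x2)))); first by sweq.
transitivity (\sw_(h1, h2 <- h) \sw_(g1, g2 <- g) \sw_(x1, x2 <- x)
  \sw_(h3, h4 <- h2) \sw_(g3, g4 <- g2) \sw_(x3, x4 <- x2)
  ((\sw_(h1, h2 <- h1) \sw_(g1, g2 <- g1) \sw_(x1, x2 <- x1)
      (omegaV h1 g1 x1 * omega h2 g2 x2)) *:
    (omegaV h4 g4 x4 *: ((h3 ⋅ g3) ⋅ x3)))).
  transitivity (\sw_(h1, h2 <- h) \sw_(g1, g2 <- g) \sw_(x1, x2 <- x)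
    \sw_(h3, h4 <- h2) \sw_(g3, g4 <- g2) \sw_(x3, x4 <- x2)
    ((eps h1 * eps g1 * eps x1) *: (omegaV h4 g4 x4 *: ((h3 ⋅ g3) ⋅ x3)))); first by sweq.
  apply: eq_sw2 => h1 h2; apply: eq_sw2 => g1 g2; apply: eq_sw2 => x1 x2.
  by rewrite (omega_convl (cqbP H)).
transitivity (\sw_(h1, h2 <- h) \sw_(g1, g2 <- g) \sw_(x1, x2 <- x)
  \sw_(h3, h4 <- h2) \sw_(g3, g4 <- g2) \sw_(x3, x4 <- x2)
  ((omegaV h1 g1 x1 * omegaV h4 g4 x4) *:
   (\sw_(h3, h5 <- h3) \sw_(g3, g5 <- g3) \sw_(x3, x5 <- x3)
     (omega h3 g3 x3 *: ((h5 ⋅ g5) ⋅ x5))))); first by sweq.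
transitivity (\sw_(h1, h2 <- h) \sw_(g1, g2 <- g) \sw_(x1, x2 <- x)
  \sw_(h3, h4 <- h2) \sw_(g3, g4 <- g2) \sw_(x3, x4 <- x2)
  ((\sw_(h5, h6 <- h4) \sw_(g5, g6 <- g4) \sw_(x5, x6 <- x4)
     (omega h5 g5 x5 * omegaV h6 g6 x6)) *:
   (omegaV h1 g1 x1 *: (h3 ⋅ (g3 ⋅ x3))))).
  transitivity (\sw_(h1, h2 <- h) \sw_(g1, g2 <- g) \sw_(x1, x2 <- x)
    \sw_(h3, h4 <- h2) \sw_(g3, g4 <- g2) \sw_(x3, x4 <- x2)
    ((omegaV h1 g1 x1 * omegaV h4 g4 x4) *:
     (\sw_(h3, h5 <- h3) \sw_(g3, g5 <- g3) \sw_(x3, x5 <- x3)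
       (omega h5 g5 x5 *: (h3 ⋅ (g3 ⋅ x3)))))); last by sweq.
  apply: eq_sw2 => h1 h2; apply: eq_sw2 => g1 g2; apply: eq_sw2 => x1 x2.
  apply: eq_sw2 => h3 h4; apply: eq_sw2 => g3 g4; apply: eq_sw2 => x3 x4.
  by rewrite (hmulA (cqbP H)).
transitivity (\sw_(h1, h2 <- h) \sw_(g1, g2 <- g) \sw_(x1, x2 <- x)
  \sw_(h3, h4 <- h2) \sw_(g3, g4 <- g2) \sw_(x3, x4 <- x2)
  ((eps h4 * eps g4 * eps x4) *: (omegaV h1 g1 x1 *: (h3 ⋅ (g3 ⋅ x3))))); last by sweq.
apply: eq_sw2 => h1 h2; apply: eq_sw2 => g1 g2; apply: eq_sw2 => x1 x2.
apply: eq_sw2 => h3 h4; apply: eq_sw2 => g3 g4; apply: eq_sw2 => x3 x4.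
by rewrite (omega_convr (cqbP H)).
Qed.

Lemma hmulA_lin_V (V : lmodType k) (F : {linear H -> V}) (h g x : H) :
  \sw_(h1, h2 <- h) \sw_(g1, g2 <- g) \sw_(x1, x2 <- x)
    (omegaV h2 g2 x2 *: F ((h1 ⋅ g1) ⋅ x1)) =
  \sw_(h1, h2 <- h) \sw_(g1, g2 <- g) \sw_(x1, x2 <- x)
    (omegaV h1 g1 x1 *: F (h2 ⋅ (g2 ⋅ x2))).
Proof. by have := congr1 F (hmulA_V h g x); rewrite !linear_sw222. Qed.

End Normalization.

(** * Cancellation of antipode pairs and the associators it costs *)

Section Folding.
Variables (k : fieldType) (H : coquasi_hopf k).
Local Notation one := (hone H).
Local Notation S := (antipode H).
Local Notation alpha := (alpha H).
Local Notation beta := (beta H).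

Lemma sw_beta (V : lmodType k) (F : {linear H -> V}) (h : H) :
  \sw_(h1, h2, h3 <- h) (beta h2 *: F (h1 ⋅ S h3)) = beta h *: F one.
Proof.
rewrite -linearZ -(antipode_beta (cqhP H)) [in RHS]/sw3 (linear_sw2 _ _ (linearP F)).
apply: eq_sw2 => h1 h'; rewrite (linear_sw2 _ _ (linearP F)).
by apply: eq_sw2 => h2 h3; rewrite linearZ.
Qed.

Lemma sw_beta_k (F : {scalar H}) (h : H) :
  \sw_(h1, h2, h3 <- h) (beta h2 * F (h1 ⋅ S h3)) = beta h * F one.
Proof. exact: (sw_beta (V := k^o) F). Qed.

Lemma sw_alpha (V : lmodType k) (F : {linear H -> V}) (h : H) :
  \sw_(h1, h2, h3 <- h) (alpha h2 *: F (S h1 ⋅ h3)) = alpha h *: F one.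
Proof.
rewrite -linearZ -(antipode_alpha (cqhP H)) [in RHS]/sw3 (linear_sw2 _ _ (linearP F)).
apply: eq_sw2 => h1 h'; rewrite (linear_sw2 _ _ (linearP F)).
by apply: eq_sw2 => h2 h3; rewrite linearZ.
Qed.

Lemma sw_alpha_k (F : {scalar H}) (h : H) :
  \sw_(h1, h2, h3 <- h) (alpha h2 * F (S h1 ⋅ h3)) = alpha h * F one.
Proof. exact: (sw_alpha (V := k^o) F). Qed.

(* The associators met when cancelling (m a_1) S(a_2), (m S(h_1)) h_2, S(g_1) (g_2 n) and
   g_1 (S(g_2) a); over a Hopf algebra all four are trivial. *)
Definition pR (m a : H) : k :=
  \sw_(a1, a2, a3 <- a) (beta a2 * omegaV m a1 (S a3)).
Definition qR (m h : H) : k :=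
  \sw_(h1, h2, h3 <- h) (alpha h2 * omega m (S h1) h3).
Definition pL (g n : H) : k :=
  \sw_(g1, g2, g3 <- g) (alpha g2 * omegaV (S g1) g3 n).
Definition qL (g a : H) : k :=
  \sw_(g1, g2, g3 <- g) (beta g2 * omega g1 (S g3) a).

(** Moving brackets turns (m a) S(a) into m (a S(a)) at the price of [omegaV]. The inner pair around
    [beta] then collapses to 1, and [omegaV] on the outer legs is what [pR] records. *)
Lemma pR_shift (V : lmodType k) (F : {linear H -> V}) (m a : H) :
  \sw_(m1, m2 <- m) \sw_(a1, a2, a3 <- a) (pR m2 a2 *: F ((m1 ⋅ a1) ⋅ S a3)) =
  \sw_(m1, m2 <- m) (pR m1 a *: F m2).
Proof.
transitivity (\sw_(a1, a2, a3 <- a) (beta a2 *: (\sw_(m1, m2 <- m)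
  \sw_(x1, x2 <- a1) \sw_(y1, y2 <- S a3) (omegaV m2 x2 y2 *: F ((m1 ⋅ x1) ⋅ y1))))).
  by rewrite /pR; sweq.
transitivity (\sw_(a1, a2, a3 <- a) (beta a2 *: (\sw_(m1, m2 <- m)
  \sw_(x1, x2 <- a1) \sw_(y1, y2 <- S a3) (omegaV m1 x1 y1 *: F (m2 ⋅ (x2 ⋅ y2)))))).
  by do 2 apply: eq_sw2 => ? ?; rewrite hmulA_lin_V.
transitivity (\sw_(m1, m2 <- m) \sw_(a1, a', a5 <- a) (omegaV m1 a1 (S a5) *:
  (\sw_(a2, a3, a4 <- a') (beta a3 *: F (m2 ⋅ (a2 ⋅ S a4)))))); first by sweq.
transitivity (\sw_(m1, m2 <- m) \sw_(a1, a2, a3 <- a)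
  (omegaV m1 a1 (S a3) *: (beta a2 *: F (m2 ⋅ one)))); last by rewrite /pR; sweq.
apply: eq_sw2 => m1 m2; do 2 apply: eq_sw2 => ? ?.
have P : linear (fun z => F (m2 ⋅ z)) by mlin.
by rewrite (sw_beta (mklin P)).
Qed.

(** Here a pair is created: the unit to the right of [m] is replaced by S(h) h around [alpha], and
    brackets move from m (S(h) h) to (m S(h)) h. *)
Lemma qR_shift (V : lmodType k) (F : {linear H -> V}) (m h : H) :
  \sw_(m1, m2 <- m) (qR m2 h *: F m1) =
  \sw_(m1, m2 <- m) \sw_(h1, h2, h3 <- h) (qR m1 h2 *: F ((m2 ⋅ S h1) ⋅ h3)).
Proof.
transitivity (\sw_(m1, m2 <- m) \sw_(h1, h2, h3 <- h)
  (omega m2 (S h1) h3 *: (alpha h2 *: F (m1 ⋅ one)))); first by rewrite /qR; sweq.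
transitivity (\sw_(m1, m2 <- m) \sw_(h1, h', h5 <- h) (omega m2 (S h1) h5 *:
  (\sw_(h2, h3, h4 <- h') (alpha h3 *: F (m1 ⋅ (S h2 ⋅ h4)))))).
  apply: eq_sw2 => m1 m2; do 2 apply: eq_sw2 => ? ?.
  have P : linear (fun z => F (m1 ⋅ z)) by mlin.
  by rewrite (sw_alpha (mklin P)).
transitivity (\sw_(h1, h2, h3 <- h) (alpha h2 *: (\sw_(m1, m2 <- m)
  \sw_(x1, x2 <- S h1) \sw_(y1, y2 <- h3) (omega m2 x2 y2 *: F (m1 ⋅ (x1 ⋅ y1)))))).
  by sweq.
transitivity (\sw_(h1, h2, h3 <- h) (alpha h2 *: (\sw_(m1, m2 <- m)
  \sw_(x1, x2 <- S h1) \sw_(y1, y2 <- h3) (omega m1 x1 y1 *: F ((m2 ⋅ x2) ⋅ y2))))).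
  by do 2 apply: eq_sw2 => ? ?; rewrite hmulA_lin.
by rewrite /qR; sweq.
Qed.

(** The mirror case: a pair S(g) g around [alpha] is created to the left of [m], and brackets move
    to S(g) (g m). *)
Lemma pL_shift (V : lmodType k) (F : {linear H -> V}) (g m : H) :
  \sw_(m1, m2 <- m) (pL g m2 *: F m1) =
  \sw_(g1, g2, g3 <- g) \sw_(m1, m2 <- m) (pL g2 m1 *: F (S g1 ⋅ (g3 ⋅ m2))).
Proof.
transitivity (\sw_(m1, m2 <- m) \sw_(g1, g2, g3 <- g)
  (omegaV (S g1) g3 m2 *: (alpha g2 *: F (one ⋅ m1)))); first by rewrite /pL; sweq.
transitivity (\sw_(m1, m2 <- m) \sw_(g1, g', g5 <- g) (omegaV (S g1) g5 m2 *:
  (\sw_(g2, g3, g4 <- g') (alpha g3 *: F ((S g2 ⋅ g4) ⋅ m1))))).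
  apply: eq_sw2 => m1 m2; do 2 apply: eq_sw2 => ? ?.
  have P : linear (fun z => F (z ⋅ m1)) by mlin.
  by rewrite (sw_alpha (mklin P)).
transitivity (\sw_(g1, g2, g3 <- g) (alpha g2 *: (\sw_(x1, x2 <- S g1)
  \sw_(y1, y2 <- g3) \sw_(m1, m2 <- m) (omegaV x2 y2 m2 *: F ((x1 ⋅ y1) ⋅ m1))))).
  by sweq.
transitivity (\sw_(g1, g2, g3 <- g) (alpha g2 *: (\sw_(x1, x2 <- S g1)
  \sw_(y1, y2 <- g3) \sw_(m1, m2 <- m) (omegaV x1 y1 m1 *: F (x2 ⋅ (y2 ⋅ m2)))))).
  by do 2 apply: eq_sw2 => ? ?; rewrite hmulA_lin_V.
by rewrite /pL; sweq.
Qed.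

Lemma pR_one_l (a : H) : pR one a = beta a.
Proof.
transitivity (\sw_(a1, a2, a3 <- a) (beta a2 * (eps a1 * eps (S a3)))); last by sweq.
by do 2 apply: eq_sw2 => ? ?; rewrite omegaV_one_l.
Qed.

Lemma pL_one_r (g : H) : pL g one = alpha g.
Proof.
transitivity (\sw_(a1, a2, a3 <- g) (alpha a2 * (eps (S a1) * eps a3))); last by sweq.
by do 2 apply: eq_sw2 => ? ?; rewrite omegaV_one_r.
Qed.

(** After [omega_cocycle1] there are three associators. The [alpha] and [beta] pairs turn one
    argument of the two outer ones into 1, which makes them trivial; the remaining one is the axiom
    [antipode_omegaV]. *)
Lemma qR_pR_right (m h : H) :
  \sw_(m1, m2 <- m) \sw_(h1, h2, h3 <- h) (qR m1 h2 * pR (m2 ⋅ S h1) h3) =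
  eps m * eps h.
Proof.
transitivity (\sw_(h1, h2, h3, h4, h5 <- h) (alpha h2 * beta h4 *
  (\sw_(m1, m2 <- m) \sw_(x1, x2 <- S h1) \sw_(y1, y2 <- h3)
   (omega m1 x1 y1 * omegaV (m2 ⋅ x2) y2 (S h5))))); first by rewrite /qR /pR; sweq.
transitivity (\sw_(h1, h2, h3, h4, h5 <- h) (alpha h2 * beta h4 *
  (\sw_(m1, m2 <- m) \sw_(x1, x2, x3 <- S h1) \sw_(y1, y2, y3 <- h3)
   \sw_(z1, z2, z3 <- S h5)
   (omegaV m1 (x1 ⋅ y1) z1 * omegaV x2 y2 z2 * omega m2 x3 (y3 ⋅ z3))))).
  by do 4 apply: eq_sw2 => ? ?; rewrite omega_cocycle1.
transitivity (\sw_(m1, m2 <- m) \sw_(h1, h2, x, h3, h' <- h) \sw_(y, h4, h5 <- h')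
  ((\sw_(x1, x2, x3 <- x) (alpha x2 * omegaV m1 (S x1 ⋅ x3) (S h5))) *
   (\sw_(y1, y2, y3 <- y) (beta y2 * omega m2 (S h1) (y1 ⋅ S y3))) *
   omegaV (S h2) h3 (S h4))); first by sweq.
transitivity (\sw_(m1, m2 <- m) \sw_(h1, h2, x, h3, h' <- h) \sw_(y, h4, h5 <- h')
  ((alpha x * (eps m1 * eps (S h5))) * (beta y * (eps m2 * eps (S h1))) *
   omegaV (S h2) h3 (S h4))).
  apply: eq_sw2 => m1 m2; do 4 apply: eq_sw2 => ? ?; do 2 apply: eq_sw2 => ? ?.
  have P1 z : scalar (fun x => omegaV m1 x z) by mlin.
  have P2 z : scalar (omega m2 z) by mlin.
  rewrite (sw_alpha_k (mkform (P1 _))) (sw_beta_k (mkform (P2 _))) /=.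
  by rewrite omegaV_one omega_one_r.
by rewrite -(antipode_omegaV (cqhP H) h); sweq.
Qed.

(** Same scheme with [omega_cocycle2]; here the axiom [antipode_omega] remains. *)
Lemma qR_pR_left (m a : H) :
  \sw_(m1, m2 <- m) \sw_(a1, a2, a3 <- a) (qR (m1 ⋅ a1) a3 * pR m2 a2) =
  eps m * eps a.
Proof.
transitivity (\sw_(a1, a2, a3, a4, a5 <- a) (beta a2 * alpha a4 *
  (\sw_(m1, m2 <- m) \sw_(x1, x2 <- a1) \sw_(y1, y2 <- S a3)
   (omega (m1 ⋅ x1) y1 a5 * omegaV m2 x2 y2)))); first by rewrite /qR /pR; sweq.
transitivity (\sw_(a1, a2, a3, a4, a5 <- a) (beta a2 * alpha a4 *
  (\sw_(m1, m2 <- m) \sw_(x1, x2, x3 <- a1) \sw_(y1, y2, y3 <- S a3)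
   \sw_(z1, z2, z3 <- a5)
   (omegaV m1 x1 (y1 ⋅ z1) * omega x2 y2 z2 * omega m2 (x3 ⋅ y3) z3)))).
  by do 4 apply: eq_sw2 => ? ?; rewrite omega_cocycle2.
transitivity (\sw_(m1, m2 <- m) \sw_(a1, a2, x, a3, a' <- a) \sw_(y, a4, a5 <- a')
  ((\sw_(x1, x2, x3 <- x) (beta x2 * omega m2 (x1 ⋅ S x3) a5)) *
   (\sw_(y1, y2, y3 <- y) (alpha y2 * omegaV m1 a1 (S y1 ⋅ y3))) *
   omega a2 (S a3) a4)); first by sweq.
transitivity (\sw_(m1, m2 <- m) \sw_(a1, a2, x, a3, a' <- a) \sw_(y, a4, a5 <- a')
  ((beta x * (eps m2 * eps a5)) * (alpha y * (eps m1 * eps a1)) *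
   omega a2 (S a3) a4)).
  apply: eq_sw2 => m1 m2; do 4 apply: eq_sw2 => ? ?; do 2 apply: eq_sw2 => ? ?.
  have P1 z : scalar (fun x => omega m2 x z) by mlin.
  have P2 z : scalar (omegaV m1 z) by mlin.
  rewrite (sw_beta_k (mkform (P1 _))) (sw_alpha_k (mkform (P2 _))) /=.
  by rewrite omegaV_one_r (omega_one (cqbP H)).
by rewrite -(antipode_omega (cqhP H) a); sweq.
Qed.

(** Of the three associators given by [omega_cocycle1], the last contains a [beta] pair and is
    trivial. The surviving [omegaV] depends on [v] and is the twist [theta] of the canonical map of
    V ⊗ A. *)
Lemma omega_pR (v a b : H) :
  \sw_(v1, v2 <- v) \sw_(a1, a2 <- a) \sw_(b1, b2 <- b)
    (omega v1 a1 b1 * pR (v2 ⋅ a2) b2) =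
  \sw_(a1, a2 <- a) \sw_(b1, b2, b3 <- b) (omegaV v (a1 ⋅ b1) (S b3) * pR a2 b2).
Proof.
transitivity (\sw_(b1, b2, b3 <- b) (beta b2 *
  (\sw_(v1, v2 <- v) \sw_(a1, a2 <- a) \sw_(x1, x2 <- b1)
   (omega v1 a1 x1 * omegaV (v2 ⋅ a2) x2 (S b3))))); first by rewrite /pR; sweq.
transitivity (\sw_(b1, b2, b3 <- b) (beta b2 *
  (\sw_(v1, v2 <- v) \sw_(a1, a2, a3 <- a) \sw_(x1, x2, x3 <- b1)
   \sw_(y1, y2, y3 <- S b3)
   (omegaV v1 (a1 ⋅ x1) y1 * omegaV a2 x2 y2 * omega v2 a3 (x3 ⋅ y3))))).
  by do 2 apply: eq_sw2 => ? ?; rewrite omega_cocycle1.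
transitivity (\sw_(v1, v2 <- v) \sw_(a1, a2, a3 <- a) \sw_(b1, b2, x, b3, b4 <- b)
  (omegaV v1 (a1 ⋅ b1) (S b4) * omegaV a2 b2 (S b3) *
   (\sw_(x1, x2, x3 <- x) (beta x2 * omega v2 a3 (x1 ⋅ S x3))))); first by sweq.
transitivity (\sw_(v1, v2 <- v) \sw_(a1, a2, a3 <- a) \sw_(b1, b2, x, b3, b4 <- b)
  (omegaV v1 (a1 ⋅ b1) (S b4) * omegaV a2 b2 (S b3) *
   (beta x * (eps v2 * eps a3)))); last by rewrite /pR; sweq.
apply: eq_sw2 => v1 v2; apply: eq_sw2 => a1 a'; apply: eq_sw2 => a2 a3.
do 4 apply: eq_sw2 => ? ?; congr (_ * _).
have P : scalar (omega v2 a3) by mlin.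
by rewrite (sw_beta_k (mkform P)) /= omega_one_r.
Qed.

(** Of the three associators given by [omega_cocycle3], the first contains an [alpha] pair and is
    trivial. This absorbs the associator in the action of A on H ⊗ A. *)
Lemma pL_omega (g m a : H) :
  \sw_(g1, g2 <- g) \sw_(m1, m2 <- m) \sw_(a1, a2 <- a)
    (pL g1 (m1 ⋅ a1) * omega g2 m2 a2) =
  \sw_(g1, g2, g3 <- g) \sw_(m1, m2 <- m) (pL g2 m1 * omegaV (S g1) (g3 ⋅ m2) a).
Proof.
transitivity (\sw_(g1, g2, g3 <- g) (alpha g2 *
  (\sw_(y1, y2 <- g3) \sw_(m1, m2 <- m) \sw_(a1, a2 <- a)
   (omegaV (S g1) y1 (m1 ⋅ a1) * omega y2 m2 a2)))); first by rewrite /pL; sweq.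
transitivity (\sw_(g1, g2, g3 <- g) (alpha g2 *
  (\sw_(x1, x2, x3 <- S g1) \sw_(y1, y2, y3 <- g3) \sw_(m1, m2, m3 <- m)
   \sw_(a1, a2 <- a)
   (omega (x1 ⋅ y1) m1 a1 * omegaV x2 y2 m2 * omegaV x3 (y3 ⋅ m3) a2)))).
  by do 2 apply: eq_sw2 => ? ?; rewrite omega_cocycle3.
transitivity (\sw_(g1, g2, x, g3, g4 <- g) \sw_(m1, m2, m3 <- m) \sw_(a1, a2 <- a)
  ((\sw_(x1, x2, x3 <- x) (alpha x2 * omega (S x1 ⋅ x3) m1 a1)) *
   omegaV (S g2) g3 m2 * omegaV (S g1) (g4 ⋅ m3) a2)); first by sweq.
transitivity (\sw_(g1, g2, x, g3, g4 <- g) \sw_(m1, m2, m3 <- m) \sw_(a1, a2 <- a)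
  ((alpha x * (eps m1 * eps a1)) *
   omegaV (S g2) g3 m2 * omegaV (S g1) (g4 ⋅ m3) a2)); last by rewrite /pL; sweq.
do 4 apply: eq_sw2 => ? ?; apply: eq_sw2 => m1 m'; apply: eq_sw2 => ? ?.
apply: eq_sw2 => a1 a2; congr (_ * _ * _).
have P : scalar (fun x => omega x m1 a1) by mlin.
by rewrite (sw_alpha_k (mkform P)) /= omega_one_l.
Qed.

(** This is [antipode_omega] with the three legs around [alpha] grouped into [qR]. The next two
    lemmas group [antipode_omegaV] in two ways. *)
Lemma beta_qR (m : H) : \sw_(m1, m2, m3 <- m) (beta m2 * qR m1 m3) = eps m.
Proof. by rewrite -(antipode_omega (cqhP H)) /qR; sweq. Qed.

Lemma beta_pL (g : H) : \sw_(g1, g2, g3 <- g) (beta g2 * pL g1 (S g3)) = eps g.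
Proof. by rewrite -(antipode_omegaV (cqhP H)) /pL; sweq. Qed.

Lemma alpha_pR (g : H) : \sw_(g1, g2, g3 <- g) (alpha g2 * pR (S g1) g3) = eps g.
Proof. by rewrite -(antipode_omegaV (cqhP H)) /pR; sweq. Qed.

End Folding.

(** * Tensoring a relative Hopf module by a comodule *)

Section TensorMap.
Variables (k : fieldType) (M M' N N' : lmodType k).
Variables (f : {linear M -> M'}) (g : {linear N -> N'}).

Lemma tmap_balanced : balanced (@kact _ M) (@kscale _ N) (fun m n => f m ⊗ g n).
Proof. by apply: kbalanced; mlin. Qed.

Definition tmap : {linear (M ⊗ N)%type -> (M' ⊗ N')%type} := tlin tmap_balanced.

Lemma tmapE m n : tmap (m ⊗ n) = f m ⊗ g n.
Proof. exact: (tlift_pure tmap_balanced). Qed.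

End TensorMap.

Section LeftTensor.
Variables (k : fieldType) (H : coquasi_bialgebra k) (A : comodule_algebra H).
Variable V : comodule H.

Section Comod.
Variable M : comodule H.
Local Notation VM := (V ⊗ M)%type.

Definition ltens_rho_fun (v : V) (m : M) : (VM ⊗ H)%type :=
  \csw_(v0, v1 <- v) \csw_(m0, m1 <- m) (v0 ⊗ m0) ⊗ (v1 ⋅ m1).

Lemma ltens_rho_balanced : balanced (@kact _ V) (@kscale _ M) ltens_rho_fun.
Proof. by apply: kbalanced; rewrite /ltens_rho_fun; mlin. Qed.

Definition ltens_rho : {linear VM -> (VM ⊗ H)%type} := tlin ltens_rho_balanced.

Lemma tlift_ltens_rho (W : lmodType k) (F : VM -> H -> W) (v : V) (m : M) :
  (forall y, linear (F^~ y)) -> (forall x, linear (F x)) ->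
  tlift F (ltens_rho (v ⊗ m)) =
  \csw_(v0, v1 <- v) \csw_(m0, m1 <- m) F (v0 ⊗ m0) (v1 ⋅ m1).
Proof.
move=> F1 F2; have P := kbalanced F1 F2.
have -> : ltens_rho (v ⊗ m) = ltens_rho_fun v m by exact: (tlift_pure ltens_rho_balanced).
rewrite (tlift_tlift _ _ P); apply: eq_tlift => v0 v1.
by rewrite (tlift_tlift _ _ P); apply: eq_tlift => m0 m1; rewrite (tlift_pure P).
Qed.

Lemma ltens_rhoA t :
  \tsum_(m0, m' <- ltens_rho t) \tsum_(m1, m2 <- comul H m') m0 ⊗ (m1 ⊗ m2) =
  \tsum_(m', m2 <- ltens_rho t) \tsum_(m0, m1 <- ltens_rho m') m0 ⊗ (m1 ⊗ m2).
Proof.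
have P x : linear (fun m' : H => \sw_(m1, m2 <- m') x ⊗ (m1 ⊗ m2) : (VM ⊗ (H ⊗ H))%type).
  by mlin.
have P' y : linear (fun m' : VM => \tsum_(m0, m1 <- ltens_rho m') m0 ⊗ (m1 ⊗ (y : H))).
  by apply: tlift_comp; [apply: kbalanced; mlin | exact: linearP].
move: t; apply: tens_ext => [||v m].
- by apply: tlift_comp; [apply: kbalanced => // ?; mlin | exact: linearP].
- by apply: tlift_comp; [apply: kbalanced => // ?; mlin | exact: linearP].
rewrite [LHS]tlift_ltens_rho //; last by mlin.
rewrite [RHS]tlift_ltens_rho //; last by mlin.
transitivity (\csw_(v0, v1 <- v) \csw_(m0, m1 <- m) \csw_(v2, v3 <- v0) \csw_(m2, m3 <- m0)
  (v2 ⊗ m2) ⊗ ((v3 ⋅ m3) ⊗ (v1 ⋅ m1))); first by sweq.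
by apply: eq_csw2 => v0 v1; apply: eq_csw2 => m0 m1; rewrite tlift_ltens_rho //; mlin.
Qed.

Lemma ltens_rho_counit t : \tsum_(m0, m1 <- ltens_rho t) counit H m1 *: m0 = t.
Proof.
move: t; apply: tens_ext => [||v m] //.
  by apply: tlift_comp; [apply: kbalanced; mlin | exact: linearP].
rewrite [LHS]tlift_ltens_rho; [|mlin..].
transitivity (\csw_(v0, v1 <- v) \csw_(m0, m1 <- m) (eps (v1 ⋅ m1) *: (v0 ⊗ m0))).
  by [].
sweq.
Qed.

Definition ltens_comod : comodule H := Comodule ltens_rhoA ltens_rho_counit.

Lemma csw2_ltens (W : lmodType k) (F : ltens_comod -> H -> W) (v : V) (m : M) :
  (forall y, linear (F^~ y)) -> (forall x, linear (F x)) ->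
  csw2 (v ⊗ m : ltens_comod) F =
  \csw_(v0, v1 <- v) \csw_(m0, m1 <- m) F (v0 ⊗ m0) (v1 ⋅ m1).
Proof. exact: tlift_ltens_rho. Qed.

End Comod.

Ltac swpure ::= apply: csw2_ltens; mlin.

Variable M : rel_hopf_module A.
Local Notation VM := (ltens_comod M).

(** H-comodules form a monoidal category with associator given by [omega], in which A is an algebra
    and M a right A-module. This is the module structure of V ⊗ M there, [omega] passing from (v m)
    a to v (m a). *)
Definition ltens_act_fun (a : A) (v : V) (m : M) : VM :=
  \csw_(v0, v1 <- v) \csw_(m0, m1 <- m) \csw_(a0, a1 <- a)
    (omega v1 m1 a1 *: (v0 ⊗ (m0 ◁ a0))).

Lemma ltens_act_balanced a : balanced (@kact _ V) (@kscale _ M) (ltens_act_fun a).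
Proof. by apply: kbalanced; rewrite /ltens_act_fun; mlin. Qed.

Lemma ltens_act_biadd : balanced (@kact _ VM) (@kscale _ A)
  (fun (t : VM) a => tlift (ltens_act_fun a) t).
Proof.
apply: kbalanced => [a|t]; first exact: tlift_is_linear (ltens_act_balanced a).
by apply: tlift_sum_linear => v m; rewrite /ltens_act_fun; mlin.
Qed.

Definition ltens_data : relhopf_data A := RelhopfData (rh_comod := VM) (tlin ltens_act_biadd).

Lemma ltens_ractE (v : V) (m : M) (a : A) : (v ⊗ m : ltens_data) ◁ a =
  \csw_(v0, v1 <- v) \csw_(m0, m1 <- m) \csw_(a0, a1 <- a)
    (omega v1 m1 a1 *: (v0 ⊗ (m0 ◁ a0))).
Proof.
by rewrite /ract /= tlift_pure; [apply: tlift_pure (ltens_act_balanced a) _ _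
  | exact: ltens_act_biadd].
Qed.

(** Colinearity of the action is quasi-associativity of H, the unit law is triviality of [omega]
    with 1 on the right, and associativity is the cocycle condition. *)
Lemma ltens_axioms : relhopf_axioms ltens_data.
Proof.
split.
- move=> t a; move: t; apply: tens_ext => [||v m].
  + by mlin.
  + by mlin.
  rewrite ltens_ractE.
  transitivity (\csw_(v0, v1 <- v) \csw_(m0, m1 <- m) \csw_(a0, a1 <- a)
    \sw_(v1, v2 <- v1) \sw_(m1, m2 <- m1) \sw_(a1, a2 <- a1)
    (omega v2 m2 a2 *: (((v0 ⊗ (m0 ◁ a0)) : ltens_data) ⊗ (v1 ⋅ (m1 ⋅ a1))))).
    transitivity (\csw_(v0, v1 <- v) \csw_(m0, m1 <- m) \csw_(a0, a1 <- a)
      (omega v1 m1 a1 *: (\csw_(x, y <- (v0 ⊗ (m0 ◁ a0) : ltens_data)) x ⊗ y))).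
      rewrite (linear_csw2 _ _ (linearP (rho ltens_data))); apply: eq_csw2 => v0 v1.
      rewrite (linear_csw2 _ _ (linearP (rho ltens_data))); apply: eq_csw2 => m0 m1.
      rewrite (linear_csw2 _ _ (linearP (rho ltens_data))); apply: eq_csw2 => a0 a1.
      by rewrite linearZ; congr (_ *: _); apply: esym (tliftE (@idfun _) _).
    by sweq.
  rewrite csw2_ltens; [|mlin..].
  transitivity (\csw_(v0, v1 <- v) \csw_(m0, m1 <- m) \csw_(a0, a1 <- a)
    \sw_(v1, v2 <- v1) \sw_(m1, m2 <- m1) \sw_(a1, a2 <- a1)
    (omega v1 m1 a1 *: (((v0 ⊗ (m0 ◁ a0)) : ltens_data) ⊗ ((v2 ⋅ m2) ⋅ a2)))); last first.
    transitivity (\csw_(v0, v1 <- v) \csw_(m0, m1 <- m) \csw_(a0, a1 <- a)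
      (\csw_(v0, v2 <- v0) \csw_(m0, m2 <- m0) \csw_(a0, a2 <- a0)
        (omega v2 m2 a2 *: (v0 ⊗ (m0 ◁ a0) : ltens_data) ⊗ ((v1 ⋅ m1) ⋅ a1)))); first by sweq.
    apply: eq_csw2 => v0 v1; apply: eq_csw2 => m0 m1; apply: eq_csw2 => a0 a1.
    rewrite ltens_ractE.
    have P : linear (fun z : ltens_data => z ⊗ ((v1 ⋅ m1) ⋅ a1)) by mlin.
    rewrite (linear_csw2 _ _ P); apply: eq_csw2 => v2 v3.
    rewrite (linear_csw2 _ _ P); apply: eq_csw2 => m2 m3.
    by rewrite (linear_csw2 _ _ P).
  apply: eq_csw2 => v0 v1; apply: eq_csw2 => m0 m1; apply: eq_csw2 => a0 a1.
  have P : linear (fun z : H => ((v0 ⊗ (m0 ◁ a0)) : ltens_data) ⊗ z) by mlin.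
  exact: (hmulA_lin (mklin P)).
- apply: tens_ext => [||v m]; [by mlin|exact: linC_id|].
  rewrite ltens_ractE.
  transitivity (\csw_(v0, v1 <- v) \csw_(m0, m1 <- m) ((eps v1 * eps m1) *: (v0 ⊗ (m0 ◁ aone A)))).
    apply: eq_csw2 => v0 v1; apply: eq_csw2 => m0 m1.
    by rewrite csw2_aone ?omega_one_r //; mlin.
  by sweq.
- move=> t a b; move: t; apply: tens_ext => [||v m].
  + by mlin.
  + by mlin.
  have Pb : linear (fun t : ltens_data => t ◁ b) by mlin.
  transitivity (\csw_(v0, v1 <- v) \csw_(m0, m1 <- m) \csw_(a0, a1 <- a)
    (omega v1 m1 a1 *: (\csw_(v0, v2 <- v0) \csw_(x, y <- m0 ◁ a0) \csw_(b0, b1 <- b)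
      (omega v2 y b1 *: (v0 ⊗ (x ◁ b0) : ltens_data))))).
    rewrite ltens_ractE (linear_csw2 _ _ Pb); apply: eq_csw2 => v0 v1.
    rewrite (linear_csw2 _ _ Pb); apply: eq_csw2 => m0 m1.
    rewrite (linear_csw2 _ _ Pb); apply: eq_csw2 => a0 a1.
    by rewrite -ltens_ractE; apply: (linearZ_LR (mklin Pb)).
  transitivity (\csw_(v0, v1 <- v) \csw_(m0, m1 <- m) \csw_(a0, a1 <- a) \csw_(b0, b1 <- b)
    ((\sw_(v1, v2 <- v1) \sw_(m1, m2 <- m1) \sw_(a1, a2 <- a1)
      (omega v1 (m1 ⋅ a1) b1 * omega v2 m2 a2)) *:
      (v0 ⊗ ((m0 ◁ a0) ◁ b0) : ltens_data))); first by sweq.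
  transitivity (\csw_(v0, v1 <- v) \csw_(m0, m1 <- m) \csw_(a0, a1 <- a) \csw_(b0, b1 <- b)
    ((\sw_(v1, v2 <- v1) \sw_(m1, m2 <- m1) \sw_(a1, a2 <- a1)
      (omega v1 (m1 ⋅ a1) b1 * omega v2 m2 a2)) *:
      (\csw_(m0, m3 <- m0) \csw_(a0, a3 <- a0) \csw_(b0, b3 <- b0)
        (omega m3 a3 b3 *: (v0 ⊗ (m0 ◁ (a0 ⊙ b0)) : ltens_data))))).
    apply: eq_csw2 => v0 v1; apply: eq_csw2 => m0 m1; apply: eq_csw2 => a0 a1.
    apply: eq_csw2 => b0 b1; congr (_ *: _); rewrite (ractA (rhP M)).
    have P : linear (fun z : M => v0 ⊗ z : ltens_data) by mlin.
    rewrite (linear_csw2 _ _ P); apply: eq_csw2 => m2 m3.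
    rewrite (linear_csw2 _ _ P); apply: eq_csw2 => a2 a3.
    rewrite (linear_csw2 _ _ P); apply: eq_csw2 => b2 b3.
    exact: (linearZ_LR (mklin P)).
  transitivity (\csw_(v0, v1 <- v) \csw_(m0, m1 <- m) \csw_(a0, a1 <- a) \csw_(b0, b1 <- b)
    ((\sw_(v1, v2 <- v1) \sw_(m1, m2, m3 <- m1) \sw_(a1, a2, a3 <- a1) \sw_(b1, b2 <- b1)
      (omega m1 a1 b1 * omega v1 (m2 ⋅ a2) b2 * omega v2 m3 a3)) *:
      (v0 ⊗ (m0 ◁ (a0 ⊙ b0)) : ltens_data))); first by sweq.
  rewrite csw2_ltens; [|mlin..].
  transitivity (\csw_(v0, v1 <- v) \csw_(m0, m1 <- m) \csw_(a0, a1 <- a) \csw_(b0, b1 <- b)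
    (omega (v1 ⋅ m1) a1 b1 *: (\csw_(v0, v1 <- v0) \csw_(m0, m1 <- m0) \csw_(x, y <- a0 ⊙ b0)
      (omega v1 m1 y *: (v0 ⊗ (m0 ◁ x) : ltens_data))))); last first.
    apply: eq_csw2 => v0 v1; apply: eq_csw2 => m0 m1; apply: eq_csw2 => a0 a1.
    by apply: eq_csw2 => b0 b1; rewrite ltens_ractE.
  transitivity (\csw_(v0, v1 <- v) \csw_(m0, m1 <- m) \csw_(a0, a1 <- a) \csw_(b0, b1 <- b)
    ((\sw_(v1, v2 <- v1) \sw_(m1, m2 <- m1) \sw_(a1, a2 <- a1) \sw_(b1, b2 <- b1)
      (omega v1 m1 (a1 ⋅ b1) * omega (v2 ⋅ m2) a2 b2)) *:
      (v0 ⊗ (m0 ◁ (a0 ⊙ b0)) : ltens_data))); last by sweq.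
  apply: eq_csw2 => v0 v1; apply: eq_csw2 => m0 m1; apply: eq_csw2 => a0 a1.
  by apply: eq_csw2 => b0 b1; rewrite (omega_cocycle (cqbP H)).
Qed.

Definition ltens : rel_hopf_module A := RelHopfModule ltens_axioms.

End LeftTensor.

(** * The canonical map of a relative Hopf module *)

Section Restriction.
Variables (k : fieldType) (H : coquasi_bialgebra k) (A : comodule_algebra H).
Variable M : rel_hopf_module A.
Local Notation B := (coinv_alg A).

(** A copy of M that keeps only its additive group, so that it can carry the right B-module
    structure in place of the k-structure. *)
Definition resB : Type := M.
HB.instance Definition _ := GRing.Zmodule.on resB.

Let act (b : B^c) (m : resB) : resB := (m : M) ◁ (val (b : B) : A).

Let actA b c m : act b (act c m) = act (b * c) m.
Proof. exact: ractA_coinv2 (coinvP (c : coinv A)). Qed.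
Let act1 : left_id 1 act.
Proof. exact: ract1 (rhP M). Qed.
Let actDr : right_distributive act +%R.
Proof. by move=> b m n; rewrite /act /ract pureDl linearD. Qed.
Let actDl m : {morph act^~ m : b c / b + c}.
Proof. by move=> b c; rewrite /act /ract /= pureDr linearD. Qed.

HB.instance Definition _ :=
  GRing.Zmodule_isLmodule.Build B^c resB actA act1 actDr actDl.

Lemma resB_scaleE (b : B) (m : resB) :
  (b : B^c) *: m = (m : M) ◁ (val b : A) :> M.
Proof. by []. Qed.

End Restriction.

Section RestrictionMap.
Variables (k : fieldType) (H : coquasi_bialgebra k) (A : comodule_algebra H).
Variables (M N : rel_hopf_module A).
Local Notation B := (coinv_alg A).

Lemma resB_map_linear (f : relhopf_hom M N) : linear (f : resB M -> resB N).
Proof.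
by move=> b m n; rewrite linearD; congr (_ + _); apply: (rh_act f).
Qed.

Definition resB_map (f : relhopf_hom M N) : {linear resB M -> resB N} :=
  HB.pack (f : resB M -> resB N)
    (GRing.isLinear.Build B^c (resB M) (resB N) *:%R
      (f : resB M -> resB N) (resB_map_linear f)).

Lemma coinv_incl_linear : linear (val : coinv_mod M -> resB M).
Proof. by []. Qed.

Definition coinv_incl : {linear coinv_mod M -> resB M} :=
  HB.pack (val : coinv_mod M -> resB M)
    (GRing.isLinear.Build B^c (coinv_mod M) (resB M) *:%R
      (val : coinv_mod M -> resB M) coinv_incl_linear).

End RestrictionMap.

Section Can.
Variables (k : fieldType) (H : coquasi_hopf k) (A : comodule_algebra H).

Ltac mlin_head ::= assumption.

Lemma linC_pR1 (U : lmodType k) (f : U -> H) a : linear f -> scalar (fun u => pR (f u) a).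
Proof. by move=> fP; rewrite /pR; mlin. Qed.

Lemma linC_pR2 (U : lmodType k) (f : U -> H) m : linear f -> scalar (fun u => pR m (f u)).
Proof. by move=> fP; rewrite /pR; mlin. Qed.

Section Module.
Variable M : rel_hopf_module A.

Definition canM_fun (m : resB M) (a : A) : (M ⊗ H)%type :=
  \csw_(m0, m1 <- (m : M)) \csw_(a0, a' <- a) \sw_(a1, a2 <- a')
    (pR m1 a1 *: ((m0 ◁ a0) ⊗ a2)).

(** A coinvariant contributes only the element 1 of H, and [omega] is trivial with 1 in the middle,
    so [b] passes from [m] to [a] without an associator. *)
Lemma canM_balanced : balanced (@ractB _ _ A (resB M)) (@lmulB _ _ A) canM_fun.
Proof.
have F1 a : linear (fun m : M => canM_fun m a) by rewrite /canM_fun /pR; mlin.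
split=> [m m' a|m|m b a].
- by have := F1 a 1 m m'; rewrite !scale1r.
- by rewrite /canM_fun /pR; mlin.
- have bP := coinvP (b : coinv A).
  rewrite /canM_fun /ractB resB_scaleE /lmulB.
  transitivity (\csw_(m0, m1 <- (m : M)) \csw_(a0, a' <- a) \sw_(a1, a2 <- a')
    (pR m1 a1 *: (((m0 ◁ (val b : A)) ◁ a0) ⊗ a2))).
    rewrite csw2_ract; [|by rewrite /pR; mlin..]; apply: eq_csw2 => m0 m1.
    by rewrite (csw2_pure _ _ bP) ?(hmul1r (cqbP H)) // /pR; mlin.
  apply: eq_csw2 => m0 m1; rewrite csw2_amul; [|by rewrite /pR; mlin..].
  rewrite (csw2_pure _ _ bP); [|by rewrite /pR; mlin..].
  apply: eq_csw2 => a0 a'; rewrite (hmul1l (cqbP H)); apply: eq_sw2 => a1 a2.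
  by rewrite ractA_coinv2.
Qed.

Definition canM : {linear indT (resB M) -> (M ⊗ H)%type} := tlin canM_balanced.

Lemma canM_pure (m : M) (a : A) : canM (pureB (m : resB M) a) =
  \csw_(m0, m1 <- m) \csw_(a0, a' <- a) \sw_(a1, a2 <- a')
    (pR m1 a1 *: ((m0 ◁ a0) ⊗ a2)).
Proof. exact: (tlift_pure canM_balanced). Qed.

End Module.

Lemma canM_natural (M N : rel_hopf_module A) (f : relhopf_hom M N) t :
  canM N (ind_lin (resB_map f) t) = tmap f idfun (canM M t).
Proof.
move: t; apply: ind_ext => [||m a]; [by mlin|by mlin|].
rewrite ind_linE !canM_pure.
rewrite /csw2 (rh_colinear f) /csw2.
have P : balanced (@kact _ N) (@kscale _ H) (fun m0 m1 =>
    \tsum_(a0, a' <- rho A a) \sw_(a1, a2 <- a') (pR m1 a1 *: ((m0 ◁ a0) ⊗ a2))).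
  by apply: kbalanced; rewrite /pR; mlin.
have Q := linearP (tmap f (@idfun H)).
rewrite (tlift_tlift _ _ P) [RHS](linear_csw2 _ _ Q); apply: eq_tlift => m0 m1.
rewrite (tlift_pure P) [RHS](linear_csw2 _ _ Q); apply: eq_csw2 => a0 a1.
rewrite [RHS](linear_sw2 _ _ Q); apply: eq_sw2 => a2 a3.
by rewrite linearZ tmapE rh_act.
Qed.

Lemma canM_regular : galois A <-> bijective (canM (regular A)).
Proof.
have E : can A =1 canM (regular A).
  apply: (@ind_ext _ _ _ (resB (regular A))) => [||a b]; [exact: linearP|exact: linearP|].
  rewrite canM_pure; apply: etrans (tlift_pure (can_balanced A) a b) _.
  transitivity (\csw_(a0, a1 <- a) \csw_(b0, b' <- b) \sw_(b1, b2 <- b')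
    (pR a1 b1 *: ((a0 ⊙ b0) ⊗ b2))); last by [].
  by rewrite /can_fun /pR; sweq.
split=> P; [exact: eq_bij P _ E | apply: eq_bij P _ _ => t; exact: esym (E t)].
Qed.

End Can.

(** * Kernels of relative Hopf modules *)

Section Complement.
Variables (k : fieldType) (M : lmodType k) (P : M -> Prop).
Hypotheses (P0 : P 0) (PL : forall c x y, P x -> P y -> P (c *: x + y)).

(* The empty set is admitted as a subspace, for the empty chain in Zorn's lemma. *)
Let sub (Q : M -> Prop) (x : M) := Q x \/ x = 0.
Let good (Q : M -> Prop) :=
  (forall c x y, sub Q x -> sub Q y -> sub Q (c *: x + y)) /\
  (forall x, Q x -> P x -> x = 0).

Let subP (Q : M -> Prop) : good Q -> forall x, sub Q x -> P x -> x = 0.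
Proof. by move=> [_ QP] x [Qx|-> //]; apply: QP. Qed.

(** A maximal subspace meeting P trivially is a complement: an [x] outside P + Q could be adjoined
    to Q. *)
Lemma exists_complement : exists Q : M -> Prop, good Q /\
  forall x, exists p, P p /\ sub Q (x - p).
Proof.
have [F FP Ftot|Q [gQ Qmax]] := @classical_sets.Zorn_bigcup M good.
  split; last by move=> x [X FX Xx]; case: (FP _ FX) => _; apply.
  have subE X x : F X -> sub X x -> sub (classical_sets.bigcup F id) x.
    by move=> FX [Xx|->]; [left; exists X | right].
  move=> c x y [[X FX Xx]|->] [[Y FY Yy]|->].
  - have [XY|YX] := Ftot _ _ FX FY.
      by apply: (subE Y) => //; apply: (FP _ FY).1; left => //; apply: XY.
    by apply: (subE X) => //; apply: (FP _ FX).1; left => //; apply: YX.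
  - by apply: (subE X) => //; apply: (FP _ FX).1; [left | right].
  - by apply: (subE Y) => //; apply: (FP _ FY).1; [right | left].
  - by rewrite scaler0 addr0; right.
exists Q; split=> // x; apply: contrapT => nx.
(* The span of [Q] and [x]. *)
pose Q' z := exists c, sub Q (z - c *: x).
have xQ' : Q' x by exists 1; rewrite scale1r subrr; right.
have nQx : ~ sub Q x by move=> Qx; apply: nx; exists 0; rewrite subr0.
apply: (Qmax Q').
  split=> [z Qz|Q'Q]; first by exists 0; rewrite scale0r subr0; left.
  by apply: nQx; left; apply: Q'Q.
have sQ' z : sub Q' z -> Q' z.
  by case=> // ->; exists 0; rewrite scale0r subr0; right.
split=> [c y z /sQ' [d yd] /sQ' [e ze]|y [c yc] Py].
  left; exists (c * d + e); rewrite scalerDl -scalerA opprD addrACA -scalerBr.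
  exact: gQ.1.
(* If c = 0, then [y] lies in both [P] and [Q]. Otherwise dividing by c exhibits [x] in P + Q, which
   was excluded. *)
have [c0|c0] := eqVneq c 0.
  by apply: (subP gQ) Py; rewrite -[y]subr0 -(scale0r x) -c0.
case: nx; exists (c^-1 *: y); split.
  by rewrite -[_ *: y]addr0; apply: PL.
have -> : x - c^-1 *: y = (- c^-1) *: (y - c *: x) + 0.
  by rewrite addr0 scalerBr scaleNr scalerA mulNr mulVf // scaleNr scale1r opprK addrC.
by apply: gQ.1 => //; right.
Qed.

(** The component of [x] in P is unique because the complement meets P trivially, and uniqueness
    makes the chosen component linear. *)
Lemma exists_projection : exists e : {linear M -> M},
  (forall x, P (e x)) /\ (forall x, P x -> e x = x).
Proof.
have [Q [gQ Qx]] := exists_complement.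
have [e eP] := choice Qx.
have uniq x p : P p -> sub Q (x - p) -> e x = p.
  move=> Pp Qp; have [Pe Qe] := eP x.
  apply/eqP; rewrite -subr_eq0; apply/eqP; apply: (subP gQ).
    have -> : e x - p = -1 *: (x - e x) + (x - p).
      by rewrite scaleN1r opprB addrA subrK.
    exact: gQ.1.
  by rewrite addrC -scaleN1r; apply: PL.
have eL : linear e.
  move=> c x y; apply: uniq; first by apply: PL; case: (eP x); case: (eP y).
  by rewrite opprD addrACA -scalerBr; apply: gQ.1; case: (eP x); case: (eP y).
exists (mklin eL); split=> [x|x Px]; first by case: (eP x).
by apply: uniq; rewrite // subrr; right.
Qed.

End Complement.

(** The third clause is exactness of the tensor product over k at a kernel. It follows from a linear
    decomposition id = r + s phi, which tensoring with N preserves. *)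
Lemma ker_retract (k : fieldType) (M M' : lmodType k) (phi : {linear M -> M'}) :
  exists r : {linear M -> M}, [/\ forall x, phi (r x) = 0,
    forall x, phi x = 0 -> r x = x
    & forall (N : lmodType k) (x : (M ⊗ N)%type),
      tmap phi (@idfun N) x = 0 -> tmap r (@idfun N) x = x].
Proof.
have [r [rK rid]] : exists e : {linear M -> M},
    (forall x, phi (e x) = 0) /\ (forall x, phi x = 0 -> e x = x).
  apply: exists_projection => [|c x y x0 y0]; first exact: linear0.
  by rewrite linearP x0 y0 scaler0 addr0.
have [e [eI eid]] : exists e : {linear M' -> M'},
    (forall y, exists x, phi x = e y) /\ (forall y, (exists x, phi x = y) -> e y = y).
  apply: (@exists_projection _ _ (fun y => exists x, phi x = y)); first by exists 0; apply: linear0.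
  by move=> c _ _ [x <-] [y <-]; exists (c *: x + y); apply: linearP.
have [s sP] := choice eI.
(* The part of x outside the kernel depends only on phi(x), so it is independent of the choices made
   by [s]; this gives linearity of the section in [sL]. *)
have rE x y : phi x = phi y -> x - r x = y - r y.
  move=> xy; have E : x - y = r x - r y.
    by rewrite -linearB rid // linearB xy subrr.
  have Ex : x = r x - r y + y by rewrite -E subrK.
  by rewrite {1}Ex -[r x - r y + y]addrA addrAC subrr add0r addrC.
have sL : linear (fun y => s y - r (s y)).
  move=> c y z.
  rewrite (@rE _ (c *: s y + s z)); last by rewrite linearP !sP linearP.
  by rewrite linearP opprD addrACA scalerBr.
exists r; split=> // N x x0.
suff E : x = tmap r (@idfun N) x + tmap (mklin sL) (@idfun N) (tmap phi (@idfun N) x).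
  by rewrite [RHS]E x0 linear0 addr0.
have P1 : linear (tmap r (@idfun N)) by exact: linearP.
have P2 : linear (fun x => tmap (mklin sL) (@idfun N) (tmap phi (@idfun N) x)) by mlin.
move: {x0} x; apply: tens_ext => [||m n]; first by mlin.
  by move=> c x y; rewrite P1 P2 scalerDr addrACA.
rewrite !tmapE -pureDl; congr (_ ⊗ _) => /=.
rewrite (@rE _ m); first by rewrite addrC subrK.
by rewrite sP eid //; exists m.
Qed.

Lemma linear_tlift (k : fieldType) (R : Type) (M : zmodType) (N : lmodType k)
    (ra : M -> R -> M) (la : R -> {linear N -> N}) (V W : lmodType k)
    (g : {linear V -> W}) (f : M -> N -> V) (t : tens ra la) :
  g (tlift f t) = \tsum_(x, y <- t) g (f x y).
Proof. exact: linear_sum. Qed.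

Lemma tlift_tmap (k : fieldType) (M M' N N' W : lmodType k) (f : {linear M -> M'})
    (g : {linear N -> N'}) (F : M' -> N' -> W) (t : (M ⊗ N)%type) :
  (forall y, linear (F^~ y)) -> (forall x, linear (F x)) ->
  tlift F (tmap f g t) = \tsum_(x, y <- t) F (f x) (g y).
Proof.
move=> F1 F2; have P := kbalanced F1 F2.
have Q : balanced (@kact _ M) (@kscale _ N) (fun x y => F (f x) (g y)).
  apply: kbalanced => ? ? ? ?; rewrite linearP; [exact: F1|exact: F2].
move: t; apply: tens_ext => [||m n].
- by apply: tlift_comp; [exact: P|exact: linearP].
- exact: tlift_is_linear.
by rewrite tmapE !tlift_pure.
Qed.

Lemma csw_rho (k : fieldType) (H : coquasi_bialgebra k) (M : comodule H) (m : M) :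
  \csw_(m0, m1 <- m) m0 ⊗ m1 = rho M m.
Proof. exact: (tliftE (@idfun _)). Qed.

Section Kernel.
Variables (k : fieldType) (H : coquasi_bialgebra k) (A : comodule_algebra H).
Variables (M M' : rel_hopf_module A) (phi : relhopf_hom M M').

Definition rh_ker_pred : {pred M} := fun m => phi m == 0.

Lemma rh_ker_closed : GRing.submod_closed rh_ker_pred.
Proof.
split=> [|c x y]; rewrite !unfold_in ?linear0 // => /eqP x0 /eqP y0.
by rewrite linearP x0 y0 scaler0 addr0.
Qed.

HB.instance Definition _ := GRing.isSubmodClosed.Build k M rh_ker_pred rh_ker_closed.

Record rh_ker_type := RhKer { rh_ker_val : M; rh_ker_valP : rh_ker_val \in rh_ker_pred }.
HB.instance Definition _ := [isSub for rh_ker_val].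
HB.instance Definition _ := [Choice of rh_ker_type by <:].
HB.instance Definition _ := [SubChoice_isSubLmodule of rh_ker_type by <:].

Lemma rh_kerP (x : rh_ker_type) : phi (val x) = 0.
Proof. by apply/eqP; apply: (rh_ker_valP x). Qed.

Lemma rh_ker_incl_linear : linear (val : rh_ker_type -> M).
Proof. by []. Qed.

Local Notation K := rh_ker_type.
Let iota : {linear K -> M} := mklin rh_ker_incl_linear.

Let tmap_phi0 (x : K) : tmap phi (@idfun H) (rho M (iota x)) = 0.
Proof.
have := rh_colinear phi (iota x); rewrite [phi _]rh_kerP linear0 => ->.
rewrite -csw_rho.
rewrite [LHS](linear_csw2 _ _ (linearP (tmap phi (@idfun H)))).
by apply: eq_csw2 => m0 m1; apply: tmapE.
Qed.

Let retract_ex : exists r : {linear M -> K}, (forall x, phi x = 0 -> iota (r x) = x) /\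
  forall t : (M ⊗ H)%type, tmap phi (@idfun H) t = 0 ->
    tmap iota (@idfun H) (tmap r (@idfun H) t) = t.
Proof.
have [r [r0 rid rK]] := ker_retract phi.
have rP x : r x \in rh_ker_pred by rewrite unfold_in; apply/eqP; apply: r0.
have rL : linear (fun x => RhKer (rP x)).
  by move=> c x y; apply: val_inj; apply: linearP.
have rE (N : lmodType k) (t : (M ⊗ N)%type) :
    tmap iota (@idfun N) (tmap (mklin rL) (@idfun N) t) = tmap r (@idfun N) t.
  move: t; apply: tens_ext => [||m n]; [by mlin|exact: linearP|].
  by rewrite !tmapE.
by exists (mklin rL); split=> [x x0|t t0]; [exact: rid | rewrite rE rK].
Qed.

(** Used to corestrict to the kernel: coaction and action of M, computed on the kernel, are followed
    by this retraction. It loses nothing there, since the coaction of a kernel element lies in the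
    kernel of phi ⊗ H. *)
Definition rh_ker_retract : {linear M -> K} := sval (cid retract_ex).
Local Notation r := rh_ker_retract.

Let rK x : phi x = 0 -> iota (r x) = x.
Proof. by move: x; case: (svalP (cid retract_ex)). Qed.

Let riota x : r (iota x) = x.
Proof. by apply: val_inj; apply: rK; apply: rh_kerP. Qed.

Definition rh_ker_rho : {linear K -> (K ⊗ H)%type} :=
  (tmap r (@idfun H) \o (rho M \o iota))%FUN.

Lemma tmap_rh_ker_rho (x : K) : tmap iota (@idfun H) (rh_ker_rho x) = rho M (val x).
Proof. by case: (svalP (cid retract_ex)) => _; apply; apply: tmap_phi0. Qed.

(** The tensor product K ⊗ N remains a subspace of M ⊗ N, so the axioms of the kernel can be checked
    inside M. *)
Let iota_inj (N : lmodType k) : injective (tmap iota (@idfun N)).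
Proof.
apply: (can_inj (g := tmap r (@idfun N))).
apply: tens_ext => [||m n]; [by mlin|exact: linC_id|].
by rewrite !tmapE riota.
Qed.

Lemma tlift_rh_ker (W : lmodType k) (F : M -> H -> W) (x : K) :
  (forall y, linear (F^~ y)) -> (forall x, linear (F x)) ->
  \tsum_(x0, x1 <- rh_ker_rho x) F (val x0) x1 = \csw_(m0, m1 <- val x) F m0 m1.
Proof.
by move=> F1 F2; rewrite /csw2 -tmap_rh_ker_rho (tlift_tmap iota idfun).
Qed.

Lemma rh_ker_rhoA x :
  \tsum_(m0, m' <- rh_ker_rho x) \tsum_(m1, m2 <- comul H m') m0 ⊗ (m1 ⊗ m2) =
  \tsum_(m', m2 <- rh_ker_rho x) \tsum_(m0, m1 <- rh_ker_rho m') m0 ⊗ (m1 ⊗ m2).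
Proof.
apply: iota_inj; have Q := linearP (tmap iota (@idfun (H ⊗ H)%type)).
transitivity (\tsum_(m0, m' <- rh_ker_rho x)
    \tsum_(m1, m2 <- comul H m') (val m0 : M) ⊗ (m1 ⊗ m2)).
  rewrite linear_tlift; apply: eq_tlift => m0 m'.
  by rewrite linear_tlift; apply: eq_tlift => m1 m2; rewrite tmapE.
transitivity (\tsum_(m', m2 <- rh_ker_rho x)
    \csw_(m0, m1 <- val m') (m0 ⊗ (m1 ⊗ m2))); last first.
  rewrite linear_tlift; apply: eq_tlift => m' m2; rewrite linear_tlift.
  by rewrite -tlift_rh_ker; [apply: eq_tlift => m0 m1; rewrite tmapE|mlin..].
rewrite (tlift_rh_ker (F := fun m0 m' => \tsum_(m1, m2 <- comul H m') m0 ⊗ (m1 ⊗ m2))).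
- rewrite (tlift_rh_ker (F := fun m' m2 => \csw_(m0, m1 <- m') (m0 ⊗ (m1 ⊗ m2)))).
  + exact: rhoA.
  + by mlin.
  + by mlin.
- by mlin.
- by move=> m0; apply: (@sw2_lin _ H); mlin.
Qed.

Lemma rh_ker_counit x : \tsum_(m0, m1 <- rh_ker_rho x) counit H m1 *: m0 = x.
Proof.
apply: val_inj; rewrite -[RHS](rho_counit (val x : M)).
rewrite -[RHS](@tlift_rh_ker _ (fun m0 m1 => counit H m1 *: m0)); [|by mlin..].
exact: (tliftD iota).
Qed.

Definition rh_ker_comod : comodule H := Comodule rh_ker_rhoA rh_ker_counit.

Lemma csw_rh_ker (W : lmodType k) (F : M -> H -> W) (x : rh_ker_comod) :
  (forall y, linear (F^~ y)) -> (forall x, linear (F x)) ->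
  \csw_(x0, x1 <- x) F (val (x0 : K)) x1 = \csw_(m0, m1 <- val (x : K)) F m0 m1.
Proof. exact: tlift_rh_ker. Qed.

Definition rh_ker_act_fun (x : rh_ker_comod) (a : A) : rh_ker_comod :=
  r (iota x ◁ a).

Lemma rh_ker_act_balanced : balanced (@kact _ rh_ker_comod) (@kscale _ A) rh_ker_act_fun.
Proof.
by apply: kbalanced; rewrite /rh_ker_act_fun; mlin.
Qed.

Definition rh_ker_data : relhopf_data A :=
  RelhopfData (rh_comod := rh_ker_comod) (tlin rh_ker_act_balanced).

Lemma val_rh_ker_act (x : rh_ker_data) (a : A) :
  val (x ◁ a : K) = (val (x : K) : M) ◁ a.
Proof.
have -> : x ◁ a = rh_ker_act_fun x a by exact: (tlift_pure rh_ker_act_balanced).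
apply: rK; rewrite rh_act rh_kerP.
have P : linear (fun m : M' => m ◁ a) by mlin.
exact: (linear0 (mklin P)).
Qed.

Lemma rh_ker_axioms : relhopf_axioms rh_ker_data.
Proof.
split.
- move=> x a; apply: (@iota_inj H); rewrite [LHS]tmap_rh_ker_rho val_rh_ker_act.
  rewrite (rho_ract (rhP M)) -(csw_rh_ker (F := fun m0 m1 =>
    \csw_(a0, a1 <- a) (m0 ◁ a0) ⊗ (m1 ⋅ a1))); [|by mlin..].
  rewrite linear_tlift; apply: eq_tlift => m0 m1.
  rewrite linear_tlift; apply: eq_tlift => a0 a1.
  by rewrite tmapE -val_rh_ker_act.
- by move=> x; apply: val_inj; rewrite val_rh_ker_act (ract1 (rhP M)).
- move=> x a b; apply: val_inj; rewrite !val_rh_ker_act (ractA (rhP M)).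
  rewrite -(csw_rh_ker (F := fun m0 m1 => \csw_(a0, a1 <- a) \csw_(b0, b1 <- b)
    (omega m1 a1 b1 *: (m0 ◁ (a0 ⊙ b0))))); [|by mlin..].
  rewrite [RHS](linear_tlift iota); apply: eq_tlift => m0 m1.
  rewrite [RHS](linear_tlift iota); apply: eq_tlift => a0 a1.
  rewrite [RHS](linear_tlift iota); apply: eq_tlift => b0 b1.
  by rewrite linearZ -val_rh_ker_act.
Qed.

Definition rh_ker : rel_hopf_module A := RelHopfModule rh_ker_axioms.

Lemma rh_ker_colinear (x : rh_ker) :
  rho M (iota x) = \csw_(x0, x1 <- x) iota x0 ⊗ x1.
Proof. by rewrite -csw_rho -(csw_rh_ker (F := fun m0 m1 => m0 ⊗ m1)) //; mlin. Qed.

Definition rh_ker_incl : relhopf_hom rh_ker M :=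
  @RelhopfHom _ _ _ rh_ker M iota rh_ker_colinear val_rh_ker_act.

Lemma rh_ker_inclP (x : rh_ker) : phi (rh_ker_incl x) = 0.
Proof. exact: rh_kerP. Qed.

Lemma rh_ker_lift (m : M) : phi m = 0 -> exists x : rh_ker, rh_ker_incl x = m.
Proof. by move=> m0; exists (r m); apply: rK. Qed.

Lemma rh_ker_lift_tens (t : (M ⊗ H)%type) :
  tmap phi (@idfun H) t = 0 -> exists u, t = tmap rh_ker_incl (@idfun H) u.
Proof.
by exists (tmap r (@idfun H) t); case: (svalP (cid retract_ex)) => _ ->.
Qed.

End Kernel.

Lemma tens_ind (k : fieldType) (R : Type) (M : zmodType) (N : lmodType k)
    (ra : M -> R -> M) (la : R -> {linear N -> N}) (P : tens ra la -> Prop) :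
  P 0 -> (forall x y, P x -> P y -> P (x + y)) ->
  (forall m n, P (pure ra la m n)) -> forall t, P t.
Proof. by move=> P0 PD Pp t; rewrite -[t]termsK tsum_ofE; elim/big_ind: _. Qed.

Lemma linear_inverse (R : pzRingType) (U V : lmodType R) (f : {linear U -> V}) :
  bijective f -> exists g : {linear V -> U}, cancel f g /\ cancel g f.
Proof.
move=> [g fg gf].
have gL : linear g by move=> c x y; apply: (can_inj fg); rewrite linearP !gf.
pose G : {linear V -> U} := HB.pack g (GRing.isLinear.Build R V U *:%R g gL).
by exists G.
Qed.

Lemma linear_inj (R : pzRingType) (U V : lmodType R) (f : {linear U -> V}) :
  (forall x, f x = 0 -> x = 0) -> injective f.
Proof.
by move=> f0 x y /eqP; rewrite -subr_eq0 -linearB => /eqP /f0 /eqP; rewrite subr_eq0 => /eqP.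
Qed.

Lemma tmap_idK (k : fieldType) (M N N' : lmodType k) (f : {linear N -> N'})
    (g : {linear N' -> N}) : cancel f g -> cancel (tmap (@idfun M) f) (tmap (@idfun M) g).
Proof.
move=> fg; apply: tens_ext => [||m n]; [by mlin|exact: linC_id|].
by rewrite !tmapE fg.
Qed.

Section LtensCoinv.
Variables (k : fieldType) (H : coquasi_bialgebra k) (A : comodule_algebra H).
Variables (V : comodule H) (M : rel_hopf_module A).

Lemma ltens_ract_coinv (v : V) (m : M) (b : coinv_alg A) :
  (v ⊗ m : ltens V M) ◁ (val b : A) = v ⊗ (m ◁ (val b : A)).
Proof.
have bP := coinvP (b : coinv A).
rewrite ltens_ractE.
transitivity (\csw_(v0, v1 <- v) \csw_(m0, m1 <- m)
    ((eps v1 * eps m1) *: (v0 ⊗ (m0 ◁ (val b : A))))); last by sweq.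
apply: eq_csw2 => v0 v1; apply: eq_csw2 => m0 m1.
by rewrite (csw2_pure _ _ bP) ?omega_one_r //; mlin.
Qed.

End LtensCoinv.

(* The two k-actions on M ⊗_B A agree, because k acts on M through B. *)
Lemma pureB_kscale (k : fieldType) (H : coquasi_bialgebra k) (A : comodule_algebra H)
    (M : rel_hopf_module A) c (m : M) (a : A) :
  pureB ((c *: m) : resB M) a = c *: pureB (m : resB M) a.
Proof.
have eP : c *: aone A \in coinv_pred A.
  by rewrite unfold_in linearZ (rho_aone (caP A)) pureZl.
pose e : coinv_alg A := Coinv eP.
have -> : c *: m = ractB (m : resB M) e.
  rewrite /ractB resB_scaleE /= -[in LHS](ract1 (rhP M) m).
  have P : linear (fun a : A => m ◁ a) by mlin.
  by apply: esym (linearZ_LR (mklin P) _ _).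
rewrite pureB_bal /lmulB /= -[RHS]pureZr; congr (pure _ _ _ _).
rewrite -[in RHS](amul1l (caP A) a).
have P : linear (fun b : A => b ⊙ a) by mlin.
exact: (linearZ_LR (mklin P)).
Qed.

Lemma pureB_linear1 (k : fieldType) (H : coquasi_bialgebra k) (A : comodule_algebra H)
    (M : rel_hopf_module A) (a : A) :
  linear (fun m : M => pureB (m : resB M) a).
Proof. by move=> c m m'; rewrite -pureB_kscale; apply: pureDl. Qed.

Ltac mlin_head ::= first [apply: linC_pR1 | apply: linC_pR2
  | exact: (linC_pR2 _ (@linC_id _ _)) | assumption].

(** * The canonical map of V ⊗ A *)

Section FreeCan.
Variables (k : fieldType) (H : coquasi_hopf k) (A : comodule_algebra H).
Variable V : comodule H.
Local Notation S := (antipode H).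
Local Notation R := (regular A).
Local Notation L := (ltens V R).

Definition theta_pure (v : V) (a : R) (h : H) : (V ⊗ R ⊗ H)%type :=
  \csw_(v0, v1 <- v) \csw_(a0, a1 <- a) \sw_(h1, h2 <- h)
    (omegaV v1 a1 (S h1) *: ((v0 ⊗ a0) ⊗ h2)).

Lemma theta_pure_balanced v : balanced (@kact _ R) (@kscale _ H) (theta_pure v).
Proof. by apply: kbalanced; rewrite /theta_pure; mlin. Qed.

Lemma theta_balanced : balanced (@kact _ V) (@kscale _ (R ⊗ H)%type)
  (fun v x => tlift (theta_pure v) x).
Proof.
apply: kbalanced => [x|v]; last exact: tlift_is_linear (theta_pure_balanced v).
by apply: tlift_sum_linear => a h; rewrite /theta_pure; mlin.
Qed.

Definition theta : {linear (V ⊗ (R ⊗ H))%type -> (V ⊗ R ⊗ H)%type} := tlin theta_balanced.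

Lemma thetaE v a h : theta (v ⊗ (a ⊗ h)) = theta_pure v a h.
Proof.
have -> : theta (v ⊗ (a ⊗ h)) = tlift (theta_pure v) (a ⊗ h).
  exact: (tlift_pure theta_balanced).
exact: (tlift_pure (theta_pure_balanced v)).
Qed.

(** The left inverse is the same formula with [omega] in place of [omegaV]. *)
Lemma theta_inj : injective theta.
Proof.
pose g v a h : (V ⊗ (R ⊗ H))%type := \csw_(v0, v1 <- v) \csw_(a0, a1 <- a) \sw_(h1, h2 <- h)
    (omega v1 a1 (S h1) *: (v0 ⊗ (a0 ⊗ h2))).
have gP h : balanced (@kact _ V) (@kscale _ R) (fun v a => g v a h).
  by apply: kbalanced; rewrite /g; mlin.
have GP : balanced (@kact _ (V ⊗ R)%type) (@kscale _ H) (fun x h => tlift (fun v a => g v a h) x).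
  apply: kbalanced => [h|x]; first exact: tlift_is_linear (gP h).
  by apply: tlift_sum_linear => v a; rewrite /g; mlin.
apply: (can_inj (g := tlin GP)).
have GE v a h : tlin GP ((v ⊗ a) ⊗ h) = g v a h.
  by rewrite /= (tlift_pure GP) (tlift_pure (gP h)).
have E v a h : tlin GP (theta_pure v a h) = v ⊗ (a ⊗ h).
  rewrite /theta_pure (linear_csw2 _ _ (linearP (tlin GP))).
  transitivity (\csw_(v0, v1 <- v) \csw_(a0, a1 <- a) \sw_(h1, h2 <- h)
    (omegaV v1 a1 (S h1) *: g v0 a0 h2)).
    apply: eq_csw2 => v0 v1; rewrite (linear_csw2 _ _ (linearP (tlin GP))).
    apply: eq_csw2 => a0 a1; rewrite (linear_sw2 _ _ (linearP (tlin GP))).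
    by apply: eq_sw2 => h1 h2; rewrite linearZ GE.
  transitivity (\csw_(v0, v1 <- v) \csw_(a0, a1 <- a) \sw_(h1, h2 <- h)
    ((\sw_(v1, v2 <- v1) \sw_(a1, a2 <- a1) \sw_(y1, y2 <- S h1)
       (omega v1 a1 y1 * omegaV v2 a2 y2)) *: (v0 ⊗ (a0 ⊗ h2)))).
    by rewrite /g; sweq.
  transitivity (\csw_(v0, v1 <- v) \csw_(a0, a1 <- a) \sw_(h1, h2 <- h)
    ((eps v1 * eps a1 * eps (S h1)) *: (v0 ⊗ (a0 ⊗ h2)))); last by sweq.
  apply: eq_csw2 => v0 v1; apply: eq_csw2 => a0 a1; apply: eq_sw2 => h1 h2.
  by rewrite (omega_convr (cqbP H)).
have F v : linear (fun t => tlin GP (theta (v ⊗ t))) by mlin.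
have F' v : (fun t => tlin GP (theta (v ⊗ t))) =1 (fun t => v ⊗ t).
  apply: tens_ext => [||a h]; [exact: F|by mlin|].
  by rewrite thetaE E.
by apply: tens_ext => [||v t]; [by mlin|exact: linC_id|exact: F'].
Qed.

(** The action on V ⊗ A produces omega(v,a,b) and the diagonal coaction produces pR(v a, b). By
    [omega_pR] their product is the form pR(a,b) of the regular module times the twist defining
    [theta]. *)
Lemma can_ltens (v : V) (a b : A) :
  canM L (pureB ((v ⊗ (a : R)) : resB L) b) =
  theta (v ⊗ canM R (pureB (a : resB R) b)).
Proof.
rewrite !canM_pure csw2_ltens; [|by mlin..].
transitivity (\csw_(v0, v1 <- v) \csw_(a0, a1 <- (a : R)) \csw_(b0, b' <- b) \sw_(b1, b2 <- b')
  (pR (v1 ⋅ a1) b1 *: \csw_(v0, v2 <- v0) \csw_(a0, a2 <- a0) \csw_(b0, b3 <- b0)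
    (omega v2 a2 b3 *: ((v0 ⊗ (a0 ◁ b0)) ⊗ b2 : (L ⊗ H)%type)))).
  apply: eq_csw2 => v0 v1; apply: eq_csw2 => a0 a1; apply: eq_csw2 => b0 b'.
  apply: eq_sw2 => b1 b2; congr (_ *: _); rewrite ltens_ractE.
  have P : linear (fun z : L => z ⊗ b2) by mlin.
  rewrite (linear_csw2 _ _ P); apply: eq_csw2 => v2 v3.
  rewrite (linear_csw2 _ _ P); apply: eq_csw2 => a2 a3.
  rewrite (linear_csw2 _ _ P); apply: eq_csw2 => b3 b4.
  exact: (linearZ_LR (mklin P)).
transitivity (\csw_(v0, v1 <- v) \csw_(a0, a1 <- (a : R)) \csw_(b0, b' <- b) \sw_(b1, b2 <- b')
  ((\sw_(v1, v2 <- v1) \sw_(a1, a2 <- a1) \sw_(b1, b3 <- b1)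
     (omega v1 a1 b1 * pR (v2 ⋅ a2) b3)) *: ((v0 ⊗ (a0 ◁ b0)) ⊗ b2 : (L ⊗ H)%type))).
  by sweq.
transitivity (\csw_(v0, v1 <- v) \csw_(a0, a1 <- (a : R)) \csw_(b0, b' <- b) \sw_(b1, b2 <- b')
  ((\sw_(a1, a2 <- a1) \sw_(b1, b3, b4 <- b1)
     (omegaV v1 (a1 ⋅ b1) (S b4) * pR a2 b3)) *: ((v0 ⊗ (a0 ◁ b0)) ⊗ b2 : (L ⊗ H)%type))).
  apply: eq_csw2 => v0 v1; apply: eq_csw2 => a0 a1; apply: eq_csw2 => b0 b'.
  by apply: eq_sw2 => b1 b2; rewrite omega_pR.
have P : linear (fun z => theta (v ⊗ z)) by mlin.
rewrite [RHS](linear_csw2 _ _ P).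
transitivity (\csw_(a0, a1 <- (a : R)) \csw_(b0, b' <- b) \sw_(b1, b2 <- b')
  (pR a1 b1 *: theta_pure v (a0 ◁ b0) b2)).
  by rewrite /theta_pure; sweq.
apply: eq_csw2 => a0 a1; rewrite (linear_csw2 _ _ P); apply: eq_csw2 => b0 b'.
rewrite (linear_sw2 _ _ P); apply: eq_sw2 => b1 b2.
by rewrite -thetaE; apply: esym (linearZ_LR (mklin P) _ _).
Qed.

(** The comparison map from V ⊗ (A ⊗_B A) onto (V ⊗ A) ⊗_B A. Through it the canonical map of V ⊗ A
    becomes [theta] after V ⊗ can; being onto, it transfers injectivity. *)
Let iota_fun (v : V) (a : resB R) (b : A) : indT (resB L) := pureB ((v ⊗ (a : R)) : resB L) b.

Let iota_fun_balanced v : balanced (@ractB _ _ A (resB R)) (@lmulB _ _ A) (iota_fun v).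
Proof.
rewrite /iota_fun; split=> [a a' b|a|a c b].
- by rewrite -[RHS]pureDl -pureDr.
- exact: pureLr.
- by rewrite -pureB_bal /ractB !resB_scaleE ltens_ract_coinv.
Qed.

Let iota_balanced : balanced (@kact _ V) (@kscale _ (indT (resB R)))
  (fun v t => tlift (iota_fun v) t).
Proof.
apply: kbalanced => [t|v]; last exact: tlift_is_linear (iota_fun_balanced v).
apply: tlift_sum_linear => a b c v v'; rewrite /iota_fun.
by rewrite -[RHS](pureB_linear1 (M := L)) pureDl pureZl.
Qed.

Let iota : {linear (V ⊗ indT (resB R))%type -> indT (resB L)} := tlin iota_balanced.

Let iotaE v a b : iota (v ⊗ pureB (a : resB R) b) = pureB ((v ⊗ (a : R)) : resB L) b.
Proof.
have -> : iota (v ⊗ pureB (a : resB R) b) = tlift (iota_fun v) (pureB (a : resB R) b).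
  exact: (tlift_pure iota_balanced).
exact: (tlift_pure (iota_fun_balanced v)).
Qed.

Let iota_onto t : exists u, iota u = t.
Proof.
have D t1 t2 : (exists u, iota u = t1) -> (exists u, iota u = t2) ->
    exists u, iota u = t1 + t2.
  by move=> [u <-] [v <-]; exists (u + v); apply: linearD.
have Z : exists u, iota u = 0 by exists 0; apply: linear0.
move: t; apply: tens_ind => // x b.
elim/tens_ind: x => [|x y|v a].
- by rewrite [pure _ _ _ _](linear0 (mklin (pureB_linear1 (M := L) b))).
- by rewrite pureDl; apply: D.
- by exists (v ⊗ pureB (a : resB R) b); apply: iotaE.
Qed.

Let can_iota u : canM L (iota u) = theta (tmap (@idfun V) (canM R) u).
Proof.
have F v : (fun t => canM L (iota (v ⊗ t))) =1 (fun t => theta (v ⊗ canM R t)).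
  by apply: ind_ext => [||a b]; [by mlin|by mlin|rewrite iotaE can_ltens].
by move: u; apply: tens_ext => [||v t]; [by mlin|by mlin|rewrite tmapE F].
Qed.

Lemma canM_ltens_inj : galois A -> injective (canM L).
Proof.
move=> /canM_regular /linear_inverse [g [gK _]]; apply: linear_inj => t.
have [u <-] := iota_onto t; rewrite can_iota => u0.
have {u0} u0 : tmap (@idfun V) (canM R) u = tmap (@idfun V) (canM R) 0.
  by apply: theta_inj; rewrite u0 !linear0.
by rewrite (can_inj (tmap_idK (M := V) gK) u0) linear0.
Qed.

End FreeCan.

Section ActionMap.
Variables (k : fieldType) (H : coquasi_hopf k) (A : comodule_algebra H).
Variable M : rel_hopf_module A.
Local Notation R := (regular A).
Local Notation L := (ltens M R).

Lemma act_map_balanced : balanced (@kact _ M) (@kscale _ R) (fun m a => m ◁ (a : A)).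
Proof. by apply: kbalanced; mlin. Qed.

Let f : {linear L -> M} := tlin act_map_balanced.

Let fE (m : M) (a : A) : f (m ⊗ (a : R)) = m ◁ a.
Proof. exact: (tlift_pure act_map_balanced). Qed.

Let f_colinear t : rho M (f t) = \csw_(t0, t1 <- t) f t0 ⊗ t1.
Proof.
move: t; apply: tens_ext => [||m a]; [by mlin|by mlin|].
rewrite csw2_ltens; [|by mlin..].
rewrite fE (rho_ract (rhP M)); apply: eq_csw2 => m0 m1; apply: eq_csw2 => a0 a1.
by rewrite fE.
Qed.

Let f_act t (b : A) : f (t ◁ b) = f t ◁ b.
Proof.
move: t; apply: tens_ext => [||m a]; [by mlin|by mlin|].
rewrite ltens_ractE fE (ractA (rhP M)) (linear_csw2 _ _ (linearP f)).
apply: eq_csw2 => m0 m1; rewrite (linear_csw2 _ _ (linearP f)).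
apply: eq_csw2 => a0 a1; rewrite (linear_csw2 _ _ (linearP f)).
by apply: eq_csw2 => b0 b1; rewrite linearZ fE.
Qed.

Definition act_map : relhopf_hom L M := @RelhopfHom _ _ _ L M f f_colinear f_act.

Lemma act_mapE (m : M) (a : A) : act_map (m ⊗ (a : R)) = m ◁ a.
Proof. exact: fE. Qed.

End ActionMap.

(** * Bijectivity of the canonical map for every relative Hopf module *)

Section CanBijective.
Variables (k : fieldType) (H : coquasi_hopf k) (A : comodule_algebra H).
Local Notation S := (antipode H).
Local Notation R := (regular A).

(* By can_ltens with V = M, followed by the action M ⊗ A -> M, a preimage of 1 ⊗ h yields one of
   m ⊗ h. *)
Lemma canM_onto (M : rel_hopf_module A) :
  (forall h : H, exists t, canM R t = aone A ⊗ h) -> forall x, exists t, canM M t = x.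
Proof.
move=> surj.
have D t1 t2 : (exists u, canM M u = t1) -> (exists u, canM M u = t2) ->
    exists u, canM M u = t1 + t2.
  by move=> [u <-] [v <-]; exists (u + v); apply: linearD.
have Z : exists u, canM M u = 0 by exists 0; apply: linear0.
apply: tens_ind => // m h; have [t tP] := surj h.
have D' t1 t2 : (exists u, canM M u = tmap (act_map M) (@idfun H) (theta A M (m ⊗ canM R t1))) ->
   (exists u, canM M u = tmap (act_map M) (@idfun H) (theta A M (m ⊗ canM R t2))) ->
   exists u, canM M u = tmap (act_map M) (@idfun H) (theta A M (m ⊗ canM R (t1 + t2))).
  by rewrite linearD pureDr !linearD; apply: D.
suff E t1 : exists u, canM M u = tmap (act_map M) (@idfun H) (theta A M (m ⊗ canM R t1)).
  have [u uE] := E t; exists u; rewrite uE tP thetaE.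
  rewrite /theta_pure (linear_csw2 _ _ (linearP (tmap _ _))).
  transitivity (\csw_(m0, m1 <- m) \csw_(a0, a1 <- aone A) \sw_(h1, h2 <- h)
    (omegaV m1 a1 (S h1) *: ((m0 ◁ a0) ⊗ h2))).
    apply: eq_csw2 => m0 m1; rewrite (linear_csw2 _ _ (linearP (tmap _ _))).
    apply: eq_csw2 => a0 a1; rewrite (linear_sw2 _ _ (linearP (tmap _ _))).
    by apply: eq_sw2 => h1 h2; rewrite linearZ tmapE act_mapE.
  transitivity (\csw_(m0, m1 <- m) \sw_(h1, h2 <- h)
    ((eps m1 * eps (S h1)) *: ((m0 ◁ aone A) ⊗ h2))); last by sweq.
  apply: eq_csw2 => m0 m1; rewrite csw2_aone; [|by mlin..].
  by apply: eq_sw2 => h1 h2; rewrite omegaV_one.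
move: t1; apply: tens_ind => [||a b].
  by rewrite !linear0 [_ ⊗ 0](linear0 (mklin (pureLr _ _ m))) !linear0.
  exact: D'.
exists (ind_lin (resB_map (act_map M)) (pureB ((m ⊗ (a : R)) : resB (ltens M R)) b)).
by rewrite canM_natural can_ltens.
Qed.

(** Surjectivity for the kernel of M ⊗ A -> M yields injectivity for M. An element killed by [canM]
    lifts to (M ⊗ A) ⊗_B A; the canonical image of the lift lies in kernel ⊗ H, hence comes from the
    kernel tensored with A. Injectivity for M ⊗ A identifies the lift with that element, which
    vanishes in M ⊗_B A. *)
Lemma canM_bij (M : rel_hopf_module A) : galois A -> bijective (canM M).
Proof.
move=> gal.
have onto (N : rel_hopf_module A) : forall x, exists t, canM N t = x.
  apply: canM_onto => h; have [g _ gK] := (canM_regular A).1 gal.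
  by exists (g (aone A ⊗ h)).
have inj : injective (canM M).
  apply: linear_inj => t tP.
  have [t' t'E] : exists t', ind_lin (resB_map (act_map M)) t' = t.
    move: {tP} t; apply: tens_ind => [|x y|m a].
    - by exists 0; apply: linear0.
    - by move=> [u <-] [v <-]; exists (u + v); apply: linearD.
    exists (pureB ((m ⊗ (aone A : R)) : resB (ltens M R)) a).
    by rewrite ind_linE [X in pureB X](act_mapE m (aone A)) (ract1 (rhP M)).
  move: tP; rewrite -{}t'E canM_natural => /rh_ker_lift_tens [y].
  have [u <-] := onto (rh_ker (act_map M)) y.
  rewrite -canM_natural => /(canM_ltens_inj gal) ->.
  move: u; apply: tens_ind => [|x x' E E'|x a]; first by rewrite !linear0.
    by rewrite !linearD E E' addr0.
  rewrite !ind_linE [X in pureB X](rh_ker_inclP x).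
  exact: (linear0 (mklin (pureB_linear1 (M := M) a))).
have [g gE] := choice (onto M).
by exists g => // x; apply: inj; rewrite gE.
Qed.

End CanBijective.

(** * Descent *)

Lemma linC_sub (k : fieldType) (U V : lmodType k) (f g : U -> V) :
  linear f -> linear g -> linear (fun u => f u - g u).
Proof. by move=> fP gP c u v; rewrite fP gP scalerBr opprD addrACA. Qed.

Section Trivial.
Variables (k : fieldType) (H : coquasi_bialgebra k) (W : lmodType k).
Local Notation one := (hone H).

Lemma triv_rho_linear : linear (fun w : W => w ⊗ one).
Proof. by mlin. Qed.

Definition triv_rho : {linear W -> (W ⊗ H)%type} := mklin triv_rho_linear.

Let tlift_triv (V : lmodType k) (F : W -> H -> V) (w : W) :
  (forall y, linear (F^~ y)) -> (forall x, linear (F x)) ->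
  tlift F (triv_rho w) = F w one.
Proof. by move=> F1 F2; apply: tlift_pure; apply: kbalanced. Qed.

Lemma triv_rhoA w :
  \tsum_(m0, m' <- triv_rho w) \tsum_(m1, m2 <- comul H m') m0 ⊗ (m1 ⊗ m2) =
  \tsum_(m', m2 <- triv_rho w) \tsum_(m0, m1 <- triv_rho m') m0 ⊗ (m1 ⊗ m2).
Proof.
have P : linear (fun x : W => x ⊗ (one ⊗ one)) by mlin.
rewrite !tlift_triv; first by rewrite (comul_one (cqbP H)) tlift_pure //; apply: kbalanced; mlin.
all: first [by mlin | by move=> x; apply: (@sw2_lin _ H); mlin
  | by move=> y; apply: tlift_comp; [apply: kbalanced; mlin | exact: linearP]].
Qed.

Lemma triv_counit w : \tsum_(m0, m1 <- triv_rho w) counit H m1 *: m0 = w.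
Proof. by rewrite tlift_triv ?[counit H one](eps_one (cqbP H)) ?scale1r //; mlin. Qed.

Definition triv : comodule H := Comodule triv_rhoA triv_counit.

Lemma csw2_triv (V : lmodType k) (F : triv -> H -> V) (w : W) :
  (forall y, linear (F^~ y)) -> (forall x, linear (F x)) ->
  csw2 (w : triv) F = F w one.
Proof. exact: tlift_triv. Qed.

End Trivial.

Section Trilinear.
Variables (k : fieldType) (U V W Y : lmodType k) (F : U -> V -> W -> Y).
Hypotheses (F1 : forall v w, linear (fun u => F u v w))
  (F2 : forall u w, linear (fun v => F u v w)) (F3 : forall u v, linear (F u v)).

(** Turns a Sweedler formula in three legs into a linear map that can be applied to both sides of an
    equation between arbitrary tensors. The existential form leaves only its values on pure tensors
    visible. *)
Lemma trilinear_lift : exists G : {linear (U ⊗ V ⊗ W)%type -> Y},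
  forall u v w, G ((u ⊗ v) ⊗ w) = F u v w.
Proof.
have P w : balanced (@kact _ U) (@kscale _ V) (fun u v => F u v w) by apply: kbalanced.
have Q : balanced (@kact _ (U ⊗ V)%type) (@kscale _ W)
    (fun x w => tlift (fun u v => F u v w) x).
  apply: kbalanced => [w|x]; first exact: tlift_is_linear (P w).
  by apply: tlift_sum_linear => u v; apply: F3.
exists (tlin Q) => u v w.
by rewrite -[LHS]/(tlift _ _) (tlift_pure Q) (tlift_pure (P w)).
Qed.

End Trilinear.

Section LinearCompQ.
Variables (k : fieldType) (H : coquasi_hopf k) (U : lmodType k) (f : U -> H).
Hypothesis fP : linear f.

Lemma linC_qR1 h : scalar (fun u => qR (f u) h).
Proof. by rewrite /qR; mlin. Qed.
Lemma linC_qR2 m : scalar (fun u => qR m (f u)).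
Proof. by rewrite /qR; mlin. Qed.
Lemma linC_pL1 h : scalar (fun u => pL (f u) h).
Proof. by rewrite /pL; mlin. Qed.
Lemma linC_pL2 m : scalar (fun u => pL m (f u)).
Proof. by rewrite /pL; mlin. Qed.

End LinearCompQ.

Ltac mlin_head ::= first [apply: linC_pR1 | apply: linC_pR2
  | apply: linC_qR1 | apply: linC_qR2 | apply: linC_pL1 | apply: linC_pL2
  | exact: (linC_pR2 _ (@linC_id _ _)) | exact: (linC_qR2 _ (@linC_id _ _))
  | exact: (linC_pL2 _ (@linC_id _ _)) | assumption].

Section Descent.
Variables (k : fieldType) (H : coquasi_hopf k) (A : comodule_algebra H).
Variable M : rel_hopf_module A.
Local Notation S := (antipode H).
Local Notation one := (hone H).
Local Notation B := (coinv_alg A).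
Local Notation T := (triv H H).
Local Notation X := (ltens T M).

Let delta0 (m : M) : X := \csw_(m0, m1 <- m) ((m1 : T) ⊗ m0).
Let delta1 (m : M) : X := (one : T) ⊗ m.

(** Elements of B have trivial coaction, so acting by them leaves the H-leg m_1 unchanged; this is
    why delta is a map over B. *)
Lemma delta_linear : linear (fun m : resB M => (delta0 m - delta1 m : resB X)).
Proof.
have P0 : linear delta0 by rewrite /delta0; mlin.
have P1 : linear delta1 by rewrite /delta1; mlin.
have D0 (x y : M) : delta0 (x + y) = delta0 x + delta0 y.
  by have := P0 1 x y; rewrite !scale1r.
have D1 (x y : M) : delta1 (x + y) = delta1 x + delta1 y.
  by have := P1 1 x y; rewrite !scale1r.
move=> b m n; rewrite D0 D1 opprD addrACA; congr (_ + _).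
have bP := coinvP (b : coinv A).
rewrite [RHS](@resB_scaleE _ _ _ X) resB_scaleE.
have P : linear (fun x : X => x ◁ (val (b : B) : A)) by mlin.
rewrite [RHS](linearB (mklin P)) /=; congr (_ - _).
  rewrite /delta0 (linear_csw2 _ _ P) csw2_ract; [|by mlin..].
  apply: eq_csw2 => m0 m1; rewrite (csw2_pure _ _ bP); [|by mlin..].
  by rewrite (hmul1r (cqbP H)) ltens_ract_coinv.
by rewrite /delta1 ltens_ract_coinv.
Qed.

Definition delta : {linear resB M -> resB X} :=
  HB.pack (fun m : resB M => (delta0 m - delta1 m : resB X))
   (GRing.isLinear.Build B^c (resB M) (resB X) *:%R
     (fun m : resB M => (delta0 m - delta1 m : resB X)) delta_linear).

Lemma deltaE (m : M) : delta m = (\csw_(m0, m1 <- m) ((m1 : T) ⊗ m0)) - (one : T) ⊗ m.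
Proof. by []. Qed.

Lemma delta_eq0 (m : M) : delta m = 0 <-> rho M m = m ⊗ one.
Proof.
have P : balanced (@kact _ T) (@kscale _ M) (fun v m => m ⊗ (v : H)).
  by apply: kbalanced; mlin.
rewrite deltaE; split=> [/eqP|mP].
  rewrite subr_eq0 => /eqP /(congr1 (tlin P)); rewrite (linear_csw2 _ _ (linearP (tlin P))).
  rewrite [RHS](tlift_pure P) => <-; rewrite -csw_rho; apply: eq_csw2 => m0 m1.
  exact: esym (tlift_pure P _ _).
by rewrite (csw2_pure _ _ mP) ?subrr //; mlin.
Qed.

Lemma ltens_triv_ract (v : H) (m : M) (a : A) :
  ((v : T) ⊗ m : X) ◁ a = (v : T) ⊗ (m ◁ a).
Proof.
rewrite ltens_ractE csw2_triv; [|by mlin..].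
transitivity (\csw_(m0, m1 <- m) \csw_(a0, a1 <- a)
    ((eps m1 * eps a1) *: ((v : T) ⊗ (m0 ◁ a0)))); last by sweq.
by apply: eq_csw2 => m0 m1; apply: eq_csw2 => a0 a1; rewrite omega_one_l.
Qed.

Lemma can_triv (v : H) (m : M) (a : A) :
  canM X (pureB (((v : T) ⊗ m) : resB X) a) =
  \csw_(m0, m1 <- m) \csw_(a0, a' <- a) \sw_(a1, a2 <- a')
    (pR m1 a1 *: (((v : T) ⊗ (m0 ◁ a0)) ⊗ a2)).
Proof.
rewrite canM_pure csw2_ltens; [|by mlin..]; rewrite csw2_triv; [|by mlin..].
apply: eq_csw2 => m0 m1; apply: eq_csw2 => a0 a'; apply: eq_sw2 => a1 a2.
by rewrite (hmul1l (cqbP H)) ltens_triv_ract.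
Qed.

(** The transport of m |-> m_1 ⊗ m_0 through [canM]: on the image of m ⊗ a the leg n_1 S(h_1) has
    the form (m_1 a_1) S(a_3), from which [pR_shift] recovers m_1. *)
Let D0_fun (n : M) (h : H) : (T ⊗ M ⊗ H)%type :=
  \csw_(n0, n1 <- n) \sw_(h1, h2 <- h) ((((n1 ⋅ S h1) : T) ⊗ n0) ⊗ h2).
Let D1_fun (n : M) (h : H) : (T ⊗ M ⊗ H)%type := ((one : T) ⊗ n) ⊗ h.

Let D0P : balanced (@kact _ M) (@kscale _ H) D0_fun.
Proof. by apply: kbalanced; rewrite /D0_fun; mlin. Qed.
Let D1P : balanced (@kact _ M) (@kscale _ H) D1_fun.
Proof. by apply: kbalanced; rewrite /D1_fun; mlin. Qed.

Let D0 : {linear (M ⊗ H)%type -> (T ⊗ M ⊗ H)%type} := tlin D0P.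
Let D1 : {linear (M ⊗ H)%type -> (T ⊗ M ⊗ H)%type} := tlin D1P.
Let D0E n h : D0 (n ⊗ h) = D0_fun n h. Proof. exact: (tlift_pure D0P). Qed.
Let D1E n h : D1 (n ⊗ h) = D1_fun n h. Proof. exact: (tlift_pure D1P). Qed.

Let can_delta t : canM X (ind_lin delta t) = D0 (canM M t) - D1 (canM M t).
Proof.
move: t; apply: ind_ext => [||m a].
- by mlin.
- by apply: linC_sub; mlin.
rewrite ind_linE deltaE.
have P : linear (fun x : X => canM X (pureB (x : resB X) a)).
  by apply: linC_map; apply: pureB_linear1.
apply: etrans (linearB (mklin P) _ _) _; congr (_ - _).
  transitivity (\csw_(m0, m1 <- m) canM X (pureB (((m1 : T) ⊗ m0) : resB X) a)).
    exact: (linear_csw2 (U := X) _ _ P).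
  transitivity (\csw_(m0, m' <- m) \csw_(a0, a' <- a) \sw_(a', a4 <- a')
    \sw_(m1, m2 <- m') (pR m1 a' *: (((m2 : T) ⊗ (m0 ◁ a0)) ⊗ a4))).
    transitivity (\csw_(m0, m2 <- m) \csw_(m0, m1 <- m0) \csw_(a0, a' <- a) \sw_(a1, a2 <- a')
      (pR m1 a1 *: (((m2 : T) ⊗ (m0 ◁ a0)) ⊗ a2))); last by sweq.
    by apply: eq_csw2 => m0 m2; rewrite can_triv.
  transitivity (\csw_(m0, m' <- m) \csw_(a0, a' <- a) \sw_(a', a4 <- a')
    \sw_(m1, m2 <- m') \sw_(a1, a2, a3 <- a')
      (pR m2 a2 *: (((((m1 ⋅ a1) ⋅ S a3) : T) ⊗ (m0 ◁ a0)) ⊗ a4))).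
    apply: eq_csw2 => m0 m'; apply: eq_csw2 => a0 a''; apply: eq_sw2 => a' a4.
    have Q : linear (fun z : H => ((z : T) ⊗ (m0 ◁ a0)) ⊗ a4) by mlin.
    exact: esym (pR_shift (mklin Q) _ _).
  rewrite canM_pure (linear_csw2 _ _ (linearP D0)).
  transitivity (\csw_(m0, m1 <- m) \csw_(a0, a' <- a) \sw_(a1, a2 <- a')
    (pR m1 a1 *: D0_fun (m0 ◁ a0) a2)); first by rewrite /D0_fun; sweq.
  apply: eq_csw2 => m0 m1; rewrite (linear_csw2 _ _ (linearP D0)).
  apply: eq_csw2 => a0 a1; rewrite (linear_sw2 _ _ (linearP D0)).
  by apply: eq_sw2 => a2 a3; rewrite linearZ D0E.
rewrite [LHS]can_triv canM_pure (linear_csw2 _ _ (linearP D1)).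
apply: eq_csw2 => m0 m1; rewrite (linear_csw2 _ _ (linearP D1)).
apply: eq_csw2 => a0 a1; rewrite (linear_sw2 _ _ (linearP D1)).
by apply: eq_sw2 => a2 a3; rewrite linearZ D1E.
Qed.

Lemma coaug_linear : linear (fun m : M =>
  \csw_(m0, m' <- m) \sw_(m1, m2 <- m') (beta H m1 *: (m0 ⊗ m2))).
Proof. by mlin. Qed.

Definition coaug : {linear M -> (M ⊗ H)%type} := mklin coaug_linear.

Lemma coaugE (m : M) : coaug m =
  \csw_(m0, m' <- m) \sw_(m1, m2 <- m') (beta H m1 *: (m0 ⊗ m2)).
Proof. by []. Qed.

Let coret_balanced : balanced (@kact _ M) (@kscale _ H)
  (fun m h => \csw_(m0, m1 <- m) (qR m1 h *: m0)).
Proof. by apply: kbalanced; mlin. Qed.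

Let coret : {linear (M ⊗ H)%type -> M} := tlin coret_balanced.

Let coretE m h : coret (m ⊗ h) = \csw_(m0, m1 <- m) (qR m1 h *: m0).
Proof. exact: (tlift_pure coret_balanced). Qed.

(** The coefficients of [coaug] and [coret] combine to [beta_qR]. *)
Let coaugK : cancel coaug coret.
Proof.
move=> m; rewrite coaugE (linear_csw2 _ _ (linearP coret)).
transitivity (\csw_(m0, m1 <- m) ((\sw_(m1, m2, m3 <- m1) (beta H m2 * qR m1 m3)) *: m0)).
  transitivity (\csw_(m0, m' <- m) \sw_(m1, m2 <- m')
    (beta H m1 *: \csw_(m0, m3 <- m0) (qR m3 m2 *: m0))); last by sweq.
  apply: eq_csw2 => m0 m1; rewrite (linear_sw2 _ _ (linearP coret)).
  by apply: eq_sw2 => m2 m3; rewrite linearZ coretE.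
transitivity (\csw_(m0, m1 <- m) (eps m1 *: m0)); last by sweq.
by apply: eq_csw2 => m0 m1; rewrite beta_qR.
Qed.

Lemma coaug_inj : injective coaug. Proof. exact: can_inj coaugK. Qed.

Let D_coaug m : D0 (coaug m) = D1 (coaug m).
Proof.
rewrite coaugE [LHS](linear_csw2 _ _ (linearP D0)) [RHS](linear_csw2 _ _ (linearP D1)).
transitivity (\csw_(m0, m' <- m) \sw_(m', m4 <- m') \sw_(m1, m2, m3 <- m')
    (beta H m2 *: ((((m1 ⋅ S m3) : T) ⊗ m0) ⊗ m4))).
  transitivity (\csw_(m0, m' <- m) \sw_(m1, m2 <- m') (beta H m1 *: D0_fun m0 m2));
    last by rewrite /D0_fun; sweq.
  apply: eq_csw2 => m0 m1; rewrite (linear_sw2 _ _ (linearP D0)).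
  by apply: eq_sw2 => m2 m3; rewrite linearZ D0E.
apply: eq_csw2 => m0 m'; rewrite (linear_sw2 _ _ (linearP D1)).
apply: eq_sw2 => m1 m4; rewrite linearZ D1E.
have Q : linear (fun z : H => ((z : T) ⊗ m0) ⊗ m4) by mlin.
exact: (sw_beta (mklin Q)).
Qed.

(** Two maps G1 and G2 agree on the image of D1 because pR(1,h) = beta(h). The descent equation is
    used twice: coaug(coret x) = G1(D0 x) = G1(D1 x) = G2(D1 x) = G2(D0 x) = x, the first equality
    by [qR_shift] and the last by [qR_pR_right]. *)
Let coret_descent x : D0 x = D1 x -> coaug (coret x) = x.
Proof.
have [G1 G1E] : exists G : {linear (T ⊗ M ⊗ H)%type -> (M ⊗ H)%type},
    forall (z : T) n h, G ((z ⊗ n) ⊗ h) = \csw_(n0, n1 <- n) \sw_(h1, h2 <- h)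
      (qR n1 h1 *: \sw_(z1, z2 <- (z : H) ⋅ h2) (beta H z1 *: (n0 ⊗ z2))).
  by apply: trilinear_lift; mlin.
have [G2 G2E] : exists G : {linear (T ⊗ M ⊗ H)%type -> (M ⊗ H)%type},
    forall (z : T) n h, G ((z ⊗ n) ⊗ h) = \csw_(n0, n1 <- n) \sw_(h1, h2, h3 <- h)
      ((qR n1 h1 * pR (z : H) h2) *: (n0 ⊗ h3)).
  by apply: trilinear_lift; mlin.
have E1 : (fun x => coaug (coret x)) =1 (fun x => G1 (D0 x)).
  apply: tens_ext => [||n h]; [by mlin|by mlin|].
  rewrite D0E coretE (linear_csw2 _ _ (linearP coaug)) [RHS](linear_csw2 _ _ (linearP G1)).
  transitivity (\csw_(n0, n' <- n) \sw_(n1, n2 <- n') (qR n2 h *: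
     \sw_(z1, z2 <- n1) (beta H z1 *: (n0 ⊗ z2)))).
    transitivity (\csw_(n0, n2 <- n) (qR n2 h *:
      \csw_(n0, n1 <- n0) \sw_(z1, z2 <- n1) (beta H z1 *: (n0 ⊗ z2)))); last by sweq.
    by apply: eq_csw2 => n0 n1; rewrite linearZ.
  transitivity (\csw_(n0, n' <- n) \sw_(n1, n2 <- n') \sw_(h1, h2, h3 <- h) (qR n1 h2 *:
     \sw_(z1, z2 <- (n2 ⋅ S h1) ⋅ h3) (beta H z1 *: (n0 ⊗ z2)))).
    apply: eq_csw2 => n0 n'.
    have Q : linear (fun z : H => \sw_(z1, z2 <- z) (beta H z1 *: (n0 ⊗ z2))) by mlin.
    exact: (qR_shift (mklin Q)).
  transitivity (\csw_(n0, n2 <- n) \sw_(h1, h' <- h) \csw_(n0, n1 <- n0) \sw_(h2, h3 <- h')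
     (qR n1 h2 *: \sw_(z1, z2 <- (n2 ⋅ S h1) ⋅ h3) (beta H z1 *: (n0 ⊗ z2)))); first by sweq.
  apply: eq_csw2 => n0 n1; rewrite (linear_sw2 _ _ (linearP G1)).
  by apply: eq_sw2 => h1 h2; rewrite G1E.
have E2 : (fun x => G1 (D1 x)) =1 (fun x => G2 (D1 x)).
  apply: tens_ext => [||n h]; [by mlin|by mlin|].
  rewrite D1E G1E G2E.
  transitivity (\csw_(n0, n1 <- n) \sw_(h1, h2, h3 <- h)
      ((qR n1 h1 * beta H h2) *: (n0 ⊗ h3))); first by sweq.
  apply: eq_csw2 => n0 n1; do 2 apply: eq_sw2 => ? ?.
  by rewrite pR_one_l.
have E3 : (fun x => G2 (D0 x)) =1 id.
  apply: tens_ext => [||n h]; [by mlin|exact: linC_id|].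
  rewrite D0E (linear_csw2 _ _ (linearP G2)).
  transitivity (\csw_(n0, n2 <- n) \sw_(h1, h' <- h) \csw_(n0, n1 <- n0) \sw_(h2, h3, h4 <- h')
     ((qR n1 h2 * pR (n2 ⋅ S h1) h3) *: (n0 ⊗ h4))).
    apply: eq_csw2 => n0 n1; rewrite (linear_sw2 _ _ (linearP G2)).
    by apply: eq_sw2 => h1 h2; rewrite G2E.
  transitivity (\csw_(n0, n1 <- n) \sw_(h1, h4 <- h)
     ((\sw_(n1, n2 <- n1) \sw_(h1, h2, h3 <- h1) (qR n1 h2 * pR (n2 ⋅ S h1) h3)) *: (n0 ⊗ h4))).
    by sweq.
  transitivity (\csw_(n0, n1 <- n) \sw_(h1, h4 <- h) ((eps n1 * eps h1) *: (n0 ⊗ h4))).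
    by apply: eq_csw2 => n0 n1; apply: eq_sw2 => h1 h4; rewrite qR_pR_right.
  by sweq.
by move=> xP; rewrite E1 xP E2 -xP E3.
Qed.

Lemma can_descent (t : indT (resB M)) : galois A ->
  ind_lin delta t = 0 <-> exists m, canM M t = coaug m.
Proof.
move=> gal; split=> [t0|[m mE]].
  have := can_delta t; rewrite t0 linear0 => /esym/eqP.
  by rewrite subr_eq0 => /eqP /coret_descent <-; exists (coret (canM M t)).
apply: (bij_inj (canM_bij X gal)); rewrite can_delta mE D_coaug subrr linear0.
by [].
Qed.

End Descent.

(** * Unit and counit *)

Section CategoryLemmas.
Variables (C : category) (T : functor C C) (theta : forall x, hom (T x) x).
Hypothesis theta_iso : forall x, is_iso (theta x).
Hypothesis theta_nat : forall x y (f : hom x y),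
  compm (theta y) (fmap T f) = compm f (theta x).

(* A natural endomorphism e of the identity commutes with every endomorphism of x,
   so a one-sided inverse of e_x is two-sided; apply this to e = eps o theta^-1. *)
Lemma split_counit_iso (eps : forall x, hom (T x) x) :
  (forall x y (f : hom x y), compm (eps y) (fmap T f) = compm f (eps x)) ->
  (forall x, exists r, compm (eps (T x)) r = idm (T x)) ->
  forall x, is_iso (eps x).
Proof.
move=> eps_nat eps_split x.
have [t [tl tr]] := theta_iso x; have [r rP] := eps_split x.
pose s := compm (fmap T (theta x)) (compm r t).
have epsS : compm (eps x) s = idm x.
  by rewrite /s !compmA eps_nat -(compmA (theta x)) rP compm1r tr.
pose e := compm (eps x) t; pose d := compm (theta x) s.
have de : compm d e = compm e d.
  rewrite /e compmA -eps_nat -!compmA; congr (compm _ _).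
  by rewrite -[LHS]compm1l -tl -!compmA (compmA _ (fmap T d)) theta_nat -!compmA tr compm1r.
exists s; split=> //.
have ed : compm e d = idm x.
  by rewrite /e /d -!compmA (compmA t) tl compm1l.
have E : compm s (eps x) = compm t (compm (compm d e) (theta x)).
  by rewrite /d /e -!compmA tl compm1r (compmA t) tl compm1l.
by rewrite E de ed compm1l tl.
Qed.

(** The dual argument, with the natural endomorphism e = theta o eta of the identity. *)
Lemma split_unit_iso (eta : forall x, hom x (T x)) :
  (forall x y (f : hom x y), compm (eta y) f = compm (fmap T f) (eta x)) ->
  (forall x, exists r, compm r (eta (T x)) = idm (T x)) ->
  forall x, is_iso (eta x).
Proof.
move=> eta_nat eta_split x.
have [t [tl tr]] := theta_iso x; have [r rP] := eta_split x.
pose s := compm (theta x) (compm r (fmap T t)).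
have etaS : compm s (eta x) = idm x.
  by rewrite /s -!compmA -eta_nat (compmA r) rP compm1l tr.
pose e := compm (theta x) (eta x); pose d := compm s t.
have de : compm d e = compm e d.
  by rewrite /e -(compmA (theta x) (eta x) d) eta_nat (compmA _ (fmap T d)) theta_nat -compmA.
have de1 : compm d e = idm x.
  by rewrite /d -(compmA s t) /e (compmA t) tl compm1l.
exists s; split=> //.
have E : compm (eta x) s = compm t (compm (compm e d) (theta x)).
  by rewrite /d /e -!compmA tl compm1r (compmA t) tl compm1l.
by rewrite E -de de1 compm1l tl.
Qed.

End CategoryLemmas.

Section Adjunction.
Variables (k : fieldType) (H : coquasi_bialgebra k) (A : comodule_algebra H).
Local Notation B := (coinv_alg A).

Section Counit.
Variable M : rel_hopf_module A.

Lemma counit_balanced : balanced (@ractB _ _ A (coinv_mod M)) (@lmulB _ _ A)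
  (fun (m : coinv_mod M) a => (val m : M) ◁ a).
Proof.
split=> [m m' a|m|m b a].
- by rewrite /ract pureDl linearD.
- by mlin.
- by rewrite /ractB coinv_scaleE; apply: ractA_coinv1; apply: coinvP.
Qed.

Definition counit_lin : {linear indT (coinv_mod M) -> M} := tlin counit_balanced.

Lemma counit_linE (m : coinv_mod M) a : counit_lin (pureB m a) = (val m : M) ◁ a.
Proof. exact: (tlift_pure counit_balanced). Qed.

Lemma counit_colinear (t : ind (coinv_mod M)) :
  rho M (counit_lin t) = \csw_(t0, t1 <- t) counit_lin t0 ⊗ t1.
Proof.
have P1 y : linear (fun x : ind (coinv_mod M) => counit_lin x ⊗ y : (M ⊗ H)%type) by mlin.
have P2 (x : ind (coinv_mod M)) : linear (fun y : H => counit_lin x ⊗ y : (M ⊗ H)%type) by mlin.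
move: t; apply: ind_ext => [||m a]; [by mlin|exact: linear_csw_ind|].
rewrite counit_linE csw_ind // rho_ract_coinvl; last exact: coinvP.
by apply: eq_csw2 => a0 a1; rewrite counit_linE.
Qed.

Lemma counit_act (t : ind (coinv_mod M)) (b : A) :
  counit_lin (t ◁ b) = counit_lin t ◁ b.
Proof.
move: t; apply: ind_ext => [||m a].
- by move=> c x y; rewrite linear_ract linearP.
- by mlin.
by rewrite ind_ractE !counit_linE ractA_coinv1 //; apply: coinvP.
Qed.

Definition counit_map : relhopf_hom (ind (coinv_mod M)) M :=
  @RelhopfHom _ _ _ (ind (coinv_mod M)) M counit_lin counit_colinear counit_act.

End Counit.

Section Unit.
Variable N : rmod A.

Lemma unit_coinv (n : N) : pureB n (aone A) \in coinv_pred (ind N).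
Proof.
rewrite unfold_in; apply/eqP; rewrite [LHS]ind_rhoE' csw2_aone //.
- by move=> y; apply: linC_pure1; apply: pureB_linear.
- by mlin.
Qed.

Definition unit_fun (n : N) : coinv_mod (ind N) := Coinv (unit_coinv n).

Lemma unit_linear : linear unit_fun.
Proof.
move=> b m n; apply: val_inj; rewrite /= [LHS]pureDl; congr (_ + _).
rewrite [LHS](pureB_bal m (b : B)) [RHS]ind_ractE; congr (pureB _ _).
by rewrite /lmulB (amul1r (caP A)) (amul1l (caP A)).
Qed.

Definition unit_map : {linear N -> coinv_mod (ind N)} :=
  HB.pack unit_fun (GRing.isLinear.Build B^c N (coinv_mod (ind N)) *:%R unit_fun unit_linear).

Lemma val_unit_map n : val (unit_map n) = pureB n (aone A). Proof. by []. Qed.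

End Unit.

Lemma ind_linK (N P Q : rmod A) (f : {linear N -> P}) (g : {linear P -> Q}) t :
  ind_lin g (ind_lin f t) = ind_lin (g \o f) t.
Proof.
by move: t; apply: ind_ext => [||n a]; [mlin|exact: linearP|rewrite !ind_linE].
Qed.

Lemma counit_unit (N : rmod A) t : counit_lin (ind N) (ind_lin (unit_map N) t) = t.
Proof.
move: t; apply: ind_ext => [||n a]; [by mlin|exact: linC_id|].
by rewrite ind_linE counit_linE val_unit_map ind_ractE (amul1l (caP A)).
Qed.

Lemma coinv_counit_unit (M : rel_hopf_module A) (m : coinv_mod M) :
  coinv_map (counit_map M) (unit_map (coinv_mod M) m) = m.
Proof. by apply: val_inj; rewrite /= [LHS]counit_linE (ract1 (rhP M)). Qed.

Lemma counit_natural (M N : rel_hopf_module A) (f : relhopf_hom M N) t :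
  counit_lin N (ind_lin (coinv_map f) t) = f (counit_lin M t).
Proof.
move: t; apply: ind_ext => [||m a]; [by mlin|by mlin|].
by rewrite ind_linE !counit_linE rh_act.
Qed.

Lemma unit_natural (N P : rmod A) (f : {linear N -> P}) n :
  unit_map P (f n) = coinv_map (ind_map f) (unit_map N n).
Proof. by apply: val_inj; apply: esym; apply: ind_linE. Qed.

End Adjunction.

Section Isomorphisms.
Variables (k : fieldType) (H : coquasi_bialgebra k) (A : comodule_algebra H).

Lemma relhopf_bij_iso (M N : cat_relhopf A) (f : relhopf_hom M N) :
  bijective f -> @is_iso (cat_relhopf A) M N f.
Proof.
move=> /linear_inverse [g [fg gf]].
have gr n : rho M (g n) = \csw_(n0, n1 <- n) g n0 ⊗ n1.
  rewrite -[in RHS](gf n) /csw2 (rh_colinear f).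
  have P : balanced (@kact _ N) (@kscale _ H) (fun x y => g x ⊗ y) by apply: kbalanced; mlin.
  rewrite (tlift_tlift _ _ P) -[LHS]csw_rho; apply: eq_tlift => m0 m1.
  by rewrite (tlift_pure P) fg.
have ga n a : g (n ◁ a) = g n ◁ a.
  by apply: (can_inj fg); rewrite gf rh_act gf.
exists (@RelhopfHom _ _ _ N M g gr ga).
by split; apply: relhopf_hom_ext => x /=; rewrite ?fg ?gf.
Qed.

Lemma relhopf_iso_bij (M N : cat_relhopf A) (f : relhopf_hom M N) :
  @is_iso (cat_relhopf A) M N f -> bijective f.
Proof.
move=> [g [gf fg]]; exists (g : relhopf_hom N M) => x.
- exact: (congr1 (fun h : relhopf_hom M M => h x) gf).
- exact: (congr1 (fun h : relhopf_hom N N => h x) fg).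
Qed.

Lemma mod_bij_iso (M N : cat_mod A) (f : mod_hom M N) :
  bijective f -> @is_iso (cat_mod A) M N f.
Proof.
move=> /linear_inverse [g [fg gf]]; exists g.
by split; apply: linear_ext => x; [exact: fg | exact: gf].
Qed.

Lemma mod_iso_bij (M N : cat_mod A) (f : mod_hom M N) :
  @is_iso (cat_mod A) M N f -> bijective f.
Proof.
move=> [g [gf fg]]; exists (g : mod_hom N M) => x.
- exact: (congr1 (fun h : mod_hom M M => h x) gf).
- exact: (congr1 (fun h : mod_hom N N => h x) fg).
Qed.

(* The natural isomorphisms on the left are arbitrary, not the unit and counit of the adjunction. *)
Lemma inverse_equivalencesP :
  inverse_equivalences (coinv_functor A) (ind_functor A) <->
  (forall M : rel_hopf_module A, bijective (counit_lin M)) /\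
  (forall N : rmod A, bijective (unit_map N)).
Proof.
split=> [[[th [th_iso th_nat]] [th' [th'_iso th'_nat]]]|[eps_bij eta_bij]].
  split=> [M|N].
    apply: (@relhopf_iso_bij _ M (counit_map M)).
    apply: (@split_counit_iso (cat_relhopf A) (functor_comp (ind_functor A) (coinv_functor A))
      th th_iso th_nat (fun M => counit_map M)) => [X Y f|X].
      by apply: relhopf_hom_ext => t; apply: counit_natural.
    (* The triangle identity splits the counit at every object induced from coinvariants. *)
    exists (ind_map (unit_map (coinv_mod X))).
    by apply: relhopf_hom_ext => t; apply: counit_unit.
  apply: (@mod_iso_bij N _ (unit_map N)).
  apply: (@split_unit_iso (cat_mod A) (functor_comp (coinv_functor A) (ind_functor A))
    th' th'_iso th'_nat (fun N => unit_map N)) => [X Y f|X].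
    by apply: linear_ext => n; apply: unit_natural.
  (* The other triangle identity splits the unit at coinvariants of induced modules. *)
  exists (coinv_map (counit_map (ind X))).
  by apply: linear_ext => m; apply: coinv_counit_unit.
split.
  exists (fun M => counit_map M); split=> [M|M N f].
    exact: (@relhopf_bij_iso (ind (coinv_mod M)) M (counit_map M) (eps_bij M)).
  by apply: relhopf_hom_ext => t; apply: counit_natural.
have ex (N : rmod A) : exists g : {linear coinv_mod (ind N) -> N},
    cancel (unit_map N) g /\ cancel g (unit_map N) by exact: linear_inverse (eta_bij N).
pose g N := sval (cid (ex N)).
have uK N : cancel (unit_map N) (g N) by case: (svalP (cid (ex N))).
have gK N : cancel (g N) (unit_map N) by case: (svalP (cid (ex N))).
exists g; split=> [N|N P f].
  exact: (@mod_bij_iso (coinv_mod (ind N)) N (g N) (Bijective (gK N) (uK N))).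
apply: linear_ext => m; apply: (can_inj (uK P)).
apply: etrans (gK P _) _; apply: esym; apply: etrans (unit_natural f (g N m)) _.
by rewrite gK.
Qed.

End Isomorphisms.

Section ExactZero.
Variables (k : fieldType) (H : coquasi_bialgebra k) (A : comodule_algebra H).

(** Expresses injectivity as exactness, the only notion through which faithful flatness is
    defined. *)
Lemma exact_zero (N P : rmod A) (f : {linear N -> P}) :
  exact_at 0 (\0 : {linear N -> N}) f <-> injective f.
Proof.
split=> [ex|finj n].
  by apply: (@linear_inj _ N P f) => n /ex [u <-].
split=> [n0|[u <-]]; last exact: linear0.
by exists 0; apply: finj; rewrite n0; exact: (linear0 f).
Qed.

Lemma ind_lin0 (N : rmod A) t : ind_lin (\0 : {linear N -> N}) t = 0.
Proof.
move: t; apply: ind_ext => [||n a]; [by mlin|by move=> c x y; rewrite scaler0 addr0|].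
by rewrite ind_linE; have := pureDl (@ractB _ _ A N) (@lmulB _ _ A) 0 0 a;
  rewrite addr0 => /esym/eqP; rewrite -subr_eq0 addrK => /eqP.
Qed.

End ExactZero.

(** * From faithful flatness and the Galois property to bijective unit and counit *)

Section GaloisDescent.
Variables (k : fieldType) (H : coquasi_hopf k) (A : comodule_algebra H).

(** For coinvariant m the form pR(m_1,a_1) is pR(1,a_1) = beta(a_1). Up to the bijection [canM] and
    the injection [coaug], the counit is thus the inclusion of coinvariants tensored with A. *)
Lemma can_incl (M : rel_hopf_module A) t :
  canM M (ind_lin (coinv_incl M) t) = coaug M (counit_lin M t).
Proof.
move: t; apply: ind_ext => [||m a]; [by mlin|by mlin|].
have mP := coinvP (m : coinv M).
rewrite ind_linE [LHS]canM_pure counit_linE coaugE (csw2_pure _ _ mP); [|by mlin..].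
transitivity (\csw_(a0, a' <- a) \sw_(a1, a2 <- a')
  (beta H a1 *: (((val m : M) ◁ a0) ⊗ a2))).
  by apply: eq_csw2 => a0 a'; apply: eq_sw2 => a1 a2; rewrite pR_one_l.
rewrite [in RHS]/csw2 rho_ract_coinvl // tlift_tlift; last by apply: kbalanced; mlin.
by apply: eq_tlift => a0 a1; rewrite tlift_pure //; apply: kbalanced; mlin.
Qed.

Lemma flat_injective (N P : rmod A) (f : {linear N -> P}) :
  faithfully_flat A -> injective f <-> injective (ind_lin f).
Proof.
move=> ff; rewrite -exact_zero (ff _ _ _ _ _).
split=> [ex|finj t].
  by apply: linear_inj => t /ex [u <-]; apply: ind_lin0.
split=> [t0|[u <-]]; last by rewrite ind_lin0 linear0.
by exists 0; rewrite ind_lin0; apply: finj; rewrite t0 linear0.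
Qed.

Lemma coinv_exact (M : rel_hopf_module A) : exact_at 0 (coinv_incl M) (delta M).
Proof.
move=> m; split=> [/delta_eq0 mP|[u <-]]; last by apply/delta_eq0; apply: coinvP.
have mP' : (m : M) \in coinv_pred M by rewrite unfold_in; apply/eqP.
by exists (Coinv mP').
Qed.

Lemma galois_counit_bij (M : rel_hopf_module A) :
  faithfully_flat A -> galois A -> bijective (counit_lin M).
Proof.
move=> ff gal.
have incl_inj : injective (ind_lin (coinv_incl M)).
  by apply/flat_injective => //; apply: val_inj.
have /ff ex := @coinv_exact M.
have inj : injective (counit_lin M).
  move=> x y xy; apply: incl_inj; apply: (bij_inj (canM_bij M gal)).
  by rewrite !can_incl xy.
have onto m : exists t, counit_lin M t = m.
  have [g _ gK] := canM_bij M gal.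
  (* The preimage of coaug(m) under [canM] is a descent datum, so flatness places it in the
     coinvariants tensored with A. *)
  have /ex [u uE] : ind_lin (delta M) (g (coaug M m)) = 0.
    by apply/(can_descent _ gal); exists m.
  by exists u; apply: (@coaug_inj _ _ _ M); rewrite -can_incl uE gK.
have [g gE] := choice onto.
by exists g => // x; apply: inj; rewrite gE.
Qed.

(** Put M = N ⊗_B A. By the triangle identity, the map n |-> n ⊗ 1 from N to M becomes, after
    tensoring with A, [coaug] up to [canM]. It is then injective with image the kernel of the
    tensored delta, and faithful flatness reflects both facts to N. *)
Lemma galois_unit_bij (N : rmod A) :
  faithfully_flat A -> galois A -> bijective (unit_map N).
Proof.
move=> ff gal; pose M := ind N.
pose i : {linear N -> resB M} := coinv_incl M \o unit_map N.
have can_i t : canM M (ind_lin i t) = coaug M t.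
  by rewrite -ind_linK can_incl counit_unit.
have i_inj : injective i.
  apply/(flat_injective _ ff) => x y xy; apply: (@coaug_inj _ _ _ M).
  by rewrite -!can_i xy.
have /ff ex : exact_at 0 (ind_lin i) (ind_lin (delta M)).
  move=> t; rewrite (can_descent _ gal); split=> [[m mE]|[u <-]].
    by exists m; apply: (bij_inj (canM_bij M gal)); rewrite can_i.
  by exists u; apply: can_i.
have onto m : exists n, unit_map N n = m.
  have /ex [n nE] : delta M (coinv_incl M m) = 0 by apply/coinv_exact; exists m.
  by exists n; apply: val_inj.
have [g gE] := choice onto.
exists g => // n; apply: i_inj.
have := congr1 (coinv_incl M) (gE (unit_map N n)); exact.
Qed.

End GaloisDescent.

(** * From the equivalence to faithful flatness *)

Section Image.
Variables (R : pzRingType) (N P : lmodType R) (f : {linear N -> P}).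

Definition image_pred : {pred P} := fun p => `[< exists n, f n = p >].

Lemma image_closed : GRing.submod_closed image_pred.
Proof.
split=> [|c x y]; rewrite !unfold_in.
  by apply/asboolP; exists 0; apply: linear0.
move=> /asboolP [n <-] /asboolP [m <-]; apply/asboolP.
by exists (c *: n + m); apply: linearP.
Qed.

HB.instance Definition _ := GRing.isSubmodClosed.Build R P image_pred image_closed.

Record image_type := Image { image_val : P; image_valP : image_val \in image_pred }.
HB.instance Definition _ := [isSub for image_val].
HB.instance Definition _ := [Choice of image_type by <:].
HB.instance Definition _ := [SubChoice_isSubLmodule of image_type by <:].

Lemma image_incl_linear : linear (val : image_type -> P).
Proof. by []. Qed.

Definition image_incl : {linear image_type -> P} :=
  HB.pack (val : image_type -> P)
    (GRing.isLinear.Build R image_type P *:%R (val : image_type -> P) image_incl_linear).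

Lemma image_inclP (x : image_type) : exists n, f n = image_incl x.
Proof. by have /asboolP := image_valP x. Qed.

Lemma image_proj_subproof n : f n \in image_pred.
Proof. by rewrite unfold_in; apply/asboolP; exists n. Qed.

Lemma image_proj_linear : linear (fun n => Image (image_proj_subproof n)).
Proof. by move=> c x y; apply: val_inj; apply: linearP. Qed.

Definition image_proj : {linear N -> image_type} :=
  HB.pack (fun n => Image (image_proj_subproof n))
    (GRing.isLinear.Build R N image_type *:%R (fun n => Image (image_proj_subproof n))
       image_proj_linear).

End Image.

Section Flatness.
Variables (k : fieldType) (H : coquasi_bialgebra k) (A : comodule_algebra H).
Hypothesis counit_bij : forall M : rel_hopf_module A, bijective (counit_lin M).
Hypothesis unit_bij : forall N : rmod A, bijective (unit_map N).

Lemma pureB_one_inj (N : rmod A) (n n' : N) :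
  pureB n (aone A) = pureB n' (aone A) -> n = n'.
Proof. by move=> E; apply: (bij_inj (unit_bij N)); apply: val_inj. Qed.

Lemma pureB0 (N : rmod A) (a : A) : pureB (0 : N) a = 0.
Proof. by apply: (addrI (pureB 0 a)); rewrite addr0 -[LHS]pureDl addr0. Qed.

Lemma coinv_indP (N : rmod A) (t : ind N) :
  rho (ind N) t = t ⊗ hone H -> exists n, t = pureB n (aone A).
Proof.
move=> tP; have tP' : t \in coinv_pred (ind N) by rewrite unfold_in; apply/eqP.
have [g _ gK] := unit_bij N.
by exists (g (Coinv tP')); rewrite -val_unit_map gK.
Qed.

(** The kernel of g ⊗ A is a relative Hopf module, so surjectivity of its counit makes it generated
    by coinvariants. By bijectivity of the units these are the n ⊗ 1 with g(n) = 0, and exactness at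
    N2 applies to each such n. *)
Lemma ind_exact (N1 N2 N3 : rmod A) (f : {linear N1 -> N2}) (g : {linear N2 -> N3}) :
  exact_at 0 f g -> exact_at 0 (ind_lin f) (ind_lin g).
Proof.
move=> ex t; split=> [t0|[u <-]]; last first.
  rewrite ind_linK; move: u; apply: ind_ext => [||n a].
  - by mlin.
  - by move=> c x y; rewrite scaler0 addr0.
  rewrite ind_linE [X in pureB X](_ : _ = 0) ?pureB0 //.
  by apply/ex; exists n.
pose K := rh_ker (ind_map g).
have [x <-] : exists x : K, rh_ker_incl (ind_map g) x = t by apply: rh_ker_lift.
have [h _ hK] := counit_bij K; rewrite -(hK x); move: (h x) => {x t0 h hK t}.
apply: tens_ind => [|x y [u uE] [v vE]|m a].
- by exists 0; rewrite !linear0.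
- by exists (u + v); rewrite !linearD uE vE.
pose m' := coinv_map (rh_ker_incl (ind_map g)) m.
have [n nE] := coinv_indP (coinvP (m' : coinv (ind N2))).
have /ex [n' n'E] : g n = 0.
  apply: pureB_one_inj; rewrite pureB0 -ind_linE -nE.
  exact: (rh_ker_inclP (phi := ind_map g) (val m)).
exists (pureB n' a); rewrite ind_linE n'E [counit_lin _ _]counit_linE.
rewrite (rh_act (rh_ker_incl _)) [rh_ker_incl _ _]nE ind_ractE.
by rewrite (amul1l (caP A)).
Qed.

(** If g(n) = 0, then n ⊗ 1 comes from some t in I ⊗_B A, where I is the image of f. Its inclusion
    stays injective after tensoring, so t inherits coinvariance from n ⊗ 1; hence t = m ⊗ 1 with m
    in I, and n is the image of m. *)
Lemma ind_exact_reflect (N1 N2 N3 : rmod A) (f : {linear N1 -> N2}) (g : {linear N2 -> N3}) :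
  exact_at 0 (ind_lin f) (ind_lin g) -> exact_at 0 f g.
Proof.
move=> ex n; split=> [n0|[u <-]]; last first.
  apply: pureB_one_inj; rewrite pureB0 -!ind_linE.
  by apply/ex; exists (pureB u (aone A)).
have [u uE] : exists u, ind_lin f u = pureB n (aone A).
  by apply/ex; rewrite ind_linE n0 pureB0.
pose i := image_incl f.
have fE : ind_lin i (ind_lin (image_proj f) u) = ind_lin f u.
  rewrite ind_linK; move: {uE} u; apply: ind_ext => [||m a]; [by mlin|by mlin|].
  by rewrite !ind_linE.
move: fE; rewrite uE; move: (ind_lin _ u) => t tE {u uE}.
have i_inj : injective (ind_lin i).
  apply: linear_inj => x x0.
  have /ind_exact ex0 : exact_at 0 (\0 : {linear image_type f -> image_type f}) i.
    by apply/exact_zero; apply: val_inj.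
  by have /ex0 [v <-] := x0; apply: ind_lin0.
(* The kernel is zero, hence so is its retraction [r]. The last clause then says that the map
   remains injective after tensoring over k with H, which is needed to compare coactions. *)
have [r [r0 _ rK]] := ker_retract (ind_lin i).
have {r0} r0 x : r x = 0 by apply: i_inj; rewrite r0 linear0.
have [m mE] : exists m, t = pureB m (aone A).
  apply: coinv_indP; apply/eqP; rewrite -subr_eq0; apply/eqP.
  set x := (X in X = 0).
  have -> : x = tmap r (@idfun H) x.
    rewrite rK // linearB tmapE tE.
    have := ind_lin_colinear i t; rewrite tE [LHS](coinvP (unit_map N2 n : coinv (ind N2))) => ->.
    rewrite -[rho _ _]csw_rho (linear_csw2 _ _ (linearP (tmap _ _))).
    apply/eqP; rewrite subr_eq0; apply/eqP; apply: eq_csw2 => t0 t1.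
    exact: tmapE.
  move: x; apply: tens_ext => [||y h]; [by mlin|by move=> c x y; rewrite scaler0 addr0|].
  have P : linear (fun z : indT (image_type f) => z ⊗ h) by mlin.
  by rewrite tmapE r0 [LHS](linear0 (mklin P)).
have [n' n'E] := image_inclP m; exists n'.
by rewrite n'E; apply: pureB_one_inj; rewrite -tE mE ind_linE.
Qed.

Lemma equiv_faithfully_flat : faithfully_flat A.
Proof.
by move=> N1 N2 N3 f g; split; [exact: ind_exact | exact: ind_exact_reflect].
Qed.

End Flatness.

(** * From the equivalence to the Galois property *)

Definition regular_comodule (k : fieldType) (C : coalgebra k) : comodule C :=
  Comodule (@comulA k C) (@counitr k C).

Section Galois.
Variables (k : fieldType) (H : coquasi_hopf k) (A : comodule_algebra H).
Hypothesis counit_bij : forall M : rel_hopf_module A, bijective (counit_lin M).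
Local Notation S := (antipode H).
Local Notation one := (hone H).
Local Notation R := (regular A).
Local Notation V := (regular_comodule H).
Local Notation L := (ltens V R).
Local Notation alpha := (alpha H).

Lemma ltens_comodE (W : lmodType k) (F : L -> H -> W) (g : H) (m : A) :
  (forall y, linear (F^~ y)) -> (forall x, linear (F x)) ->
  csw2 ((g : V) ⊗ (m : R) : L) F =
  \sw_(g1, g2 <- g) \csw_(m0, m1 <- (m : R)) F ((g1 : V) ⊗ m0) (g2 ⋅ m1).
Proof. exact: csw2_ltens. Qed.

Definition coret_fun (g : V) (m : R) : R := \csw_(m0, m1 <- m) (pL (g : H) m1 *: m0).

Lemma coret_balanced : balanced (@kact _ V) (@kscale _ R) coret_fun.
Proof. by apply: kbalanced; rewrite /coret_fun; mlin. Qed.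

Definition coret : {linear L -> R} := tlin coret_balanced.

Lemma coretE (g : H) (m : R) : coret ((g : V) ⊗ m) = \csw_(m0, m1 <- m) (pL g m1 *: m0).
Proof. exact: (tlift_pure coret_balanced). Qed.

(** An element of B acts on H ⊗ A through A alone and leaves the coaction leg in [pL] unchanged. *)
Let coret_B_linear : linear (fun e : coinv_mod L => (coret (val e : L) : resB R)).
Proof.
move=> b e e'; rewrite [LHS](linearD coret); congr (_ + _).
rewrite resB_scaleE coinv_scaleE; move: (val e) => {e e'}.
have bP := coinvP (b : coinv A).
apply: tens_ext => [||g m]; [by mlin|by mlin|].
rewrite ltens_ract_coinv !coretE csw2_ract; [|by mlin..].
have P : linear (fun x : R => x ◁ (val (b : coinv_alg A) : A)) by mlin.
rewrite (linear_csw2 _ _ P); apply: eq_csw2 => m0 m1.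
rewrite (csw2_pure _ _ bP); [|by mlin..].
by rewrite (hmul1r (cqbP H)); apply: esym (linearZ_LR (mklin P) _ _).
Qed.

Definition coretB : {linear coinv_mod L -> resB R} :=
  HB.pack (fun e : coinv_mod L => (coret (val e : L) : resB R))
    (GRing.isLinear.Build (coinv_alg A)^c (coinv_mod L) (resB R) *:%R
      (fun e : coinv_mod L => (coret (val e : L) : resB R)) coret_B_linear).

Lemma ltens_ractV (g : H) (m a : A) : ((g : V) ⊗ (m : R) : L) ◁ a =
  \sw_(g0, g1 <- g) \csw_(m0, m1 <- (m : R)) \csw_(a0, a1 <- a)
    (omega g1 m1 a1 *: ((g0 : V) ⊗ (m0 ◁ a0))).
Proof. exact: ltens_ractE. Qed.

Lemma linear_rho (W : lmodType k) (G : {linear (V ⊗ R ⊗ H)%type -> W}) (g : H) (m : R) :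
  G (rho L ((g : V) ⊗ m)) =
  \sw_(g1, g2 <- g) \csw_(m0, m1 <- m) G (((g1 : V) ⊗ m0) ⊗ (g2 ⋅ m1)).
Proof.
by rewrite -csw_rho (linear_csw2 _ _ (linearP G)) ltens_comodE //; mlin.
Qed.

(** Over a Hopf algebra with trivial associator this is g ⊗ m |-> m_0 ⊗ g m_1. It is chosen so that
    can after the retraction factors as [Psi] after the counit of H ⊗ A. *)
Let Psi_fun (g : V) (m : R) : (R ⊗ H)%type :=
  \csw_(m0, m1 <- m) \sw_(g1, g2, g3 <- (g : H)) \sw_(m1, m2 <- m1)
    (pL g2 m1 *: \sw_(y1, y2 <- g3 ⋅ m2) (pR (S g1) y1 *: (m0 ⊗ y2))).

Let Psi_balanced : balanced (@kact _ V) (@kscale _ R) Psi_fun.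
Proof. by apply: kbalanced; rewrite /Psi_fun; mlin. Qed.

Let Psi : {linear L -> (R ⊗ H)%type} := tlin Psi_balanced.

Let PsiE (g : H) (m : R) : Psi ((g : V) ⊗ m) =
  \csw_(m0, m1 <- m) \sw_(g1, g2, g3 <- g) \sw_(m1, m2 <- m1)
    (pL g2 m1 *: \sw_(y1, y2 <- g3 ⋅ m2) (pR (S g1) y1 *: (m0 ⊗ y2))).
Proof. exact: (tlift_pure Psi_balanced). Qed.

Let Psi_one (h : H) : Psi ((h : V) ⊗ (aone A : R)) = (aone A : R) ⊗ h.
Proof.
rewrite PsiE csw2_aone; [|by mlin..].
transitivity (\sw_(h1, h2, h' <- h) \sw_(h3, h4 <- h')
  ((pL h2 one * pR (S h1) h3) *: ((aone A : R) ⊗ h4))); first by sweq.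
transitivity (\sw_(h', h4 <- h) ((\sw_(h1, h2, h3 <- h') (alpha h2 * pR (S h1) h3)) *:
  ((aone A : R) ⊗ h4))).
  transitivity (\sw_(h1, h2, h' <- h) \sw_(h3, h4 <- h')
    ((alpha h2 * pR (S h1) h3) *: ((aone A : R) ⊗ h4))); last by sweq.
  by do 2 apply: eq_sw2 => ? ?; apply: eq_sw2 => ? ?; rewrite pL_one_r.
transitivity (\sw_(h', h4 <- h) (eps h' *: ((aone A : R) ⊗ h4))); last by sweq.
by apply: eq_sw2 => ? ?; rewrite alpha_pR.
Qed.

(** Both sides are written as linear functions of rho(e): [P1] by [pL_shift], [P2] by
    quasi-associativity. After replacing rho(e) by e ⊗ 1, they are linked through [P3], where
    [pL_omega] absorbs the associator of the action. *)
Let can_coret (e : coinv_mod L) (a : A) :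
  canM R (pureB (coretB e) a) = Psi ((val e : L) ◁ a).
Proof.
have [P1 P1E] : exists G : {linear (V ⊗ R ⊗ H)%type -> (R ⊗ H)%type},
    forall (g : V) m z, G ((g ⊗ m) ⊗ z) =
     \csw_(m0, m1 <- m) \sw_(g1, g2 <- (g : H)) (pL g2 m1 *:
       \csw_(a0, a1 <- a) \sw_(a1, a2 <- a1) (pR (S g1 ⋅ z) a1 *: ((m0 ◁ a0) ⊗ a2))).
  by apply: trilinear_lift; mlin.
have [P2 P2E] : exists G : {linear (V ⊗ R ⊗ H)%type -> (R ⊗ H)%type},
    forall (g : V) m z, G ((g ⊗ m) ⊗ z) =
     \csw_(m0, m1 <- m) \csw_(a0, a1 <- a) \sw_(a1, a2 <- a1) \sw_(g1, g2 <- (g : H))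
       ((\sw_(g2, g3 <- g2) \sw_(m1, m2 <- m1) \sw_(a1, a3 <- a1)
         (pL g2 (m1 ⋅ a1) * omega g3 m2 a3)) *:
       \sw_(y1, y2 <- z ⋅ a2) (pR (S g1) y1 *: ((m0 ◁ a0) ⊗ y2))).
  by apply: trilinear_lift; mlin.
have [P3 P3E] : exists G : {linear (V ⊗ R ⊗ H)%type -> (R ⊗ H)%type},
    forall (g : V) m z, G ((g ⊗ m) ⊗ z) =
     \csw_(m0, m1 <- m) \csw_(a0, a1 <- a) \sw_(a1, a2 <- a1) \sw_(g1, g2, g3 <- (g : H))
       ((pL g3 m1 * omegaV (S g2) z a1) *:
       \sw_(y1, y2 <- a2) (pR (S g1) y1 *: ((m0 ◁ a0) ⊗ y2))).
  by apply: trilinear_lift; mlin.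
have E0 : (fun x : L => canM R (pureB (coret x : resB R) a)) =1 (fun x => P1 (rho L x)).
  apply: tens_ext => [||g m].
  - apply: (linear_comp (f := fun x => canM R (pureB (x : resB R) a))); last by mlin.
    by apply: linC_map; apply: pureB_linear1.
  - by mlin.
  rewrite coretE linear_rho.
  have P : linear (fun x : R => canM R (pureB (x : resB R) a)).
    by apply: linC_map; apply: pureB_linear1.
  rewrite [LHS](linear_csw2 _ _ P).
  transitivity (\csw_(m0, m' <- m) \sw_(m1, m2 <- m') (pL g m2 *:
    \csw_(a0, a1 <- a) \sw_(a1, a2 <- a1) (pR m1 a1 *: ((m0 ◁ a0) ⊗ a2)))).
    transitivity (\csw_(m0, m2 <- m) (pL g m2 *: \csw_(m0, m1 <- m0)
      \csw_(a0, a1 <- a) \sw_(a1, a2 <- a1) (pR m1 a1 *: ((m0 ◁ a0) ⊗ a2)))); last by sweq.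
    apply: eq_csw2 => m0 m1; rewrite -canM_pure.
    exact: (linearZ_LR (mklin P)).
  transitivity (\csw_(m0, m' <- m) \sw_(g1, g2, g3 <- g) \sw_(m1, m2 <- m') (pL g2 m1 *:
    \csw_(a0, a1 <- a) \sw_(a1, a2 <- a1) (pR (S g1 ⋅ (g3 ⋅ m2)) a1 *: ((m0 ◁ a0) ⊗ a2)))).
    apply: eq_csw2 => m0 m'.
    have Q : linear (fun z => \csw_(a0, a1 <- a) \sw_(a1, a2 <- a1)
      (pR z a1 *: ((m0 ◁ a0) ⊗ a2))) by mlin.
    exact: (pL_shift (mklin Q)).
  transitivity (\sw_(g1, g2 <- g) \csw_(m0, m1 <- m) \csw_(m0, m2 <- m0) \sw_(g3, g4 <- g1)
    (pL g4 m2 *: \csw_(a0, a1 <- a) \sw_(a1, a2 <- a1)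
      (pR (S g3 ⋅ (g2 ⋅ m1)) a1 *: ((m0 ◁ a0) ⊗ a2)))); first by sweq.
  by apply: eq_sw2 => g1 g2; apply: eq_csw2 => m0 m1; rewrite P1E.
have E1 : (fun x : L => Psi (x ◁ a)) =1 (fun x => P2 (rho L x)).
  apply: tens_ext => [||g m]; [by mlin|by mlin|].
  rewrite ltens_ractV linear_rho (linear_sw2 _ _ (linearP Psi)).
  transitivity (\csw_(m0, m' <- m) \csw_(a0, a' <- a) \sw_(g1, g2, g' <- g)
    \sw_(m1, m' <- m') \sw_(a1, a' <- a') (pL g2 (m1 ⋅ a1) *:
      (\sw_(g3, g4 <- g') \sw_(m2, m3 <- m') \sw_(a2, a3 <- a') (omega g4 m3 a3 *:
        \sw_(y1, y2 <- g3 ⋅ (m2 ⋅ a2)) (pR (S g1) y1 *: ((m0 ◁ a0) ⊗ y2)))))).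
    transitivity (\sw_(g1, g4 <- g) \csw_(m0, m3 <- m) \csw_(a0, a3 <- a) (omega g4 m3 a3 *:
      \csw_(x0, x1 <- m0 ◁ a0) \sw_(g1, g2, g3 <- g1) \sw_(x1, x2 <- x1)
      (pL g2 x1 *: \sw_(y1, y2 <- g3 ⋅ x2) (pR (S g1) y1 *: (x0 ⊗ y2))))); last by sweq.
    apply: eq_sw2 => g1 g4; rewrite (linear_csw2 _ _ (linearP Psi)).
    apply: eq_csw2 => m0 m3; rewrite (linear_csw2 _ _ (linearP Psi)).
    by apply: eq_csw2 => a0 a3; rewrite linearZ PsiE.
  transitivity (\csw_(m0, m' <- m) \csw_(a0, a' <- a) \sw_(g1, g2, g' <- g)
    \sw_(m1, m' <- m') \sw_(a1, a' <- a') (pL g2 (m1 ⋅ a1) *: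
      (\sw_(g3, g4 <- g') \sw_(m2, m3 <- m') \sw_(a2, a3 <- a') (omega g3 m2 a2 *:
        \sw_(y1, y2 <- (g4 ⋅ m3) ⋅ a3) (pR (S g1) y1 *: ((m0 ◁ a0) ⊗ y2)))))).
    apply: eq_csw2 => m0 m'; apply: eq_csw2 => a0 a'; apply: eq_sw2 => g1 g''.
    apply: eq_sw2 => g2 g'; apply: eq_sw2 => m1 m''; apply: eq_sw2 => a1 a''.
    congr (_ *: _).
    have Q : linear (fun z => \sw_(y1, y2 <- z) (pR (S g1) y1 *: ((m0 ◁ a0) ⊗ y2))) by mlin.
    exact: (hmulA_lin (mklin Q)).
  transitivity (\sw_(g1, g2 <- g) \csw_(m0, m2 <- m)
    \csw_(m0, m1 <- m0) \csw_(a0, a1 <- a) \sw_(a1, a2 <- a1) \sw_(g1, g4 <- g1)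
       ((\sw_(g3, g4 <- g4) \sw_(m1, m3 <- m1) \sw_(a1, a3 <- a1)
         (pL g3 (m1 ⋅ a1) * omega g4 m3 a3)) *:
       \sw_(y1, y2 <- (g2 ⋅ m2) ⋅ a2) (pR (S g1) y1 *: ((m0 ◁ a0) ⊗ y2)))); first by sweq.
  by apply: eq_sw2 => g1 g2; apply: eq_csw2 => m0 m1; rewrite P2E.
have E2 : (fun x : L => P2 (x ⊗ one)) =1 (fun x => P3 (rho L x)).
  apply: tens_ext => [||g m]; [by mlin|by mlin|].
  rewrite P2E linear_rho.
  transitivity (\csw_(m0, m1 <- m) \csw_(a0, a1 <- a) \sw_(a1, a2 <- a1) \sw_(g1, g2 <- g)
       ((\sw_(g2, g3, g4 <- g2) \sw_(m1, m2 <- m1)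
          (pL g3 m1 * omegaV (S g2) (g4 ⋅ m2) a1)) *:
       \sw_(y1, y2 <- one ⋅ a2) (pR (S g1) y1 *: ((m0 ◁ a0) ⊗ y2)))).
    apply: eq_csw2 => m0 m1; apply: eq_csw2 => a0 a1; apply: eq_sw2 => a2 a3.
    by apply: eq_sw2 => g1 g2; rewrite pL_omega.
  transitivity (\sw_(g1, g4 <- g) \csw_(m0, m2 <- m) \csw_(m0, m1 <- m0) \csw_(a0, a1 <- a)
     \sw_(a1, a2 <- a1) \sw_(g1, g2, g3 <- g1)
       ((pL g3 m1 * omegaV (S g2) (g4 ⋅ m2) a1) *:
       \sw_(y1, y2 <- a2) (pR (S g1) y1 *: ((m0 ◁ a0) ⊗ y2)))); first by sweq.
  by apply: eq_sw2 => g1 g2; apply: eq_csw2 => m0 m1; rewrite P3E.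
have E3 : (fun x : L => P3 (x ⊗ one)) =1 (fun x => P1 (x ⊗ one)).
  apply: tens_ext => [||g m]; [by mlin|by mlin|].
  rewrite P3E P1E.
  transitivity (\csw_(m0, m1 <- m) \csw_(a0, a1 <- a) \sw_(a1, a2 <- a1) \sw_(g1, g2, g3 <- g)
       ((pL g3 m1 * (eps (S g2) * eps a1)) *:
       \sw_(y1, y2 <- a2) (pR (S g1) y1 *: ((m0 ◁ a0) ⊗ y2)))); last by sweq.
  apply: eq_csw2 => m0 m1; apply: eq_csw2 => a0 a1; apply: eq_sw2 => a2 a3.
  by do 2 apply: eq_sw2 => ? ?; rewrite omegaV_one.
have eP := coinvP (e : coinv L).
(* Coinvariance is used three times: P1(rho e) = P1(e ⊗ 1) = P3(e ⊗ 1) = P3(rho e) = P2(e ⊗ 1) =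
   P2(rho e). *)
by rewrite [LHS]E0 eP -E3 -eP -E2 -eP -E1.
Qed.

Lemma equiv_can_onto (x : (R ⊗ H)%type) : exists t, canM R t = x.
Proof.
have E : (fun u => canM R (ind_lin coretB u)) =1 (fun u => Psi (counit_lin L u)).
  by apply: ind_ext => [||e a]; [by mlin|by mlin|rewrite ind_linE counit_linE can_coret].
apply: canM_onto => h; have [g _ gK] := counit_bij L.
by exists (ind_lin coretB (g ((h : V) ⊗ (aone A : R)))); rewrite E gK Psi_one.
Qed.

End Galois.

(** * Injectivity of the canonical map, by means of the inverse antipode *)

Section Injective.
Variables (k : fieldType) (H : coquasi_hopf k) (A : comodule_algebra H).
Local Notation S := (antipode H).
Local Notation one := (hone H).
Local Notation R := (regular A).
Local Notation V := (regular_comodule H).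
Local Notation L := (ltens V R).
Local Notation beta := (beta H).
Variable Sb : {linear H -> H}.
Hypotheses (SK : cancel S Sb) (SbK : cancel Sb S).

Let sw2_Sb (W : lmodType k) (F : H -> H -> W) (h : H) :
  (forall y, linear (F^~ y)) -> (forall x, linear (F x)) ->
  sw2 (Sb h) F = \sw_(h1, h2 <- h) F (Sb h2) (Sb h1).
Proof.
move=> F1 F2; rewrite -[h in RHS]SbK sw2_antipode.
- by apply: eq_sw2 => x y; rewrite !SK.
- by move=> y; apply: (linear_comp (F2 _)); apply: linearP.
- by move=> x; apply: (linear_comp (F1 _)); apply: linearP.
Qed.

Let eps_Sb (h : H) : eps (Sb h) = eps h.
Proof. by rewrite -(antipode_eps (cqhP H)) SbK. Qed.

(** This is [sw_beta] evaluated at [Sb x]: the inverse antipode also reverses the legs, so the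
    factor S(Sb x_1) = x_1 ends up on the right. *)
Let sw_beta_Sb (W : lmodType k) (F : {linear H -> W}) (x : H) :
  \sw_(x1, x2, x3 <- x) (beta (Sb x2) *: F (Sb x3 ⋅ x1)) = beta (Sb x) *: F one.
Proof.
rewrite -sw_beta.
transitivity (\sw_(g1, g2 <- Sb x) \sw_(g1, g3 <- g1) (beta g3 *: F (g1 ⋅ S g2)));
  last by sweq.
rewrite sw2_Sb; [|by mlin..].
transitivity (\sw_(x1, x' <- x) \sw_(x2, x3 <- x') (beta (Sb x2) *: F (Sb x3 ⋅ S (Sb x1)))).
  by apply: eq_sw2 => x1 x'; apply: eq_sw2 => x2 x3; rewrite SbK.
by apply: eq_sw2 => x1 x'; rewrite sw2_Sb //; mlin.
Qed.

Let sw_pL_Sb (x : H) :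
  \sw_(x1, x2, x3 <- x) (beta (Sb x2) * pL (Sb x3) x1) = eps x.
Proof.
rewrite -eps_Sb -beta_pL.
transitivity (\sw_(g1, g2 <- Sb x) \sw_(g1, g3 <- g1) (beta g3 * pL g1 (S g2)));
  last by sweq.
rewrite (@sw2_Sb k^o); [|by mlin..].
transitivity (\sw_(x1, x' <- x) \sw_(x2, x3 <- x') (beta (Sb x2) * pL (Sb x3) (S (Sb x1)))).
  by apply: eq_sw2 => x1 x'; apply: eq_sw2 => x2 x3; rewrite SbK.
by apply: eq_sw2 => x1 x'; rewrite (@sw2_Sb k^o) //; mlin.
Qed.

Let gamma (m : R) : L :=
  \csw_(m0, m' <- m) \sw_(m1, m2 <- m') (beta (Sb m1) *: ((Sb m2 : V) ⊗ m0)).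

Let gamma_linear : linear gamma.
Proof. by rewrite /gamma; mlin. Qed.

(** The diagonal coaction multiplies Sb(m_3) by m_1 around beta(Sb(m_2)), which is the product that
    [sw_beta_Sb] collapses to 1. *)
Let gamma_coinv m : gamma m \in coinv_pred L.
Proof.
rewrite unfold_in; apply/eqP; rewrite /gamma.
rewrite (linear_csw2 _ _ (linearP (rho L))).
transitivity (\csw_(m0, m' <- m) \sw_(m', m4 <- m') \sw_(m1, m2, m3 <- m')
  (beta (Sb m2) *: (((Sb m4 : V) ⊗ m0) ⊗ (Sb m3 ⋅ m1) : (L ⊗ H)%type))).
  transitivity (\csw_(m0, m' <- m) \sw_(m1, m2 <- m') (beta (Sb m1) *:
    \sw_(g1, g2 <- m2) \csw_(m0, m3 <- m0) (((Sb g2 : V) ⊗ m0) ⊗ (Sb g1 ⋅ m3) : (L ⊗ H)%type)));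
    last by sweq.
  apply: eq_csw2 => m0 m'; rewrite (linear_sw2 _ _ (linearP (rho L))).
  apply: eq_sw2 => m1 m2; rewrite linearZ; congr (_ *: _).
  by rewrite -csw_rho ltens_comodE; [rewrite sw2_Sb //; mlin|mlin..].
have P : linear (fun x : L => x ⊗ one) by mlin.
rewrite [RHS](linear_csw2 _ _ P); apply: eq_csw2 => m0 m'.
rewrite [RHS](linear_sw2 _ _ P); apply: eq_sw2 => m1 m4.
have Q : linear (fun z => ((Sb m4 : V) ⊗ m0) ⊗ z : (L ⊗ H)%type) by mlin.
rewrite [RHS](linearZ_LR (mklin P)); exact: (sw_beta_Sb (mklin Q)).
Qed.

Let gammaB_linear : linear (fun m : resB R => (Coinv (gamma_coinv m) : coinv_mod L)).
Proof.
move=> b m n; apply: val_inj; rewrite /= -[RHS]/(_ + gamma n).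
rewrite -[gamma (_ + _)]/(mklin gamma_linear _) [LHS](linearD (mklin gamma_linear)).
congr (_ + _); rewrite resB_scaleE.
rewrite -[LHS]/(gamma _) -[RHS]/(gamma m ◁ (val (b : coinv_alg A) : A)) /gamma.
have bP := coinvP (b : coinv A).
have P : linear (fun x : L => x ◁ (val (b : coinv_alg A) : A)) by mlin.
rewrite [RHS](linear_csw2 _ _ P) csw2_ract; [|by mlin..].
apply: eq_csw2 => m0 m'; rewrite (csw2_pure _ _ bP); [|by mlin..].
rewrite (hmul1r (cqbP H)) [RHS](linear_sw2 _ _ P); apply: eq_sw2 => m1 m2.
by rewrite [RHS](linearZ_LR (mklin P)) /= ltens_ract_coinv.
Qed.

Let gammaB : {linear resB R -> coinv_mod L} :=
  HB.pack (fun m : resB R => (Coinv (gamma_coinv m) : coinv_mod L))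
    (GRing.isLinear.Build (coinv_alg A)^c (resB R) (coinv_mod L) *:%R
      (fun m : resB R => (Coinv (gamma_coinv m) : coinv_mod L)) gammaB_linear).

Let coret_gamma m : coret A (gamma m) = m.
Proof.
rewrite /gamma (linear_csw2 _ _ (linearP (coret A))).
transitivity (\csw_(m0, m' <- m) ((\sw_(m1, m2, m3 <- m') (beta (Sb m2) * pL (Sb m3) m1)) *: m0)).
  transitivity (\csw_(m0, m' <- m) \sw_(m1, m2 <- m') (beta (Sb m1) *:
    \csw_(m0, m3 <- m0) (pL (Sb m2) m3 *: m0))); last by sweq.
  apply: eq_csw2 => m0 m'; rewrite (linear_sw2 _ _ (linearP (coret A))).
  by apply: eq_sw2 => m1 m2; rewrite linearZ coretE.
transitivity (\csw_(m0, m' <- m) (eps m' *: m0)); last by sweq.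
by apply: eq_csw2 => m0 m'; rewrite sw_pL_Sb.
Qed.

(** Over a Hopf algebra with trivial associator this is n ⊗ h |-> h Sb(n_1) ⊗ n_0. Here [Sb] is
    applied to the product n_1 S(h), since S is not assumed antimultiplicative. *)
Let Xi_fun (n : R) (h : H) : L :=
  \csw_(n0, n1 <- n) \sw_(n1, n2 <- n1) \sw_(h1, h2, h3 <- h) (qR n1 h2 *:
    \sw_(z1, z2 <- n2 ⋅ S h1) (qL (Sb z1) h3 *: ((Sb z2 : V) ⊗ n0))).

Lemma linC_qL1 (U : lmodType k) (f : U -> H) h : linear f -> scalar (fun u => qL (f u) h).
Proof. by move=> fP; rewrite /qL; mlin. Qed.
Lemma linC_qL2 (U : lmodType k) (f : U -> H) m : linear f -> scalar (fun u => qL m (f u)).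
Proof. by move=> fP; rewrite /qL; mlin. Qed.

Ltac mlin_head ::= first [apply: linC_pR1 | apply: linC_pR2
  | apply: linC_qR1 | apply: linC_qR2 | apply: linC_qL1 | apply: linC_qL2
  | exact: (linC_pR2 _ (@linC_id _ _)) | exact: (linC_qR2 _ (@linC_id _ _))
  | exact: (linC_qL2 _ (@linC_id _ _)) | assumption].

Let Xi_balanced : balanced (@kact _ R) (@kscale _ H) Xi_fun.
Proof. by apply: kbalanced; rewrite /Xi_fun; mlin. Qed.

Let Xi : {linear (R ⊗ H)%type -> L} := tlin Xi_balanced.

Let XiE n h : Xi (n ⊗ h) = Xi_fun n h.
Proof. exact: (tlift_pure Xi_balanced). Qed.

Let qL_Sb (x a : H) :
  qL (Sb x) a = \sw_(x1, x2, x3 <- x) (beta (Sb x2) * omega (Sb x3) x1 a).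
Proof.
transitivity (\sw_(g', g3 <- Sb x) \sw_(g1, g2 <- g') (beta g2 * omega g1 (S g3) a)).
  by rewrite /qL; sweq.
rewrite (@sw2_Sb k^o); [|by mlin..].
transitivity (\sw_(x1, x' <- x) \sw_(x2, x3 <- x') (beta (Sb x2) * omega (Sb x3) (S (Sb x1)) a)).
  by apply: eq_sw2 => x1 x'; rewrite (@sw2_Sb k^o) //; mlin.
by apply: eq_sw2 => x1 x'; apply: eq_sw2 => x2 x3; rewrite SbK.
Qed.

Let gamma_ract (m : R) (a : A) : gamma m ◁ a =
  \csw_(m0, m' <- m) \csw_(a0, a1 <- a) \sw_(m1, m2 <- m')
    (qL (Sb m1) a1 *: ((Sb m2 : V) ⊗ (m0 ◁ a0))).
Proof.
have P : linear (fun x : L => x ◁ a) by mlin.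
rewrite /gamma (linear_csw2 _ _ P).
transitivity (\csw_(m0, m' <- m) \csw_(a0, a1 <- a) \sw_(m', m4 <- m')
  ((\sw_(m1, m2, m3 <- m') (beta (Sb m2) * omega (Sb m3) m1 a1)) *:
    ((Sb m4 : V) ⊗ (m0 ◁ a0)))); last first.
  by apply: eq_csw2 => m0 m'; apply: eq_csw2 => a0 a1; apply: eq_sw2 => m1 m2; rewrite qL_Sb.
transitivity (\csw_(m0, m' <- m) \sw_(m1, m2 <- m') (beta (Sb m1) *:
  \sw_(m3, m4 <- m2) \csw_(n0, n1 <- m0) \csw_(a0, a1 <- a)
   (omega (Sb m3) n1 a1 *: ((Sb m4 : V) ⊗ (n0 ◁ a0))))); last by sweq.
apply: eq_csw2 => m0 m'; rewrite (linear_sw2 _ _ P); apply: eq_sw2 => m1 m2.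
rewrite [LHS](linearZ_LR (mklin P)); congr (_ *: _); rewrite /= ltens_ractV sw2_Sb //; by mlin.
Qed.

(** Inside [Sb] the product (m a) S(a) is cancelled by [pR_shift]; the remaining forms combine to
    [qR_pR_left], and the left-over [qL] is the associator of the action on [gamma]. *)
Let Xi_can (m : R) (a : A) : Xi (canM R (pureB (m : resB R) a)) = gamma m ◁ a.
Proof.
rewrite canM_pure (linear_csw2 _ _ (linearP Xi)) gamma_ract.
transitivity (\csw_(m0, m' <- m) \csw_(a0, a' <- a) \sw_(m1, m' <- m')
  \sw_(a1, a', a5, a6 <- a') (qR (m1 ⋅ a1) a5 *:
   (\sw_(m2, m3 <- m') \sw_(a2, a3, a4 <- a') (pR m3 a3 *:
    \sw_(z1, z2 <- (m2 ⋅ a2) ⋅ S a4) (qL (Sb z1) a6 *: ((Sb z2 : V) ⊗ (m0 ◁ a0))))))).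
  transitivity (\csw_(m0, m1 <- m) \csw_(a0, a1 <- a) \sw_(a1, a2 <- a1) (pR m1 a1 *:
    \csw_(n0, n1 <- m0 ◁ a0) \sw_(n1, n2 <- n1) \sw_(h1, h2, h3 <- a2) (qR n1 h2 *:
    \sw_(z1, z2 <- n2 ⋅ S h1) (qL (Sb z1) h3 *: ((Sb z2 : V) ⊗ n0))))); last by sweq.
  apply: eq_csw2 => m0 m1; rewrite (linear_csw2 _ _ (linearP Xi)).
  apply: eq_csw2 => a0 a1; rewrite (linear_sw2 _ _ (linearP Xi)).
  by apply: eq_sw2 => a2 a3; rewrite linearZ XiE.
transitivity (\csw_(m0, m' <- m) \csw_(a0, a' <- a) \sw_(m1, m' <- m')
  \sw_(a1, a', a5, a6 <- a') (qR (m1 ⋅ a1) a5 *: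
   (\sw_(m2, m3 <- m') (pR m2 a' *:
    \sw_(z1, z2 <- m3) (qL (Sb z1) a6 *: ((Sb z2 : V) ⊗ (m0 ◁ a0))))))).
  apply: eq_csw2 => m0 m'; apply: eq_csw2 => a0 a1; apply: eq_sw2 => m1 m2.
  do 2 apply: eq_sw2 => ? ?; apply: eq_sw2 => a5 a6; congr (_ *: _).
  have Q : linear (fun z => \sw_(z1, z2 <- z) (qL (Sb z1) a6 *: ((Sb z2 : V) ⊗ (m0 ◁ a0)))).
    by mlin.
  exact: (pR_shift (mklin Q)).
transitivity (\csw_(m0, m' <- m) \csw_(a0, a' <- a) \sw_(m', m3 <- m')
  \sw_(a', a6 <- a') ((\sw_(m1, m2 <- m') \sw_(a1, a2, a3 <- a') (qR (m1 ⋅ a1) a3 * pR m2 a2)) *: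
    \sw_(z1, z2 <- m3) (qL (Sb z1) a6 *: ((Sb z2 : V) ⊗ (m0 ◁ a0))))); first by sweq.
transitivity (\csw_(m0, m' <- m) \csw_(a0, a' <- a) \sw_(m', m3 <- m')
  \sw_(a', a6 <- a') ((eps m' * eps a') *:
    \sw_(z1, z2 <- m3) (qL (Sb z1) a6 *: ((Sb z2 : V) ⊗ (m0 ◁ a0))))); last by sweq.
apply: eq_csw2 => m0 m'; apply: eq_csw2 => a0 a1; apply: eq_sw2 => m1 m2.
by apply: eq_sw2 => a2 a3; rewrite qR_pR_left.
Qed.

Hypothesis counit_bij : forall M : rel_hopf_module A, bijective (counit_lin M).

(** Since [coret] splits [gamma] over B, tensoring [gammaB] with A remains injective; the counit of
    H ⊗ A is injective by hypothesis, and their composite is [Xi] after [canM]. *)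
Lemma equiv_canM_inj (t : indT (resB R)) : canM R t = 0 -> t = 0.
Proof.
have E : (fun t => counit_lin L (ind_lin gammaB t)) =1 (fun t => Xi (canM R t)).
  apply: ind_ext => [||m a]; [by mlin|by mlin|].
  by rewrite ind_linE counit_linE Xi_can.
move=> t0; have := E t; rewrite t0 linear0 => G0.
have K : (fun t => ind_lin (coretB A) (ind_lin gammaB t)) =1 idfun.
  apply: ind_ext => [||m a]; [by mlin|by mlin|].
  by rewrite !ind_linE; congr (pureB _ _); apply: coret_gamma.
rewrite -[t]K; have -> : ind_lin gammaB t = 0.
  by apply: (bij_inj (counit_bij L)); rewrite G0 linear0.
exact: linear0.
Qed.

Lemma equiv_galois : galois A.
Proof.
apply/canM_regular.
have [g gK] := choice (equiv_can_onto counit_bij).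
exists g => // t; apply: subr0_eq; apply: equiv_canM_inj.
by rewrite linearB gK subrr.
Qed.

End Injective.

Theorem theorem28 (k : fieldType) (H : coquasi_hopf k) (A : comodule_algebra H)
    (S_bij : bijective (antipode H)) :
  (faithfully_flat A /\ galois A) <->
  inverse_equivalences (coinv_functor A) (ind_functor A).
Proof.
rewrite inverse_equivalencesP; split=> [[ff gal]|[cb ub]].
  by split=> [M|N]; [apply: galois_counit_bij|apply: galois_unit_bij].
have [Sb [SK SbK]] := linear_inverse S_bij.
by split; [apply: equiv_faithfully_flat|apply: equiv_galois SK SbK cb].
Qed.
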